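(* Let $G$ be a $4$-light $5$-rooted graph. If $G$ is quite heavy, then $G$ contains a vampire or $K_{2,\downarrow 5}$ as a rooted minor.
   Context: Graphs are finite and simple. A rooted graph is a graph $G$ together with a set $X_G\subseteq V(G)$ of root vertices; it is $m$-rooted if $|X_G|=m$. Rooted minors: a model of a graph $H$ in a graph $G$ is a map $\mu$ assigning to the vertices of $H$ pairwise disjoint non-empty subsets of $V(G)$ inducing connected subgraphs, and to each edge $uv$ of $H$ an edge of $G$ with one end in $\mu(u)$ and the other in $\mu(v)$. A rooted graph $H$ with $|X_H|=|X_G|$ is a rooted minor of a rooted graph $G$ (or $G$ contains $H$ as a rooted minor) if there exist a bijection $\pi:X_H\to X_G$ and a model $\mu$ of $H$ in $G$ such that $\pi(v)\in\mu(v)$ for every $v\in X_H$. Separations and density: for a rooted graph $G$, let $n(G)=|V(G)\setminus X_G|$, let $\rho(G)$ be the number of edges of $G$ that do not have both ends in $X_G$, and let $\rho_4(G)=\rho(G)-4n(G)$. A separation of $G$ is an ordered pair $(A,B)$ with $A\cup B=V(G)$ and no edge between $A\setminus B$ and $B\setminus A$; its order is $|A\cap B|$; it is a root separation if $X_G\subseteq A$. Its right-hand side $R_{A,B}$ is the rooted graph $G[B]$ with root set $A\cap B$. A $k$-rooted graph $G$ is $4$-light if $\rho_4(R_{A,B})\le 0$ for every root separation $(A,B)$ of $G$ of order at most $k-1$. A $5$-rooted graph $G$ is quite heavy if either $\rho_4(G)\ge 2$, or $\rho_4(G)=1$ and no vertex in $V(G)\setminus X_G$ is adjacent to all five roots.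 A vampire is a $7$-vertex $5$-rooted graph $W$ with no edges between roots whose two non-root vertices $p$ and $q$ are adjacent and for which there exist distinct roots $x_1,x_2\in X_W$ such that $p$ is adjacent to every root except possibly $x_2$, and $q$ is adjacent to every root except possibly $x_1$. $K_{2,\downarrow 5}$ is the $7$-vertex $5$-rooted graph with no edges between roots whose two non-root vertices are non-adjacent and are each adjacent to all five roots. *)

(* Defs.v *)
From HB Require Import structures.
From mathcomp Require Import all_boot all_order all_algebra.
Set Implicit Arguments.
Unset Strict Implicit.
Unset Printing Implicit Defensive.
Import Order.TTheory GRing.Theory Num.Theory.
Local Open Scope ring_scope.

Record rooted_graph := RootedGraph {
  vert :> finType;
  adj : rel vert;
  root_set : {set vert};
  adj_sym : symmetric adj;
  adj_irr : irreflexive adj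
}.

Definition rooted (m : nat) (G : rooted_graph) : Prop := #|root_set G| = m.

Definition edges (G : rooted_graph) : {set {set G}} :=
  [set [set x; y] | x in G, y in G & adj x y].

Definition nonroots (G : rooted_graph) : nat := #|~: root_set G|.

Definition rho (G : rooted_graph) : nat :=
  #|[set e in edges G | ~~ (e \subset root_set G)]|.

Definition rho4 (G : rooted_graph) : int := (rho G)%:Z - 4 * (nonroots G)%:Z.

Section RightHandSide.
Variables (G : rooted_graph) (A B : {set G}).

Definition induced_adj : rel {x : G | x \in B} := fun x y => adj (val x) (val y).

Lemma induced_adj_sym : symmetric induced_adj.
Proof. by move=> x y; apply: adj_sym. Qed.

Lemma induced_adj_irr : irreflexive induced_adj.
Proof. by move=> x; apply: adj_irr. Qed.

Definition right_hand_side : rooted_graph :=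
  RootedGraph [set x : {x : G | x \in B} | val x \in A :&: B]
         induced_adj_sym induced_adj_irr.

End RightHandSide.

Definition separation (G : rooted_graph) (A B : {set G}) : Prop :=
  A :|: B = [set: G] /\
  (forall x y, x \in A :\: B -> y \in B :\: A -> ~~ adj x y).

Definition root_separation (G : rooted_graph) (A B : {set G}) : Prop :=
  separation A B /\ root_set G \subset A.

(* "Order at most k - 1" is rendered as "order < k", since natural number
   subtraction is truncated at k = 0. *)
Definition light4 (G : rooted_graph) : Prop :=
  forall A B : {set G}, root_separation A B ->
    (#|A :&: B| < #|root_set G|)%N -> rho4 (right_hand_side A B) <= 0.

Definition quite_heavy (G : rooted_graph) : Prop :=
  2 <= rho4 G \/
  (rho4 G = 1 /\
   ~ exists2 v : G, v \notin root_set G & forall x, x \in root_set G -> adj v x).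

Definition induces_connected (G : rooted_graph) (S : {set G}) : Prop :=
  forall x y, x \in S -> y \in S ->
    connect [rel u v : G | [&& u \in S, v \in S & adj u v]] x y.

Definition model (H G : rooted_graph) (mu : H -> {set G}) : Prop :=
  [/\ forall u, mu u != set0,
      forall u, induces_connected (mu u),
      forall u v, u != v -> [disjoint mu u & mu v] &
      forall u v, adj u v ->
        exists x y : G, [/\ x \in mu u, y \in mu v & adj x y]].

(* A bijection between the root sets is a map of vertices that restricts to
   one; its values outside [root_set H] are irrelevant. *)
Definition rooted_minor (H G : rooted_graph) : Prop :=
  #|root_set H| = #|root_set G| /\
  exists (pi : H -> G) (mu : H -> {set G}),
    [/\ {in root_set H &, injective pi},
        pi @: root_set H = root_set G,
        model mu &
        forall v, v \in root_set H -> pi v \in mu v].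

Definition vampire (W : rooted_graph) : Prop :=
  [/\ #|W| = 7%N,
      rooted 5 W,
      forall x y, x \in root_set W -> y \in root_set W -> ~~ adj x y &
      exists p q : W,
        [/\ ~: root_set W = [set p; q],
            adj p q &
            exists x1 x2 : W,
              [/\ x1 \in root_set W, x2 \in root_set W, x1 != x2,
                  forall x, x \in root_set W -> x != x2 -> adj p x &
                  forall x, x \in root_set W -> x != x1 -> adj q x]]].

Definition K25_adj : rel ('I_2 + 'I_5)%type := fun x y =>
  match x, y with
  | inl _, inr _ | inr _, inl _ => true
  | _, _ => false
  end.

Lemma K25_adj_sym : symmetric K25_adj.
Proof. by case=> x [] y. Qed.

Lemma K25_adj_irr : irreflexive K25_adj.
Proof. by case. Qed.

Definition K2down5 : rooted_graph :=
  RootedGraph [set inr i | i : 'I_5] K25_adj_sym K25_adj_irr.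

(* Main.v *)
From mathcomp Require Import all_boot all_algebra zify.
From Stdlib Require Import Classical.
Require Import Defs.
Set Implicit Arguments.
Unset Strict Implicit.
Unset Printing Implicit Defensive.

(** Write [n = |Y|] for the set [Y] of non-roots, [N(P)] for the neighbourhood
    of [P] and [e(P)] for the number of edges meeting [P]; lightness says
    [e(P) <= 4 |P|] whenever [P] is a set of non-roots with [|N(P)| <= 4].  The
    theorem is proved for every number [k <= 5] of roots at once, in a minimal
    counterexample, where the minors sought ([target]) are a vampire or
    [K_{2,k}].

    If [|N(P)| < k] and [P] already contains the target rooted at [N(P)], then
    [P] can be replaced by a clique on [N(P)] ([|N(P)| <= 3]) or by a vertex
    adjacent to [N(P)] together with two further edges at one root
    ([|N(P)| = 4]); a set violating lightness afterwards gives a larger such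
    [P], so none exists.  With Menger's theorem it follows that no proper [Z]
    with [|N(Z)| = k] is quite heavy.  Hence [Y] is connected, [e(Y) = 4n + 1],
    and contracting an edge keeps the graph light, so every edge meeting [Y] lies
    in at least four triangles (pairs of roots counting as edges).  The degree sum
    then gives a vertex [v] of degree at most 7 whose neighbourhood has at most
    two missing edges at each vertex, and linking the roots to [N(v)] produces
    the target with [v] as one of its two centres. *)

(** * Edge counts and connectivity *)

(** All [k <= 5] are treated together because the induction produces smaller root sets: a minimal
    set violating lightness has at most four neighbours, is light with respect to them, and is quite
    heavy as soon as it is heavy, since no vertex can see five of them. So every modified graph with
    a violator also has one containing a target. The gadgets replacing [P] are priced by
    [e(P) <= 4 |P|]: deleting [P] does not lower the excess [e(Y) - 4n], so a clique on [N(P)] is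
    gained for nothing. A target with four roots need not contain a clique on them; there the new
    vertex pays for itself by its four edges. The exception in the definition of quite heavy is the
    main obstacle. Contracting [uv] may create a vertex that sees all five roots although neither
    end does, and then minimality says nothing about the triangles at [uv]. Such pairs are excluded
    separately: the components of [Y] minus [u] and [v] carry enough excess that some can be joined
    to [u] and others to [v], until each side sees at least four roots. *)

Section Basics.
Variable T : finType.
Implicit Types (g h : rel T) (A B C P Q Z : {set T}) (u v x y : T).

Definition nbrs g u : {set T} := [set y | g u y].

Definition nbhd g Z : {set T} := [set y | (y \notin Z) && [exists x in Z, g x y]].

(** Edges between two vertices outside [Z] are ignored, so for a set [Z] of non-roots [ecount g Z]
    is the quantity [rho] of the right-hand side whose non-roots are [Z]. *)
Definition touching g Z : {set {set T}} :=
  [set [set p.1; p.2] | p in [set p : T * T | (p.1 \in Z) && g p.1 p.2]].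

Definition ecount g Z := #|touching g Z|.

Definition del_verts g P : rel T := fun x y => [&& x \notin P, y \notin P & g x y].

Definition touch g A B := [exists x in A, [exists y in B, g x y]].

(** Connectedness without paths. The empty set qualifies, so non-emptiness of branch sets is always
    a separate condition. *)
Definition conn g A := forall B, B \subset A -> B != set0 ->
  (forall x y, x \in B -> y \in A -> g x y -> y \in B) -> B = A.

(** For symmetric [g] these are the unions of components of [A]. *)
Definition closed_in g A C :=
  C \subset A /\ forall x y, x \in C -> y \in A -> g x y -> y \in C.

Lemma nbhdP g Z y :
  reflect (y \notin Z /\ exists2 x, x \in Z & g x y) (y \in nbhd g Z).
Proof.
rewrite inE; apply: (iffP andP) => -[yZ].
  by move/existsP=> [x /andP[xZ gxy]]; split=> //; exists x.
by move=> [x xZ gxy]; split=> //; apply/existsP; exists x; rewrite xZ.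
Qed.

Lemma nbrsE g u y : (y \in nbrs g u) = g u y.
Proof. by rewrite inE. Qed.

Lemma touchP g A B :
  reflect (exists x y, [/\ x \in A, y \in B & g x y]) (touch g A B).
Proof.
apply: (iffP existsP) => [[x /andP[xA /existsP[y /andP[yB gxy]]]]|[x [y [xA yB gxy]]]].
  by exists x, y.
by exists x; rewrite xA; apply/existsP; exists y; rewrite yB.
Qed.

Lemma touch_sub g A B A' B' :
  A \subset A' -> B \subset B' -> touch g A B -> touch g A' B'.
Proof.
move=> /subsetP sA /subsetP sB /touchP[x [y [xA yB gxy]]].
by apply/touchP; exists x, y; split; auto.
Qed.

Lemma touch_sym g A B : symmetric g -> touch g A B = touch g B A.
Proof.
by move=> gS; apply/touchP/touchP=> -[x [y [xA yB gxy]]]; exists y, x;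
  rewrite gS.
Qed.

Lemma del_verts_sym g P : symmetric g -> symmetric (del_verts g P).
Proof. by move=> gS x y; rewrite /del_verts gS andbCA. Qed.

Lemma del_verts_irr g P : irreflexive g -> irreflexive (del_verts g P).
Proof. by move=> gI x; rewrite /del_verts gI !andbF. Qed.

Lemma touchingP g Z e :
  reflect (exists x y, [/\ x \in Z, g x y & e = [set x; y]]) (e \in touching g Z).
Proof.
apply: (iffP imsetP) => [[[x y] /=]|[x [y [xZ gxy ->]]]].
  by rewrite inE /= => /andP[xZ gxy] ->; exists x, y.
by exists (x, y); rewrite ?inE /= ?xZ.
Qed.

Lemma set2_eqP x y a b : [set x; y] = [set a; b] ->
  (x = a /\ y = b) \/ (x = b /\ y = a).
Proof.
move=> E.
have := set21 x y; have := set22 x y; rewrite E !inE.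
have := set21 a b; have := set22 a b; rewrite -E !inE.
do 4!(case/orP=> /eqP ?); subst; by [left|right].
Qed.

Lemma touching_edge g Z x y : symmetric g ->
  ([set x; y] \in touching g Z) = g x y && ((x \in Z) || (y \in Z)).
Proof.
move=> gS; apply/touchingP/andP.
  move=> [a [b [aZ gab /set2_eqP[[-> ->]|[-> ->]]]]]; first by rewrite gab aZ.
  by rewrite gS gab aZ orbT.
move=> [gxy /orP[xZ|yZ]]; first by exists x, y.
by exists y, x; rewrite gS setUC.
Qed.

Lemma ecount_set0 g : ecount g set0 = 0.
Proof.
apply/eqP; rewrite cards_eq0; apply/eqP/setP=> e; rewrite inE.
by apply/touchingP=> -[x [y [xZ _ _]]]; rewrite inE in xZ.
Qed.

Lemma ecount_le g h Z : (forall x y, x \in Z -> g x y -> h x y) -> ecount g Z <= ecount h Z.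
Proof.
move=> sub; apply/subset_leq_card/subsetP=> e /touchingP[x [y [xZ gxy ->]]].
by apply/touchingP; exists x, y; split=> //; exact: sub.
Qed.

Lemma ecount_ext g h Z : (forall x y, x \in Z -> g x y = h x y) -> ecount g Z = ecount h Z.
Proof.
by move=> E; apply/eqP; rewrite eqn_leq !ecount_le // => x y xZ; rewrite E.
Qed.

Lemma ecount_lt g h Z x y : symmetric g -> symmetric h ->
  (forall x y, x \in Z -> g x y -> h x y) ->
  x \in Z -> h x y -> ~~ g x y -> ecount g Z < ecount h Z.
Proof.
move=> gS hS sub xZ hxy ngxy; apply: proper_card; apply/properP; split.
  apply/subsetP=> e /touchingP[a [b [aZ gab ->]]].
  by apply/touchingP; exists a, b; split=> //; exact: sub.
by exists [set x; y]; rewrite touching_edge // ?hxy ?xZ // (negPf ngxy).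
Qed.

Lemma ecount_U g A B : symmetric g -> [disjoint A & B] ->
  (forall x y, x \in A -> y \in B -> ~~ g x y) ->
  ecount g (A :|: B) = ecount g A + ecount g B.
Proof.
move=> gS dis nAB; rewrite /ecount.
have -> : touching g (A :|: B) = touching g A :|: touching g B.
  apply/setP=> e; rewrite inE; apply/touchingP/orP.
    move=> [x [y [xAB gxy ->]]]; rewrite !touching_edge // gxy /=.
    by move: xAB; rewrite inE => /orP[->|->]; [left|right].
  case=> /touchingP[x [y [xA gxy ->]]]; exists x, y; rewrite inE xA ?orbT; by [].
rewrite cardsU; suff -> : touching g A :&: touching g B = set0 by rewrite cards0 subn0.
apply/setP=> e; rewrite !inE; apply/negP=> /andP[/touchingP[x [y [xA gxy ->]]]].
rewrite touching_edge // gxy /= => /orP[xB|yB].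
  by move: (disjointFr dis xA); rewrite xB.
by move: (nAB x y xA yB); rewrite gxy.
Qed.

Lemma ecount_del g Z P : symmetric g -> [disjoint Z & P] ->
  ecount g (Z :|: P) = ecount g P + ecount (del_verts g P) Z.
Proof.
move=> gS dis; rewrite /ecount.
have dS := del_verts_sym P gS.
have -> : touching g (Z :|: P) = touching g P :|: touching (del_verts g P) Z.
  apply/setP=> e; rewrite inE; apply/touchingP/orP.
    move=> [x [y [xZP gxy ->]]]; rewrite !touching_edge // gxy /= /del_verts gxy andbT.
    move: xZP; rewrite inE.
    by case: (x \in P); case: (y \in P); rewrite ?orbF ?orbT /= => H; auto; rewrite H; auto.
  case=> /touchingP[x [y [xA gxy ->]]]; exists x, y; rewrite inE xA ?orbT //.
  by case/and3P: gxy.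
rewrite cardsU; suff -> : touching g P :&: touching (del_verts g P) Z = set0
  by rewrite cards0 subn0.
apply/setP=> e; rewrite !inE; apply/negP=> /andP[/touchingP[x [y [xA gxy ->]]]].
by rewrite touching_edge // /del_verts xA.
Qed.

Lemma ecount1 g u : symmetric g -> irreflexive g -> ecount g [set u] = #|nbrs g u|.
Proof.
move=> gS gI; rewrite /ecount.
have -> : touching g [set u] = [set [set u; y] | y in nbrs g u].
  apply/setP=> e; apply/touchingP/imsetP.
    by move=> [x [y [/set1P-> gxy ->]]]; exists y; rewrite ?inE.
  by move=> [y]; rewrite inE => guy ->; exists u, y; rewrite inE eqxx.
rewrite card_in_imset // => y z; rewrite !inE => guy guz /set2_eqP[[]//|[E1 E2]].
by move: guz; rewrite -E1 gI.
Qed.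

Lemma ecount_add1 g u Z : symmetric g -> irreflexive g -> u \notin Z ->
  ecount g (u |: Z) = ecount g Z + #|nbrs g u :\: Z|.
Proof.
move=> gS gI uZ; rewrite ecount_del // ?disjoints1 //.
rewrite ecount1; [|exact: del_verts_sym|exact: del_verts_irr].
congr (_ + #|pred_of_set _|); apply/setP=> y; rewrite !inE /del_verts uZ /=; by [].
Qed.

Lemma ecount_rem1 g u Z : symmetric g -> irreflexive g -> u \in Z ->
  ecount g Z = ecount g (Z :\ u) + #|nbrs g u :\: Z|.
Proof.
move=> gS gI uZ; rewrite -{1}(setD1K uZ) ecount_add1 ?inE ?eqxx //.
congr (_ + #|pred_of_set _|); apply/setP=> y; rewrite !inE.
by case: (y =P u) => // ->; rewrite gI !andbF.
Qed.

(** An edge inside [Z] is met from both of its ends; an edge leaving [Z] is met once as part of a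
    degree and once by the second summand. *)
Lemma degree_sum g Z : symmetric g -> irreflexive g ->
  \sum_(y in Z) (#|nbrs g y| + #|nbrs g y :\: Z|) = 2 * ecount g Z.
Proof.
move=> gS gI; move: {2}(#|Z|) (erefl #|Z|) => n; elim: n Z => [|n IH] Z cZ.
  by move/cards0_eq: cZ => ->; rewrite big_set0 ecount_set0.
have /card_gt0P[u uZ] : 0 < #|Z| by rewrite cZ.
have cZ' : #|Z :\ u| = n by move: cZ; rewrite (cardsD1 u) uZ => -[].
rewrite (ecount_rem1 gS gI uZ) (big_setD1 u) //= mulnDr -(IH _ cZ').
have -> : \sum_(i in Z :\ u) (#|nbrs g i| + #|nbrs g i :\: (Z :\ u)|) =
   \sum_(i in Z :\ u) (#|nbrs g i| + #|nbrs g i :\: Z|) + \sum_(i in Z :\ u) g u i.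
  rewrite -big_split /=; apply: eq_bigr => i; rewrite !inE => /andP[iu iZ].
  rewrite -addnA; congr (_ + _).
  rewrite (cardsD1 u (nbrs g i :\: (Z :\ u))) !inE eqxx /= gS addnC.
  congr (#|pred_of_set _| + _); apply/setP=> y; rewrite !inE.
  by case: (y =P u) => // ->; rewrite uZ.
have -> : \sum_(i in Z :\ u) g u i = #|nbrs g u :&: Z|.
  rewrite -sum1_card big_mkcond [RHS]big_mkcond /=; apply: eq_bigr => i _.
  by rewrite !inE; case: eqP => [->|_]; rewrite ?gI //=; case: (i \in Z); case: (g u i).
have := cardsID Z (nbrs g u); lia.
Qed.

Lemma nbhd_ext g h Z : (forall x y, x \in Z -> g x y = h x y) -> nbhd g Z = nbhd h Z.
Proof.
move=> E; apply/setP=> y; apply/nbhdP/nbhdP=> -[yZ [x xZ gxy]]; split=> //; exists x=> //.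
  by rewrite -E.
by rewrite E.
Qed.

Lemma nbhd_notin g Z x : x \in nbhd g Z -> x \notin Z.
Proof. by case/nbhdP. Qed.

Lemma conn1 g u : conn g [set u].
Proof.
move=> B; rewrite subset1 => /orP[/eqP //|/eqP ->]; by rewrite eqxx.
Qed.

Lemma conn_mono g h A : (forall x y, x \in A -> y \in A -> g x y -> h x y) ->
  conn g A -> conn h A.
Proof.
move=> sub cA B sB B0 cl; apply: cA => // x y xB yA gxy.
by apply: (cl x) => //; apply: sub => //; exact: (subsetP sB).
Qed.

Lemma conn_bigcup g h A (F : T -> {set T}) :
  conn h A -> (forall x, x \in A -> conn g (F x)) ->
  (forall x, x \in A -> F x != set0) ->
  (forall x y, x \in A -> y \in A -> h x y -> touch g (F x) (F y)) ->
  conn g (\bigcup_(x in A) F x).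
Proof.
move=> cA cF F0 tF B sB B0 cl.
have full x : x \in A -> B :&: F x != set0 -> F x \subset B.
  move=> xA BF; rewrite -(cF x xA (B :&: F x) _ BF) ?subsetIl ?subsetIr //.
  move=> a b; rewrite !inE => /andP[aB aF] bF gab; rewrite bF andbT.
  by apply: (cl a) => //; apply/bigcupP; exists x.
have DA : [set x in A | F x \subset B] = A.
  apply: cA.
  - by apply/subsetP=> x; rewrite inE => /andP[].
  - have /set0Pn[b bB] := B0.
    have /bigcupP[x xA bF] := subsetP sB b bB.
    apply/set0Pn; exists x; rewrite inE xA full //.
    by apply/set0Pn; exists b; rewrite inE bB.
  move=> x y; rewrite !inE => /andP[xA xB] yA hxy; rewrite yA /=.
  apply: full => //.
  have /touchP[a [b [aF bF gab]]] := tF x y xA yA hxy.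
  apply/set0Pn; exists b; rewrite inE bF andbT; apply: (cl a) => //.
    exact: (subsetP xB).
  by apply/bigcupP; exists y.
apply/eqP; rewrite eqEsubset sB /=; apply/bigcupsP=> x.
by rewrite -{1}DA inE => /andP[].
Qed.

Lemma conn_meet g A B : conn g A -> conn g B -> A :&: B != set0 ->
  conn g (A :|: B).
Proof.
move=> cA cB /set0Pn[z]; rewrite inE => /andP[zA zB] C sC C0 cl.
have half (D : {set T}) : D \subset A :|: B -> conn g D -> C :&: D != set0 -> D \subset C.
  move=> sD cD CD; rewrite -(cD (C :&: D) _ CD) ?subsetIl ?subsetIr //.
  move=> a b; rewrite !inE => /andP[aC aD] bD gab; rewrite bD andbT.
  by apply: (cl a) => //; exact: (subsetP sD).
have hA := half _ (subsetUl A B) cA; have hB := half _ (subsetUr A B) cB.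
apply/eqP; rewrite eqEsubset sC subUset.
have /set0Pn[c cC] := C0.
have := subsetP sC c cC; rewrite inE => /orP[cA'|cB'].
  have sA : A \subset C by apply: hA; apply/set0Pn; exists c; rewrite inE cC.
  rewrite sA; apply: hB; apply/set0Pn; exists z; rewrite inE zB andbT.
  exact: (subsetP sA).
have sB : B \subset C by apply: hB; apply/set0Pn; exists c; rewrite inE cC.
rewrite sB andbT; apply: hA; apply/set0Pn; exists z; rewrite inE zA andbT.
exact: (subsetP sB).
Qed.

Lemma conn2 g x y : symmetric g -> g x y -> conn g [set x; y].
Proof.
move=> gS gxy C sC C0 cl.
have xy : x \in C -> y \in C by move=> xC; apply: (cl x) => //; exact: set22.
have yx : y \in C -> x \in C by move=> yC; apply: (cl y); rewrite ?set21 // gS.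
apply/eqP; rewrite eqEsubset sC; have /set0Pn[z zC] := C0.
have := subsetP sC z zC; rewrite !inE => /orP[]/eqP zE; subst z;
  apply/subsetP=> w; rewrite !inE => /orP[]/eqP ->; auto.
Qed.

Lemma connU g A B : symmetric g -> conn g A -> conn g B -> touch g A B ->
  conn g (A :|: B).
Proof.
move=> gS cA cB /touchP[a [b [aA bB gab]]].
have c2 : conn g (A :|: [set a; b]).
  by apply: conn_meet cA (conn2 gS gab) _; apply/set0Pn; exists a; rewrite !inE aA eqxx.
have -> : A :|: B = (A :|: [set a; b]) :|: B.
  apply/setP=> z; rewrite !inE.
  by case: eqP => [->|_]; rewrite ?aA //; case: eqP => [->|_]; rewrite ?bB ?orbT ?orbF.
by apply: conn_meet c2 cB _; apply/set0Pn; exists b; rewrite !inE eqxx bB !orbT.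
Qed.

Lemma connU1 g u A : symmetric g -> conn g A -> u \in nbhd g A -> conn g (u |: A).
Proof.
move=> gS cA /nbhdP[_ [x xA gxu]]; apply: connU => //; first exact: conn1.
by apply/touchP; exists u, x; rewrite inE gS.
Qed.

Lemma closedD g A C : symmetric g -> closed_in g A C -> closed_in g A (A :\: C).
Proof.
move=> gS [sC cl]; split; first exact: subsetDl.
move=> x y; rewrite !inE => /andP[xC xA] yA gxy; rewrite yA andbT.
by apply: contra xC => yC; apply: (cl y) => //; rewrite gS.
Qed.

Lemma closed_trans g A C B : closed_in g A C -> closed_in g C B -> closed_in g A B.
Proof.
move=> [sC clC] [sB clB]; split; first exact: subset_trans sC.
move=> x y xB yA gxy; apply: (clB x) => //; apply: (clC x) => //.
exact: (subsetP sB).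
Qed.

Lemma min_set (R : {set T} -> Prop) : (exists A, R A) ->
  exists2 A, R A & forall B, R B -> B \subset A -> B = A.
Proof.
move=> [A RA]; move: {2}(#|A|).+1 (ltnSn #|A|) => n.
elim: n A RA => // n IH A RA An.
case: (classic (exists2 B, R B & B \proper A)) => [[B RB BA]|no].
  by apply: (IH B) => //; apply: leq_trans (proper_card BA) _.
exists A => // B RB; rewrite subEproper => /orP[/eqP//|pBA].
by case: no; exists B.
Qed.

Lemma max_set (R : {set T} -> Prop) : (exists A, R A) ->
  exists2 A, R A & forall B, R B -> A \subset B -> B = A.
Proof.
move=> [A RA].
have [|D RD mD] := @min_set (fun B => R (~: B)).
  by exists (~: A); rewrite setCK.
exists (~: D) => // B RB sB.
rewrite -(mD (~: B)) ?setCK //; by rewrite -setCS setCK.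
Qed.

Lemma comp_ex g A u : symmetric g -> u \in A ->
  exists C, [/\ u \in C, conn g C & closed_in g A C].
Proof.
move=> gS uA.
have [|C [uC clC] mC] := @min_set (fun C => u \in C /\ closed_in g A C).
  by exists A; split=> //; split.
exists C; split=> // B sB B0 clB.
have cB : closed_in g A B by apply: closed_trans clC _; split.
have cD : closed_in g A (C :\: B).
  by apply: closed_trans clC _; apply: closedD => //; split.
case: (boolP (u \in B)) => uB; first exact: mC.
have E : C :\: B = C by apply: mC; rewrite ?subsetDl //; split=> //; rewrite inE uB.
have /set0Pn[b bB] := B0.
by have := subsetP sB b bB; rewrite -E inE bB.
Qed.

Lemma ecount_closed g A C : symmetric g -> closed_in g A C ->
  ecount g A = ecount g C + ecount g (A :\: C).
Proof.
move=> gS [sC cl]; rewrite -ecount_U //.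
- by rewrite setUC -{1}(setID A C) setUC (setIidPr sC).
- by rewrite disjoints_subset; apply/subsetP=> x xC; rewrite !inE xC.
move=> x y xC; rewrite inE => /andP[yC yA]; apply: contra yC; exact: cl.
Qed.

(** Edges and vertices both add up over components, so the excess over four edges per vertex is
    positive on one of them. A minimal heavy closed set is connected, because one of the two parts
    of a splitting would again be heavy. *)
Lemma heavy_comp g A : symmetric g -> 4 * #|A| < ecount g A ->
  exists C, [/\ conn g C, closed_in g A C, C != set0 & 4 * #|C| < ecount g C].
Proof.
move=> gS hA.
have [|C [clC hC] mC] := @min_set (fun C => closed_in g A C /\ 4 * #|C| < ecount g C).
  by exists A; split=> //; split.
have C0 : C != set0 by apply: contraTneq hC => ->; rewrite ecount_set0.
exists C; split=> // B sB B0 clB.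
have clBC : closed_in g C B by [].
have eC := ecount_closed gS clBC.
have cB := cardsD C B; rewrite (setIidPr sB) in cB.
have lB := subset_leq_card sB.
case: (ltnP (4 * #|B|) (ecount g B)) => hB.
  by apply: mC => //; split=> //; apply: closed_trans clC _.
have E : C :\: B = C.
  apply: mC; last exact: subsetDl.
  split; first by apply: closed_trans clC _; exact: closedD.
  lia.
have /set0Pn[b bB] := B0.
by have := subsetP sB b bB; rewrite -E inE bB.
Qed.

(** Every component of [A] minus [R] is attached to [R], so what is left after removing some of them
    hangs together through [R]. *)
Lemma conn_compl g A R C : symmetric g -> conn g A -> conn g R -> R != set0 ->
  R \subset A -> closed_in g (A :\: R) C -> conn g (A :\: C).
Proof.
move=> gS cA cR R0 sR [sC clC] B sB B0 clB.
have key (D : {set T}) : D \subset A :\: C -> D != set0 ->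
   (forall x y, x \in D -> y \in A :\: C -> g x y -> y \in D) -> R :&: D != set0.
  move=> sD D0 clD; apply/negP=> /eqP RD.
  have DA : D = A.
    apply: cA => //; first exact: subset_trans sD (subsetDl _ _).
    move=> x y xD yA gxy; apply: (clD x) => //; rewrite inE yA andbT.
    have xR : x \notin R.
      by apply/negP=> xR; have := in_set0 x; rewrite -RD inE xR xD.
    have := subsetP sD x xD; rewrite inE => /andP[xC xA].
    by apply: contra xC => yC; apply: (clC y) => //; rewrite ?inE ?xR // gS.
  have /set0Pn[r rR] := R0.
  have := in_set0 r; rewrite -RD inE rR DA (subsetP sR) //.
have sRC : R \subset A :\: C.
  apply/subsetP=> r rR; rewrite inE (subsetP sR) // andbT.
  by apply/negP=> rC; have := subsetP sC r rC; rewrite inE rR.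
have RB : R \subset B.
  rewrite -(cR (R :&: B)) ?subsetIl ?subsetIr //; first exact: key.
  move=> x y; rewrite !inE => /andP[xR xB] yR gxy; rewrite yR /=.
  by apply: (clB x) => //; exact: (subsetP sRC).
apply/eqP; rewrite eqEsubset sB /= -setD_eq0; apply/negPn/negP=> D0.
have clD x y : x \in (A :\: C) :\: B -> y \in A :\: C -> g x y -> y \in (A :\: C) :\: B.
  rewrite !(inE, in_setD) => /and3P[xB xC xA] /andP[yC yA] gxy.
  rewrite yC yA !andbT; apply: contra xB => yB; apply: (clB y) => //.
    by rewrite inE xC.
  by rewrite gS.
have /set0Pn[x] := key _ (subsetDl _ _) D0 clD.
rewrite !inE => /and3P[xR xB _].
by rewrite (subsetP RB) in xB.
Qed.

End Basics.

(** * The target and Menger's theorem *)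

Section Target.
Variable T : finType.
Implicit Types (g h : rel T) (A B C P Q S Y Z W : {set T}) (u v x y s : T).

Definition rooted_model g Y S (p q : {set T}) (M : T -> {set T}) : Prop :=
  [/\ [/\ p != set0, q != set0, p \subset Y, q \subset Y & [disjoint p & q]],
      conn g p /\ conn g q,
      forall s, s \in S -> [/\ s \in M s, M s \subset s |: Y, conn g (M s),
                               [disjoint p & M s] & [disjoint q & M s]] &
      forall s s', s \in S -> s' \in S -> s != s' -> [disjoint M s & M s']].

(* The vertices a and b play the roles of x2 and x1 in the definition of a
   vampire; they need not be roots, so that fewer than two roots are allowed. *)
Definition fanged g S (p q : {set T}) (M : T -> {set T}) : Prop :=
  exists a b, [/\ a != b,
    forall s, s \in S -> s != a -> touch g p (M s),
    forall s, s \in S -> s != b -> touch g q (M s) &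
    touch g p q \/ forall s, s \in S -> touch g p (M s) /\ touch g q (M s)].

Definition target g Y S : Prop :=
  exists p q M, rooted_model g Y S p q M /\ fanged g S p q M.

Lemma disjointP A B : reflect (forall x, x \in A -> x \in B -> False) [disjoint A & B].
Proof.
apply: (iffP pred0P) => [H x xA xB|H x /=]; first by have := H x; rewrite /= xA xB.
by apply/negP=> /andP[xA xB]; exact: H xA xB.
Qed.

Lemma target_mono g h Y S : (forall x y, g x y -> h x y) -> target g Y S -> target h Y S.
Proof.
move=> sub [p [q [M [[H1 [cp cq] H2 H3] [a [b [ab pa qb pq]]]]]]].
have tt A B : touch g A B -> touch h A B.
  by move/touchP=> [x [y [xA yB gxy]]]; apply/touchP; exists x, y; split; auto.
have cc A : conn g A -> conn h A by apply: conn_mono; auto.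
exists p, q, M; split.
  by split; auto => s sS; have [? ? ? ? ?] := H2 s sS; split; auto.
exists a, b; split=> //; [by auto|by auto|].
case: pq => [pq|all]; [left|right]; first exact: tt.
by move=> s /all[? ?]; auto.
Qed.

Section Transfer.
Variables (g h : rel T) (Y Y' S S' : {set T}) (F : T -> {set T}) (f : T -> T).
Hypotheses (gS : symmetric g) (hS : symmetric h) (hI : irreflexive h).
Let D := Y' :|: f @: S.
Hypotheses (fS : forall s, s \in S -> f s \in S') (f_inj : {in S &, injective f}).
Hypotheses (FD : forall x, x \in D -> F x != set0 /\ conn g (F x)).
Hypotheses (FY : forall y, y \in Y' -> F y \subset Y).
Hypotheses (FS : forall s, s \in S -> s \in F (f s) /\ F (f s) \subset s |: Y).
Hypotheses (Fdis : forall x y, x \in D -> y \in D -> x != y -> [disjoint F x & F y]).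
Hypotheses (Ft : forall x y, x \in Y' -> y \in D -> h x y -> touch g (F x) (F y)).

(** [F] expands vertices of [h] to branch sets in [g], and [f s] is the root of [h] that stands for
    [s]. Roots of [h] outside the image of [f] are dropped, so [S'] may be larger than [S].
    Adjacencies between roots of [h] need not be realised, because a branch set contains at most one
    root. *)
Lemma target_transfer : target h Y' S' -> target g Y S.
Proof.
move=> [p [q [M [[[p0 q0 pY qY dpq] [cp cq] HM dM] [a [b [ab pa qb pq]]]]]]].
pose U (A : {set T}) := \bigcup_(x in A) F x.
have YD : Y' \subset D by apply: subsetUl.
have fD s : s \in S -> f s \in D by move=> sS; rewrite inE imset_f // orbT.
have MD s : s \in S -> M (f s) \subset D.
  move=> sS; have [_ sM _ _ _] := HM _ (fS sS); apply: subset_trans sM _.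
  by rewrite subUset sub1set fD.
have cU A s : A \subset D -> A \subset s |: Y' -> conn h A -> conn g (U A).
  move=> /subsetP AD sA cA.
  apply: conn_bigcup cA _ _ _ => [x /AD/FD[]//|x /AD/FD[]//|x y xA yA hxy].
  have := subsetP sA x xA; rewrite in_setU1 => /orP[/eqP xs|xY]; last first.
    by apply: Ft => //; exact: AD.
  rewrite touch_sym //; apply: Ft; [|exact: AD|by rewrite hS].
  have := subsetP sA y yA; rewrite in_setU1 => /orP[/eqP ys|//].
  by move: hxy; rewrite xs ys hI.
have UD A B : A \subset D -> B \subset D -> [disjoint A & B] -> [disjoint U A & U B].
  move=> /subsetP sA /subsetP sB /disjointP dAB.
  apply/disjointP=> z /bigcupP[x xA zx] /bigcupP[y yB zy].
  case: (x =P y) => [E|/eqP xy]; first by apply: (dAB x) => //; rewrite E.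
  by have /disjointP := Fdis (sA _ xA) (sB _ yB) xy; move/(_ z zx zy).
have Ut A B : A \subset Y' -> B \subset D -> touch h A B -> touch g (U A) (U B).
  move=> sA sB /touchP[x [y [xA yB hxy]]].
  apply: touch_sub (Ft (subsetP sA _ xA) (subsetP sB _ yB) hxy);
    exact: bigcup_sup.
have U0 A : A \subset D -> A != set0 -> U A != set0.
  move=> sA /set0Pn[x xA]; have [/set0Pn[z zx] _] := FD (subsetP sA x xA).
  by apply/set0Pn; exists z; apply/bigcupP; exists x.
have UY A : A \subset Y' -> U A \subset Y.
  by move=> sA; apply/bigcupsP=> x xA; apply: FY; exact: (subsetP sA).
have [pD qD] : p \subset D /\ q \subset D by split; apply: subset_trans YD.
exists (U p), (U q), (fun s => U (M (f s))).
have sM s : s \in S -> s \in U (M (f s)).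
  move=> sS; apply/bigcupP; exists (f s); last by have [] := FS sS.
  by have [] := HM _ (fS sS).
have pU s : s \in S -> [disjoint U p & U (M (f s))].
  by move=> sS; apply: UD; auto; have [] := HM _ (fS sS).
have qU s : s \in S -> [disjoint U q & U (M (f s))].
  by move=> sS; apply: UD; auto; have [] := HM _ (fS sS).
have /set0Pn[x0 x0p] := U0 p pD p0; have /set0Pn[y0 y0q] := U0 q qD q0.
have nx0 s : s \in S -> s != x0.
  move=> sS; apply/eqP=> E; have /disjointP/(_ x0 x0p) := pU s sS.
  by case; rewrite -E; exact: sM.
have ny0 s : s \in S -> s != y0.
  move=> sS; apply/eqP=> E; have /disjointP/(_ y0 y0q) := qU s sS.
  by case; rewrite -E; exact: sM.
split; first split.
- by split; auto.
- by split; apply: (@cU _ x0); rewrite // subsetU ?pY ?qY ?orbT.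
- move=> s sS; have [sM' MY cM dpM dqM] := HM _ (fS sS).
  split; auto; last by apply: (@cU _ (f s)); auto.
  apply/bigcupsP=> x xM; have := subsetP MY x xM; rewrite in_setU1.
  case/orP=> [/eqP->|xY]; first by have [] := FS sS.
  by apply: subset_trans (FY xY) _; rewrite subsetU // subxx orbT.
- move=> s s' sS s'S ss'; apply: UD; auto; apply: dM; auto.
  by apply: contra ss' => /eqP/f_inj->.
(* The exceptional vertices are pulled back along [f]. One without a preimage is replaced by a
   filler in [U p] or [U q]: it lies outside [S], and the two fillers differ because these sets are
   disjoint. *)
pose pre c z := if [pick s in S | f s == c] is Some s then s else z.
have preP c z s : s \in S -> s != pre c z -> f s != c.
  rewrite /pre => sS; case: pickP => [r /andP[rS /eqP fr]|no _].
    by apply: contra => /eqP fs; apply/eqP/f_inj => //; rewrite fr.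
  by have := no s; rewrite sS /= => ->.
exists (pre a x0), (pre b y0); split.
- rewrite /pre; case: pickP => [r /andP[rS /eqP fr]|_];
    case: pickP => [r' /andP[r'S /eqP fr']|_].
  + by apply: contra ab => /eqP rr; rewrite -fr -fr' rr.
  + exact: ny0.
  + by rewrite eq_sym; exact: nx0.
  apply/eqP=> E; have /disjointP/(_ x0 x0p) := UD _ _ pD qD dpq; case.
  by rewrite E.
- by move=> s sS /(preP _ _ _ sS) sa; apply: Ut; auto.
- by move=> s sS /(preP _ _ _ sS) sa; apply: Ut; auto.
case: pq => [pq|all]; [left; exact: Ut|right=> s sS].
by have [tp tq] := all _ (fS sS); split; apply: Ut; auto.
Qed.

End Transfer.

(** A system of disjoint paths from [nbhd g W] to [nbhd g Z], weakened to connected sets; [t s] is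
    the end of the path that starts at [s]. *)
Definition linked g Z W (M : T -> {set T}) (t : T -> T) : Prop :=
  (forall s, s \in nbhd g W -> [/\ s \in M s, conn g (M s),
     M s \subset s |: (W :\: Z) & M s :&: nbhd g Z = [set t s]]) /\
  (forall s s', s \in nbhd g W -> s' \in nbhd g W -> s != s' -> [disjoint M s & M s']).

Lemma nbhd_sub_setU g Z W : Z \subset W -> nbhd g Z \subset W :|: nbhd g W.
Proof.
move=> /subsetP sZ; apply/subsetP=> y /nbhdP[yZ [x xZ gxy]].
rewrite inE; case yW: (y \in W) => //=; apply/nbhdP; split; rewrite ?yW //.
by exists x; auto.
Qed.

Lemma nbhd_del1 g s Z : s \notin Z -> nbhd (del_verts g [set s]) Z = nbhd g Z :\ s.
Proof.
move=> sZ; apply/setP=> y; rewrite in_setD1; apply/nbhdP/andP.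
  move=> [yZ [x xZ /and3P[_ ys gxy]]]; rewrite inE in ys; split=> //.
  by apply/nbhdP; split=> //; exists x.
move=> [ys /nbhdP[yZ [x xZ gxy]]]; split=> //; exists x => //; rewrite /del_verts !inE ys gxy.
by rewrite /= andbT; apply: contra sZ => /eqP <-.
Qed.

(** The vertex form of Menger's theorem, by induction on [W :\: Z]: no set between [Z] and [W] has
    fewer neighbours than [W]. Either a tight set strictly in between splits the problem, or a
    vertex [s] of [nbhd g W] is deleted and its path made to start at a neighbour [u] in [W]. *)
Lemma menger g Z W : symmetric g -> Z \subset W ->
  (forall W', Z \subset W' -> W' \subset W -> #|nbhd g W| <= #|nbhd g W'|) ->
  exists M t, linked g Z W M t.
Proof.
move: {2}(#|W :\: Z|).+1 (ltnSn #|W :\: Z|) => n.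
elim: n g Z W => // n IH g Z W lt_n gS sZW minW.
case: (boolP (nbhd g W \subset nbhd g Z)) => [sub|].
  exists (fun s => [set s]), id; split=> [s sW|s s' _ _ ss'].
    split; rewrite ?set11 ?subsetUl //; first exact: conn1.
    by apply/setIidPl; rewrite sub1set; exact: (subsetP sub).
  by rewrite disjoints1 inE.
move=> /subsetPn[s sW sZ].
have sNW := nbhd_notin sW.
have /nbhdP[_ [u uW gus]] := sW.
have uZ : u \notin Z.
  apply: contra sZ => uZ; apply/nbhdP; split; last by exists u.
  by apply: contra sNW; exact: (subsetP sZW).
(* With a tight set [W'], the paths from [nbhd g W] to [nbhd g W'] and those from there to
   [nbhd g Z] are glued; they meet only at the gluing vertices, since the former avoid [W'] and the
   latter run inside it after their first vertex. *)
case: (classic (exists W', [/\ Z \proper W', W' \proper W & #|nbhd g W'| = #|nbhd g W|])).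
  move=> [W' [ZW' W'W cW']].
  have sZW' := proper_sub ZW'; have sW'W := proper_sub W'W.
  have [| |M1 [t1 [L1 D1]]] := IH g Z W' _ gS sZW'.
  - apply: leq_trans (proper_card _) lt_n.
    rewrite properEneq setSD // andbT; apply/eqP=> E.
    have /properP[_ [x xW xW']] := W'W.
    have : x \in W :\: Z by rewrite inE xW andbT; apply: contra xW'; exact: (subsetP sZW').
    by rewrite -E inE (negPf xW') andbF.
  - by move=> W2 s1 s2; rewrite cW'; apply: minW => //; exact: subset_trans sW'W.
  have [| |M2 [t2 [L2 D2]]] := IH g W' W _ gS sW'W.
  - apply: leq_trans (proper_card _) lt_n.
    rewrite properEneq setDS // andbT; apply/eqP=> E.
    have /properP[_ [x xW' xZ]] := ZW'.
    have : x \in W :\: Z by rewrite inE xZ (subsetP sW'W).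
    by rewrite -E inE xW'.
  - by move=> W2 s1 s2; apply: minW => //; exact: subset_trans s1.
  have t2P r : r \in nbhd g W -> t2 r \in M2 r /\ t2 r \in nbhd g W'.
    by case/L2=> _ _ _ E; have := set11 (t2 r); rewrite -E inE => /andP[].
  have notW' r x : r \in nbhd g W -> x \in M2 r -> x \notin W'.
    move=> rW xM; have [_ _ sM _] := L2 _ rW; have := subsetP sM x xM.
    rewrite !inE => /orP[/eqP->|/andP[]//].
    by apply: contra (nbhd_notin rW); exact: (subsetP sW'W).
  have cross r r' x : r \in nbhd g W -> r' \in nbhd g W -> x \in M2 r -> x \in M1 (t2 r') ->
      r = r'.
    move=> rW r'W xM2 xM1; have [tr'M tr'] := t2P _ r'W.
    have [_ _ sM _] := L1 _ tr'; have := subsetP sM x xM1.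
    rewrite !inE (negPf (notW' _ _ rW xM2)) andbF orbF => /eqP xt.
    apply/eqP/negPn/negP=> rr'; have /disjointP/(_ x xM2) := D2 _ _ rW r'W rr'.
    by rewrite xt => /(_ tr'M).
  exists (fun r => M2 r :|: M1 (t2 r)), (fun r => t1 (t2 r)); split=> [r rW|r r' rW r'W rr'].
    have [rM cM sM iM] := L2 _ rW; have [trM trW] := t2P _ rW.
    have [rM1 cM1 sM1 iM1] := L1 _ trW; split.
    - by rewrite inE rM.
    - by apply: conn_meet cM cM1 _; apply/set0Pn; exists (t2 r); rewrite inE trM.
    - rewrite subUset (subset_trans sM) ?setUS ?setDS //=.
      apply: subset_trans sM1 _; rewrite subUset sub1set; apply/andP; split.
        by apply: (subsetP _ _ (subsetP sM _ trM)); rewrite setUS ?setDS.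
      by rewrite subsetU // setSD ?orbT.
    rewrite -iM1 setIUl; apply/setUidPr; apply/subsetP=> x.
    rewrite !in_setI => /andP[xM2 xZ]; rewrite xZ andbT.
    have := subsetP (nbhd_sub_setU g sZW') x xZ.
    rewrite inE (negPf (notW' _ _ rW xM2)) /= => xW'.
    have : x \in M2 r :&: nbhd g W' by rewrite inE xM2.
    by rewrite iM => /set1P ->.
  apply/disjointP=> x; rewrite !in_setU => /orP[x1|x1] /orP[x2|x2].
  - by have /disjointP/(_ x x1 x2) := D2 _ _ rW r'W rr'.
  - move/eqP: rr'; apply; exact: (cross _ _ _ rW r'W x1 x2).
  - move/eqP: rr' => rr'; apply: rr'; apply/esym; exact: (cross _ _ _ r'W rW x2 x1).
  have [t2M t2W] := t2P _ rW; have [t2M' t2W'] := t2P _ r'W.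
  have tt : t2 r != t2 r'.
    apply/eqP=> E; have /disjointP/(_ _ t2M) := D2 _ _ rW r'W rr'.
    by rewrite E => /(_ t2M').
  by have /disjointP/(_ x x1 x2) := D1 _ _ t2W t2W' tt.
move=> noW; set g' := del_verts g [set s]; set W1 := W :\ u.
have sW1W : W1 \subset W by exact: subsetDl.
have sW1 : s \notin W1 by apply: contra sNW; exact: (subsetP sW1W).
have ZW1 : Z \subset W1 by rewrite subsetD1 sZW.
(* Without a tight set strictly in between, each such [W'] either does not have [s] as a neighbour
   or has one neighbour to spare, so the lower bound survives the deletion of [s]. *)
have big W' : Z \subset W' -> W' \subset W1 -> #|nbhd g W| <= #|nbhd g W' :\ s|.
  move=> s1 s2; have s3 := subset_trans s2 sW1W.
  have := minW W' s1 s3; rewrite (cardsD1 s (nbhd g W')); case: (boolP (s \in nbhd g W')) =>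
      //= sN.
  rewrite add1n leq_eqVlt => /orP[/eqP E|//]; case: noW; exists W'; split.
  - by rewrite properEneq s1 andbT; apply: contra sZ => /eqP ->.
  - by apply: sub_proper_trans s2 _; exact: properD1.
  - by rewrite E (cardsD1 s (nbhd g W')) sN add1n.
have nbW1 : nbhd g' W1 = u |: (nbhd g W :\ s).
  apply/eqP; rewrite eqEcard; apply/andP; split.
    rewrite nbhd_del1 //; apply/subsetP=> x; rewrite !in_setD1 in_setU1 => /andP[xs xW1].
    rewrite in_setD1 xs /=.
    case: eqP => //= /eqP xu; have /nbhdP[xN [y yW1 gyx]] := xW1.
    apply/nbhdP; split; first by move: xN; rewrite in_setD1 xu.
    by exists y => //; exact: (subsetP sW1W).
  rewrite nbhd_del1 //; apply: leq_trans (big _ ZW1 (subxx _)).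
  rewrite cardsU1 (cardsD1 s (nbhd g W)) sW leq_add2r.
  by case: (_ \notin _).
have [| | |M1 [t1 [L1 D1]]] := IH g' Z W1 _ _ ZW1.
- apply: leq_trans (proper_card _) lt_n; apply/properP; split; first exact: setSD.
  by exists u; rewrite !inE ?uZ ?uW // eqxx andbF.
- exact: del_verts_sym.
- move=> W' s1 s2; have -> : nbhd g' W' = nbhd g W' :\ s.
    by apply: nbhd_del1; apply: contra sW1; exact: (subsetP s2).
  apply: leq_trans (big _ s1 s2).
  rewrite nbW1 cardsU1 (cardsD1 s (nbhd g W)) sW leq_add2r.
  by case: (_ \notin _).
have nbZ : nbhd g' Z = nbhd g Z.
  rewrite nbhd_del1; last by apply: contra sNW; exact: (subsetP sZW).
  by apply/setDidPl; rewrite disjoint_sym disjoints1.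
rewrite /linked nbW1 nbZ in L1 D1.
have uL : u \in u |: nbhd g W :\ s by rewrite setU11.
have rL r : r \in nbhd g W -> r != s -> r \in u |: nbhd g W :\ s.
  by move=> rW rs; rewrite in_setU1 in_setD1 rs rW orbT.
have gg' A : conn g' A -> conn g A by apply: conn_mono => x y _ _ /and3P[].
have [uM cM sM iM] := L1 _ uL.
have sub1 r : r \in u |: nbhd g W :\ s -> r |: (W1 :\: Z) \subset r |: (W :\: Z).
  by move=> _; rewrite setUS // setSD.
have sMr r : r \in nbhd g W -> r != s -> s \notin M1 r.
  move=> rW rs; have [_ _ sM1 _] := L1 _ (rL _ rW rs).
  apply/negP=> /(subsetP sM1); rewrite !inE eq_sym (negPf rs) /=.
  by rewrite (negPf sNW) !andbF.
exists (fun r => if r == s then s |: M1 u else M1 r), (fun r => if r == s then t1 u else t1 r).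
split=> [r rW|r r' rW r'W].
  case: (eqVneq r s) => [->|rs].
    split; first exact: setU11.
    - apply: connU => //; [exact: conn1|exact: gg'|].
      by apply/touchP; exists s, u; rewrite set11 gS.
    - apply: setUS; apply: subset_trans sM _.
      rewrite subUset sub1set inE uZ uW /=; exact: setSD.
    rewrite setIUl iM; apply/setUidPr; apply/subsetP=> x; rewrite in_setI.
    by move=> /andP[/set1P->]; rewrite (negPf sZ).
  have [rM1 cM1 sM1 iM1] := L1 _ (rL _ rW rs).
  by split; auto; apply: subset_trans sM1 _; apply: sub1; exact: rL.
have uN r1 : r1 \in nbhd g W -> u != r1 by move/nbhd_notin; apply: contra => /eqP <-.
case: (eqVneq r s) => [E|rs]; case: (eqVneq r' s) => [E'|r's] rr'.
- by rewrite E E' eqxx in rr'.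
- have := D1 _ _ uL (rL _ r'W r's) (uN _ r'W) => /disjointP H.
  apply/disjointP=> x; rewrite in_setU1 => /orP[/eqP ->|]; last exact: H.
  by apply/negP; exact: sMr.
- have := D1 _ _ uL (rL _ rW rs) (uN _ rW) => /disjointP H.
  apply/disjointP=> x xM; rewrite in_setU1 => /orP[/eqP E|xu]; last exact: H xM.
  by move: xM; rewrite E; apply/negP; exact: sMr.
by apply: D1 => //; exact: rL.
Qed.

(** The linking set of a root of [W] becomes the branch set of its end in [nbhd g Z]; vertices of
    [nbhd g Z] reached by no path are dropped as roots. *)
Lemma target_linked g Z W M t : symmetric g -> irreflexive g -> Z \subset W ->
  linked g Z W M t -> target g Z (nbhd g Z) -> target g W (nbhd g W).
Proof.
move=> gS gI ZW [L D] tZ.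
have tN s : s \in nbhd g W -> t s \in M s /\ t s \in nbhd g Z.
  by case/L=> _ _ _ E; have := set11 (t s); rewrite -E inE => /andP[].
have t_inj : {in nbhd g W &, injective t}.
  move=> s s' sW s'W E; apply/eqP/negPn/negP=> ss'.
  have /disjointP/(_ (t s)) := D _ _ sW s'W ss'; apply; first by have [] := tN s sW.
  by rewrite E; have [] := tN s' s'W.
pose F x := if [pick s in nbhd g W | t s == x] is Some s then M s else [set x].
have Ft s : s \in nbhd g W -> F (t s) = M s.
  move=> sW; rewrite /F; case: pickP => [r /andP[rW /eqP/t_inj->//]|no].
  by have := no s; rewrite sW eqxx.
have FZ x : x \in Z -> F x = [set x].
  move=> xZ; rewrite /F; case: pickP => [r /andP[rW /eqP E]|//].
  by have [_ /nbhd_notin] := tN r rW; rewrite E xZ.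
have MZ s x : s \in nbhd g W -> x \in M s -> x \notin Z.
  move=> sW xM; have [_ _ sM _] := L _ sW; have := subsetP sM x xM.
  rewrite !inE => /orP[/eqP ->|/andP[]//].
  by apply: contra (nbhd_notin sW); exact: (subsetP ZW).
have DP x : x \in Z :|: t @: nbhd g W -> x \in Z \/ exists2 s, s \in nbhd g W & x = t s.
  by rewrite inE => /orP[|/imsetP[s]]; [left|right; exists s].
move: tZ; apply: (@target_transfer _ _ _ _ _ _ F t) => //.
- by move=> s /tN[].
- move=> x /DP[xZ|[s sW ->]].
    by rewrite FZ //; split; [apply/set0Pn; exists x; rewrite set11|exact: conn1].
  rewrite Ft //; have [sM cM _ _] := L _ sW; split=> //.
  by apply/set0Pn; exists s.
- by move=> y yZ; rewrite FZ // sub1set; exact: (subsetP ZW).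
- move=> s sW; rewrite Ft //; have [sM cM sub _] := L _ sW; split=> //.
  by apply: subset_trans sub _; rewrite setUS // subsetDl.
- move=> x y /DP[xZ|[s sW ->]] /DP[yZ|[s' s'W ->]] xy.
  + by rewrite !FZ // disjoints1 inE.
  + by rewrite FZ // Ft // disjoints1; apply/negP=> /(MZ _ _ s'W); rewrite xZ.
  + by rewrite (FZ y) // Ft // disjoint_sym disjoints1; apply/negP=> /(MZ _ _ sW); rewrite yZ.
  rewrite !Ft //; apply: D => //; by apply: contra xy => /eqP ->.
move=> x y xZ yD gxy; apply/touchP; exists x, y; split=> //.
  by rewrite FZ // set11.
case: (DP y yD) => [yZ|[s sW E]]; first by rewrite FZ // set11.
by rewrite E Ft //; have [] := tN s sW.
Qed.

End Target.

(** * Cliques and hubs contained in a target *)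

Section Gadgets.
Variable T : finType.
Implicit Types (g h : rel T) (A B C P Q S Y Z W : {set T}) (u v x y s : T).

(* A rooted graph is represented by its set Y of non-roots alone: its roots are
   the elements of nbhd g Y, and its right-hand sides are the subsets of Y. *)
Definition light g Y : Prop := forall P, P \subset Y ->
  #|nbhd g P| < #|nbhd g Y| -> ecount g P <= 4 * #|P|.

Definition qheavy g Y : Prop := 4 * #|Y| + 2 <= ecount g Y \/
  (4 * #|Y| < ecount g Y /\ forall y, y \in Y -> #|nbrs g y :&: nbhd g Y| < 5).

Lemma qheavy_heavy g Y : qheavy g Y -> 4 * #|Y| < ecount g Y.
Proof. by case=> [|[]//]; lia. Qed.

Lemma fanged_in g S p q M : 1 < #|S| -> fanged g S p q M ->
  exists a b, [/\ a \in S, b \in S, a != b &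
    [/\ forall s, s \in S -> s != a -> touch g p (M s),
    forall s, s \in S -> s != b -> touch g q (M s) &
    touch g p q \/ forall s, s \in S -> touch g p (M s) /\ touch g q (M s)]].
Proof.
move=> S1 [a [b [ab pa qb pq]]].
have exists_neq x : exists2 y, y \in S & y != x.
  have : 0 < #|S :\ x| by move: S1; rewrite (cardsD1 x); case: (x \in S); lia.
  by case/card_gt0P=> y; rewrite !inE => /andP[yx yS]; exists y.
have notin x y : x \notin S -> y \in S -> y != x by move=> xS yS; apply: contraNneq xS => <-.
case: (boolP (a \in S)) => aS; case: (boolP (b \in S)) => bS.
- by exists a, b; split.
- have [c cS ca] := exists_neq a; exists a, c; rewrite eq_sym ca; split=> //; split=> // s sS _.
  by apply: qb => //; exact: notin.
- have [c cS cb] := exists_neq b; exists c, b; split=> //; split=> // s sS _.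
  by apply: pa => //; exact: notin.
have [c cS _] := exists_neq a; have [d dS dc] := exists_neq c.
exists c, d; rewrite eq_sym dc; split=> //; split=> // s sS _.
  by apply: pa => //; exact: notin.
by apply: qb => //; exact: notin.
Qed.

Lemma disjointU A B C : [disjoint A :|: B & C] = [disjoint A & C] && [disjoint B & C].
Proof.
apply/disjointP/andP=> [H|[/disjointP H1 /disjointP H2] x]; last first.
  by rewrite inE => /orP[xA|xB] xC; [exact: H1 xA xC|exact: H2 xB xC].
by split; apply/disjointP=> x xA; apply: H; rewrite inE xA ?orbT.
Qed.

(** The branch set of [b] absorbs [p], which touches every root but [a], and that of [a] absorbs
    [q]. Now all pairs involving [a] or [b] touch, and among at most three roots there is no other
    pair. *)
Lemma target_clique g P S : symmetric g -> #|S| <= 3 -> target g P S ->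
  exists F : T -> {set T},
    (forall s, s \in S -> [/\ s \in F s, F s \subset s |: P & conn g (F s)]) /\
    (forall s s', s \in S -> s' \in S -> s != s' ->
       [disjoint F s & F s'] /\ touch g (F s) (F s')).
Proof.
move=> gS S3 [p [q [M [[[p0 q0 pP qP dpq] [cp cq] HM dM] fan]]]].
case: (ltnP 1 #|S|) => S1; last first.
  exists M; split=> [s /HM[]//|s s' sS s'S ss'].
  have sub : s |: [set s'] \subset S by rewrite !subUset !sub1set sS s'S.
  by have := subset_leq_card sub; rewrite cardsU1 cards1 inE ss' => /leq_trans/(_ S1).
have [a [b [aS bS ab [pa qb pq]]]] := fanged_in S1 fan.
have pb : touch g p (M b) by apply: pa => //; rewrite eq_sym.
have qa : touch g q (M a) by apply: qb.
have [aM aP ca dpa dqa] := HM _ aS; have [bM bP cb dpb dqb] := HM _ bS.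
exists (fun s => if s == b then M b :|: p else if s == a then M a :|: q else M s).
split=> [s sS|].
  case: eqP => [->|_].
    by rewrite inE bM subUset bP subsetU ?pP ?orbT //; split=> //; apply: connU;
        rewrite // touch_sym.
  case: eqP => [->|_]; last by have [] := HM _ sS.
  by rewrite inE aM subUset aP subsetU ?qP ?orbT //; split=> //; apply: connU;
      rewrite // touch_sym.
have tbs s : s \in S -> s != a -> s != b -> touch g (M b :|: p) (M s).
  by move=> sS sa sb; apply: touch_sub (pa s sS sa); rewrite ?subsetUr.
have tas s : s \in S -> s != a -> s != b -> touch g (M a :|: q) (M s).
  by move=> sS sa sb; apply: touch_sub (qb s sS sb); rewrite ?subsetUr.
have tab : touch g (M b :|: p) (M a :|: q).
  case: pq => [pq|/(_ _ aS)[pa' _]]; first by apply: touch_sub pq; rewrite subsetUr.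
  by apply: touch_sub pa'; rewrite ?subsetUr ?subsetUl.
have dbs s : s \in S -> s != a -> s != b -> [disjoint M b :|: p & M s].
  move=> sS sa sb; have [_ _ _ d1 d2] := HM _ sS.
  by rewrite disjointU d1 dM // eq_sym.
have das s : s \in S -> s != a -> s != b -> [disjoint M a :|: q & M s].
  move=> sS sa sb; have [_ _ _ d1 d2] := HM _ sS.
  by rewrite disjointU d2 dM // eq_sym.
have dab : [disjoint M b :|: p & M a :|: q].
  rewrite disjointU; apply/andP; split; rewrite disjoint_sym disjointU.
    by rewrite dM //= dqb.
  by rewrite disjoint_sym dpa disjoint_sym dpq.
move=> s s' sS s'S ss'.
case: (eqVneq s b) => [E|sb].
  rewrite eq_sym -E (negPf ss'); case: (eqVneq s' a) => [_|s'a]; first by rewrite E.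
  by rewrite E; split; [apply: dbs|apply: tbs]; rewrite // -E eq_sym.
case: (eqVneq s' b) => [E'|s'b].
  rewrite disjoint_sym touch_sym //; case: (eqVneq s a) => [_|sa] //.
  by split; [apply: dbs|apply: tbs].
case: (eqVneq s a) => [E|sa].
  rewrite -E eq_sym (negPf ss'); rewrite E; split; [apply: das|apply: tas];
      rewrite // -E eq_sym //.
case: (eqVneq s' a) => [E'|s'a].
  by rewrite disjoint_sym touch_sym //; split; [apply: das|apply: tas].
have sub : s |: (s' |: (a |: [set b])) \subset S.
  by rewrite !subUset !sub1set sS s'S aS bS.
have := subset_leq_card sub; rewrite !cardsU1 cards1 !inE.
rewrite (negPf ss') (negPf sa) (negPf sb) (negPf s'a) (negPf s'b) (negPf ab) /=.
by move/leq_trans/(_ S3).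
Qed.

(** Only [p] is absorbed, by the root [b] that [q] may miss. This makes [q] touch every root, and
    [F b] touch every other root except possibly [a]. *)
Lemma target_hub g P S : symmetric g -> 1 < #|S| -> target g P S ->
  exists a b q (F : T -> {set T}),
    [/\ [/\ a \in S, b \in S & a != b],
        [/\ q != set0, q \subset P & conn g q],
        forall s, s \in S -> [/\ s \in F s, F s \subset s |: P, conn g (F s),
                                 [disjoint q & F s] & touch g q (F s)],
        forall s s', s \in S -> s' \in S -> s != s' -> [disjoint F s & F s'] &
        forall s, s \in S -> s != a -> s != b -> touch g (F b) (F s)].
Proof.
move=> gS S1 [p [q [M [[[p0 q0 pP qP dpq] [cp cq] HM dM] fan]]]].
have [a [b [aS bS ab [pa qb pq]]]] := fanged_in S1 fan.
have pb : touch g p (M b) by apply: pa => //; rewrite eq_sym.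
have [bM bP cb dpb dqb] := HM _ bS.
exists a, b, q, (fun s => if s == b then M b :|: p else M s); split=> //.
- move=> s sS; have [sM sP cs dps dqs] := HM _ sS.
  case: (eqVneq s b) => [->|sb]; last by split; auto.
  rewrite inE bM subUset bP subsetU ?pP ?orbT //; split=> //.
  + by apply: connU; rewrite // touch_sym.
  + by rewrite disjoint_sym disjointU disjoint_sym dqb.
  case: pq => [pq|/(_ _ bS)[_ qb']].
    by rewrite touch_sym //; apply: touch_sub pq; rewrite ?subsetUr.
  by apply: touch_sub qb'; rewrite ?subsetUl.
- move=> s s' sS s'S ss'.
  have [_ _ _ d1 _] := HM _ sS; have [_ _ _ d1' _] := HM _ s'S.
  case: (eqVneq s b) => [E|sb].
    rewrite eq_sym -E (negPf ss') E disjointU d1' andbT; apply: dM => //.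
    by rewrite -E.
  case: (eqVneq s' b) => [E|s'b]; last exact: dM.
  rewrite disjoint_sym disjointU d1 andbT; apply: dM => //; by rewrite eq_sym.
move=> s sS sa sb; rewrite eqxx (negPf sb).
by apply: touch_sub (pa s sS sa); rewrite ?subsetUr.
Qed.

End Gadgets.

(** * The minimal counterexample *)

Section MinimalCounterexample.
Variable T : finType.
Implicit Types (h : rel T) (A B C P Q S Z W : {set T}) (u v x y s : T).
Variables (g : rel T) (Y : {set T}).
Hypotheses (gS : symmetric g) (gI : irreflexive g).
Hypothesis k5 : #|nbhd g Y| <= 5.
Hypothesis lightY : light g Y.
Hypothesis heavyY : qheavy g Y.
Hypothesis noT : ~ target g Y (nbhd g Y).
Hypothesis IH : forall h Z, symmetric h -> irreflexive h ->
  #|Z| < #|Y| \/ #|Z| = #|Y| /\ ecount h Z < ecount g Y ->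
  #|nbhd h Z| <= 5 -> light h Z -> qheavy h Z -> target h Z (nbhd h Z).

(** Failure of lightness in a modified graph [h], measured against the number of roots of the
    original graph. *)
Definition violates h Z := #|nbhd h Z| < #|nbhd g Y| /\ 4 * #|Z| < ecount h Z.

(** A minimal violator is light for its own number of roots. That number is at most four, so no
    vertex sees five roots, heavy means quite heavy, and the induction hypothesis applies. *)
Lemma violator_target h A : symmetric h -> irreflexive h -> #|A| < #|Y| ->
  (exists2 P : {set T}, P \subset A & violates h P) ->
  exists Z, [/\ Z \subset A, Z != set0, violates h Z & target h Z (nbhd h Z)].
Proof.
move=> hS hI cA [P0 sP0 vP0].
have [|Z [sZ [lZ eZ]] mZ] := @min_set _ (fun P => P \subset A /\ violates h P).
  by exists P0.
exists Z; split=> //; first by apply: contraTneq eZ => ->; rewrite ecount_set0.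
have k5' : #|nbhd h Z| < 5 by apply: leq_trans lZ k5.
apply: IH => //.
- by left; apply: leq_ltn_trans (subset_leq_card sZ) cA.
- exact: ltnW.
- move=> P sP lP; rewrite leqNgt; apply/negP=> eP.
  have E : P = Z by apply: mZ => //; split; [exact: subset_trans sZ|split=> //;
      exact: ltn_trans lZ].
  by rewrite E ltnn in lP.
right; split=> // y yZ; apply: leq_ltn_trans k5'.
by apply: subset_leq_card; apply: subsetIr.
Qed.

(** Had the modified graph lost a root, [Z] itself would be a violator. *)
Lemma smaller_target h Z : symmetric h -> irreflexive h ->
  #|Z| < #|Y| \/ #|Z| = #|Y| /\ ecount h Z < ecount g Y ->
  nbhd h Z \subset nbhd g Y -> qheavy h Z ->
  (forall P, P \subset Z -> ~ violates h P) ->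
  nbhd h Z = nbhd g Y /\ target h Z (nbhd h Z).
Proof.
move=> hS hI cZ sub qZ nv.
have E : nbhd h Z = nbhd g Y.
  apply/eqP; rewrite eqEcard sub leqNgt; apply/negP=> lt.
  by apply: (nv Z) => //; split=> //; exact: qheavy_heavy.
split=> //; apply: IH => //; first by rewrite E.
move=> P sP; rewrite E => lt; rewrite leqNgt; apply/negP=> eP.
by apply: (nv P).
Qed.

Definition rigid P := [/\ P \subset Y, #|nbhd g P| < #|nbhd g Y| & target g P (nbhd g P)].

Lemma target_nonempty h Z S : target h Z S -> Z != set0.
Proof.
move=> [p [q [M [[[/set0Pn[x xp] _ pZ _ _] _ _ _] _]]]].
by apply/set0Pn; exists x; exact: (subsetP pZ).
Qed.

(* Either h has the same adjacencies as g between Z and the roots, or it has an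
   extra edge that compensates for a vertex adjacent to all of them. *)
Lemma qheavy_super h P Z : symmetric h -> Z \subset Y ->
  ecount g Y <= 4 * (#|Y| - #|Z|) + ecount (del_verts g P) Z ->
  (forall x y, x \in Z -> del_verts g P x y -> h x y) -> [disjoint Z & P] -> P \subset Y ->
  4 * #|Z| + 2 <= ecount h Z \/
  (4 * #|Z| < ecount h Z /\ forall y, y \in Z -> #|nbrs h y :&: nbhd g Y| < 5).
Proof.
move=> hS sZ cnt sub /disjointP dZP sPY.
have le := ecount_le sub; have leZ := subset_leq_card sZ.
case: heavyY => [h2|[h1 nf]]; first by left; lia.
case: (classic (forall y, y \in Z -> #|nbrs h y :&: nbhd g Y| < 5)) => [nf'|full].
  by right; split=> //; lia.
left; have [y yZ yfull] : exists2 y, y \in Z & 5 <= #|nbrs h y :&: nbhd g Y|.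
  apply: NNPP => no; apply: full => y yZ; rewrite ltnNge; apply/negP=> le5.
  by apply: no; exists y.
have : ~~ (nbrs h y :&: nbhd g Y \subset nbrs g y :&: nbhd g Y).
  apply/negP=> /subset_leq_card le2; have := nf y (subsetP sZ y yZ); lia.
case/subsetPn=> x; rewrite !in_setI !nbrsE => /andP[hyx xN]; rewrite xN andbT => ngyx.
have lt : ecount (del_verts g P) Z < ecount h Z.
  apply: (ecount_lt (del_verts_sym P gS) hS sub yZ hyx).
  by apply: contra ngyx => /and3P[].
lia.
Qed.

(** * Replacing a set by a clique on its neighbourhood *)

Section Clique.
Variables (P : {set T}) (F : T -> {set T}).
Let S := nbhd g P.
Hypothesis (PY : P \subset Y).
Hypothesis FS : forall s, s \in S -> [/\ s \in F s, F s \subset s |: P & conn g (F s)].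
Hypothesis FF : forall s s', s \in S -> s' \in S -> s != s' ->
       [disjoint F s & F s'] /\ touch g (F s) (F s').

Definition cliqued : rel T := fun x y =>
  [|| del_verts g P x y | [&& x \in S, y \in S & x != y]].

Lemma cliqued_sym : symmetric cliqued.
Proof. by move=> x y; rewrite /cliqued (del_verts_sym P gS) andbCA eq_sym. Qed.

Lemma cliqued_irr : irreflexive cliqued.
Proof. by move=> x; rewrite /cliqued del_verts_irr // eqxx !andbF. Qed.

Lemma cliqued_nbhd_sub Z : S \subset Z :|: nbhd cliqued Z ->
    nbhd g (Z :|: P) \subset nbhd cliqued Z.
Proof.
move=> sub; apply/subsetP=> y /nbhdP[]; rewrite inE => /norP[yZ yP] [x].
rewrite inE; case: (boolP (x \in P)) => [xP _ gxy|xP].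
  have yS : y \in S by apply/nbhdP; split=> //; exists x.
  by have := subsetP sub y yS; rewrite inE (negPf yZ).
rewrite orbF => xZ gxy; apply/nbhdP; split=> //; exists x => //.
by rewrite /cliqued /del_verts xP yP gxy.
Qed.

(** The new edges are realised inside [P] by the sets [F s]. The covering hypothesis makes every
    neighbour of [Z :|: P] in [g] a root of [Z] in the new graph. *)
Lemma cliqued_target Z : [disjoint Z & P] -> S \subset Z :|: nbhd cliqued Z ->
  target cliqued Z (nbhd cliqued Z) -> target g (Z :|: P) (nbhd g (Z :|: P)).
Proof.
move=> /disjointP dZP sub.
have nsub := cliqued_nbhd_sub sub.
pose F1 x := if x \in S then F x else [set x].
have F1sub x : F1 x \subset x |: P.
  by rewrite /F1; case: (boolP (x \in S)) => [/FS[]//|_]; rewrite subsetUl.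
have xF1 x : x \in F1 x.
  by rewrite /F1; case: (boolP (x \in S)) => [/FS[]//|_]; rewrite set11.
have notP x : x \in Z :|: [set id z | z in nbhd g (Z :|: P)] -> x \notin P.
  rewrite inE => /orP[xZ|/imsetP[y yN ->]]; first by apply/negP; exact: dZP.
  by have := nbhd_notin yN; rewrite inE => /norP[].
apply: (@target_transfer _ _ _ _ _ _ _ F1 id) => //.
- exact: cliqued_sym.
- exact: cliqued_irr.
- by move=> s sN; exact: (subsetP nsub).
- move=> x _; split; first by apply/set0Pn; exists x.
  by rewrite /F1; case: (boolP (x \in S)) => [/FS[]//|_]; exact: conn1.
- move=> y yZ; apply: subset_trans (F1sub y) _.
  by rewrite setSU // sub1set.
- move=> s sN; split=> //; apply: subset_trans (F1sub s) _.
  by rewrite setUS // subsetUr.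
- move=> x y /notP xP /notP yP xy.
  have dx z w : w \notin P -> z != w -> [disjoint F1 z & [set w]].
    move=> wP zw; rewrite disjoint_sym disjoints1; apply/negP.
    by move/(subsetP (F1sub z)); rewrite !inE (negPf wP) orbF eq_sym (negPf zw).
  rewrite {2}/F1; case: (boolP (y \in S)) => yS; last exact: dx.
  rewrite /F1; case: (boolP (x \in S)) => xS; first by have [] := FF xS yS xy.
  have := dx y x xP; rewrite eq_sym => /(_ xy); rewrite /F1 yS disjoint_sym.
  exact.
move=> x y xZ _ /orP[/and3P[_ _ gxy]|/and3P[xS yS xy]].
  by apply/touchP; exists x, y.
by rewrite /F1 xS yS; have [] := FF xS yS xy.
Qed.

Hypothesis Pmax : forall Q, rigid Q -> P \subset Q -> Q = P.
Hypothesis Prigid : rigid P.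

Lemma cliqued_contra : False.
Proof.
have [_ Pk tP] := Prigid; have P0 := target_nonempty tP.
set Z1 := Y :\: P.
have cZ1 : #|Z1| + #|P| = #|Y| by rewrite cardsD (setIidPr PY); have := subset_leq_card PY; lia.
have cP : 0 < #|P| by rewrite card_gt0.
have ltZ1 : #|Z1| < #|Y| by lia.
have dis Z : Z \subset Z1 -> [disjoint Z & P].
  by rewrite subsetD => /andP[].
have nv Z : Z \subset Z1 -> ~ violates cliqued Z.
  move=> sZ vZ; have [Z' [sZ' Z'0 [lt hv] tZ']] : exists Z, [/\ Z \subset Z1, Z != set0,
      violates cliqued Z & target cliqued Z (nbhd cliqued Z)].
    by apply: violator_target cliqued_sym cliqued_irr ltZ1 _; exists Z.
  have dZ := dis _ sZ'; have sZY := subset_trans sZ' (subsetDl _ _).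
  (* If [Z'] meets [S], the clique puts all of [S] into [Z'] and its neighbourhood, so [Z' :|: P] is
     a larger rigid set. Otherwise the two graphs agree at [Z'], which then violates lightness of
     [g]. *)
  case: (set_0Vmem (Z' :&: S)) => [Z'S|[z]]; last first.
    rewrite inE => /andP[zZ zS].
    have sub : S \subset Z' :|: nbhd cliqued Z'.
      apply/subsetP=> s sS; rewrite inE; case sZ2: (s \in Z') => //=.
      apply/nbhdP; rewrite sZ2; split=> //; exists z => //.
      rewrite /cliqued zS sS /=; case: eqP => [E|]; last by rewrite orbT.
      by rewrite -E zZ in sZ2.
    have E : Z' :|: P = P.
      apply: Pmax; last exact: subsetUr.
      split; first by rewrite subUset sZY.
        by apply: leq_ltn_trans (subset_leq_card (cliqued_nbhd_sub sub)) lt.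
      exact: cliqued_target.
    have /set0Pn[x xZ] := Z'0; have /disjointP/(_ x xZ) := dZ; apply.
    by rewrite -E inE xZ.
  have agree x y : x \in Z' -> cliqued x y = g x y.
    move=> xZ; have xP : x \notin P by apply/negP; have /disjointP/(_ x xZ) := dZ.
    have xS : x \notin S by apply/negP=> xS; have := in_set0 x; rewrite -Z'S inE xZ xS.
    rewrite /cliqued /del_verts xP (negPf xS) orbF /=.
    case: (boolP (y \in P)) => //= yP; apply/esym; apply: contraNF xS => gxy.
    by apply/nbhdP; split=> //; exists y; rewrite // gS.
  have := lightY sZY; rewrite -(nbhd_ext agree) -(ecount_ext agree) => /(_ lt).
  by rewrite leqNgt hv.
have nbZ1 : nbhd cliqued Z1 \subset nbhd g Y.
  apply/subsetP=> y /nbhdP[yZ1 [x xZ1 cxy]].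
  have yP : y \notin P.
    case/orP: cxy => [/and3P[]//|/and3P[_ yS _]]; exact: nbhd_notin yS.
  have yY : y \notin Y by apply: contra yZ1 => yY; rewrite inE yP.
  apply/nbhdP; split=> //; case/orP: cxy => [/and3P[_ _ gxy]|/and3P[_ yS _]].
    by exists x => //; move: xZ1; rewrite inE => /andP[].
  by have /nbhdP[_ [w wP gwy]] := yS; exists w => //; exact: (subsetP PY).
have eP := lightY PY Pk.
have eY : ecount g Y = ecount g P + ecount (del_verts g P) Z1.
  rewrite -ecount_del //; last exact: dis.
  by congr (ecount g _); rewrite setUC -{1}(setID Y P) (setIidPr PY).
have qZ : qheavy cliqued Z1.
  case: (@qheavy_super cliqued P Z1 cliqued_sym (subsetDl _ _)) => //.
  - by rewrite eY leq_add2r -cZ1 addKn.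
  - by move=> x y _ gxy; rewrite /cliqued gxy.
  - exact: dis.
  - by left.
  move=> [h1 nf]; right; split=> // y yZ; apply: leq_ltn_trans (nf y yZ).
  by apply/subset_leq_card/setIS.
have [E tE] : nbhd cliqued Z1 = nbhd g Y /\ target cliqued Z1 (nbhd cliqued Z1).
  by apply: smaller_target cliqued_sym cliqued_irr _ nbZ1 qZ nv; left.
have YE : Z1 :|: P = Y by rewrite setUC -[RHS](setID Y P) (setIidPr PY).
apply: noT; rewrite -YE; apply: cliqued_target => //; first exact: dis.
rewrite E; apply/subsetP=> x xS.
have := subsetP (nbhd_sub_setU g PY) x xS; rewrite !in_setU => /orP[xY|->].
  by rewrite in_setD xY (nbhd_notin xS).
by rewrite orbT.
Qed.

End Clique.
Lemma target_card h Z S : target h Z S -> 1 < #|Z|.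
Proof.
move=> [p [q [M [[[p0 q0 pZ qZ dpq] _ _ _] _]]]].
have sub : p :|: q \subset Z by rewrite subUset pZ.
apply: leq_trans (subset_leq_card sub); rewrite cardsU disjoint_setI0 // cards0 subn0.
by rewrite -card_gt0 in p0; rewrite -card_gt0 in q0; lia.
Qed.

(** * Replacing a set with four neighbours by a single vertex *)

Section Hub.
Variables (P q : {set T}) (F : T -> {set T}) (a b z0 : T).
Let S := nbhd g P.
Hypothesis (PY : P \subset Y).
Hypotheses (aS : a \in S) (bS : b \in S) (ab : a != b) (z0P : z0 \in P).
Hypotheses (S4 : #|S| = 4) (q0 : q != set0) (qP : q \subset P) (cq : conn g q).
Hypothesis FS : forall s, s \in S -> [/\ s \in F s, F s \subset s |: P, conn g (F s),
                                 [disjoint q & F s] & touch g q (F s)].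
Hypothesis dF : forall s s', s \in S -> s' \in S -> s != s' -> [disjoint F s & F s'].
Hypothesis tb : forall s, s \in S -> s != a -> s != b -> touch g (F b) (F s).

(* z0 stands for the centre q of the target at P, and b for the root that has
   absorbed the other centre. *)
Let half x y := [|| (x == z0) && (y \in S) | [&& x == b, y \in S, y != a & y != b]].

Definition hub : rel T := fun x y => [|| del_verts g P x y, half x y | half y x].

Lemma z0S : z0 \notin S. Proof. by apply/negP=> /nbhd_notin; rewrite z0P. Qed.

Lemma hub_sym : symmetric hub.
Proof. by move=> x y; rewrite /hub (del_verts_sym P gS); case: (half x y);
    rewrite ?orbT ?orbF. Qed.

Lemma hub_irr : irreflexive hub.
Proof.
move=> x; rewrite /hub del_verts_irr // /half orbb /=.
case: (eqVneq x z0) => [->|_]; first by rewrite (negPf z0S) /= !andbF.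
by case: (eqVneq x b) => [->|_] //=; rewrite ?eqxx !andbF.
Qed.

Lemma hub_out x y : hub x y -> y \in P -> y = z0.
Proof.
move=> H yP; have yS : y \notin S by apply/negP=> /nbhd_notin; rewrite yP.
move: H; rewrite /hub /del_verts yP /half (negPf yS) /= !andbF /=.
case/orP=> [/andP[/eqP//]|/and4P[/eqP yb]].
by rewrite yb bS in yS.
Qed.

Lemma hub_agree Z x y : [disjoint Z & P] -> Z :&: S = set0 -> x \in Z -> hub x y = g x y.
Proof.
move=> /disjointP dZP ZS xZ.
have xP : x \notin P by apply/negP; exact: dZP.
have xS : x \notin S by apply/negP=> xS; have := in_set0 x; rewrite -ZS inE xZ xS.
have xz : (x == z0) = false by apply: contraNF xP => /eqP ->.
have xb : (x == b) = false by apply: contraNF xS => /eqP ->.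
rewrite /hub /half xz xb (negPf xS) /= !andbF !orbF /del_verts xP /=.
case: (boolP (y \in P)) => //= yP; apply/esym; apply: contraNF xS => gxy.
by apply/nbhdP; split=> //; exists y; rewrite // gS.
Qed.

Lemma hub_deg : nbrs hub z0 = S.
Proof.
apply/setP=> y; rewrite inE /hub /half /del_verts z0P eqxx (negPf z0S) /=.
have -> : (z0 == b) = false by apply: contraNF z0S => /eqP ->.
by rewrite /= !andbF !orbF.
Qed.

(** [z0] expands to [q], and the further edges at [b] become contacts of [F b]. The parameter [d]
    allows one vertex of [S] that [Z'] does not reach: the root [z0] of [Z'] then stands for the
    root [d], with branch set [q :|: F d]. The value [d = z0] says that there is no such vertex. *)
Lemma hub_target Z Z' d : [disjoint Z & P] -> Z' = Z \/ Z' = z0 |: Z ->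
  S \subset d |: (Z :|: nbhd hub Z') ->
  d = z0 \/ [/\ d \in S, d \notin Z, d \notin nbhd hub Z' & z0 \in nbhd hub Z'] ->
  #|nbhd g (Z :|: P)| <= #|nbhd hub Z'| /\
  (target hub Z' (nbhd hub Z') -> target g (Z :|: P) (nbhd g (Z :|: P))).
Proof.
move=> /disjointP dZP Z'E sub dP.
pose f x := if x == d then z0 else x.
have ZZ' : Z \subset Z' by case: Z'E => ->; rewrite ?subsetUr.
have Z'Z x : x \in Z' -> x = z0 \/ x \in Z.
  by case: Z'E => ->; [right|rewrite in_setU1 => /orP[/eqP|]; auto].
have nP x : x \in nbhd g (Z :|: P) -> x \notin P /\ x \notin Z.
  by move/nbhd_notin; rewrite inE => /norP[].
have nz0 x : x \notin P -> x != z0 by apply: contraNneq => ->.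
have fN x : x \in nbhd g (Z :|: P) -> f x \in nbhd hub Z'.
  move=> xN; have [xP xZ] := nP x xN; rewrite /f; case: eqP => [E|/eqP xd].
    by case: dP => [E'|[]//]; rewrite E E' z0P in xP.
  have xZ' : x \notin Z' by apply/negP=> /Z'Z[E|xz]; [rewrite E z0P in xP|rewrite xz in xZ].
  have /nbhdP[_ [w]] := xN; rewrite inE; case: (boolP (w \in P)) => [wP _ gwx|wP].
    have xS : x \in S by apply/nbhdP; split=> //; exists w.
    by have := subsetP sub x xS; rewrite in_setU1 in_setU (negPf xd) (negPf xZ).
  rewrite orbF => wZ gwx; apply/nbhdP; split=> //; exists w; first exact: (subsetP ZZ').
  by rewrite /hub /del_verts wP xP gwx.
have f_inj : {in nbhd g (Z :|: P) &, injective f}.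
  move=> x y /nP[xP _] /nP[yP _]; rewrite /f.
  case: eqP => [->|_]; case: eqP => [->|_] // E; first by rewrite -E z0P in yP.
  by rewrite E z0P in xP.
split.
  rewrite -(card_in_imset f_inj); apply/subset_leq_card/subsetP=> y /imsetP[x xN ->].
  exact: fN.
pose F0 := if d \in S then q :|: F d else q.
pose F2 x := if x == z0 then F0 else if x \in S then F x else [set x].
have qF0 : q \subset F0 by rewrite /F0; case: ifP => //; rewrite subsetUl.
have F0sub : F0 \subset d |: P.
  rewrite /F0; case: ifP => [dS|_]; last by rewrite subsetU // qP orbT.
  by have [_ sF _ _ _] := FS dS; rewrite subUset sF subsetU // qP orbT.
have cF0 : conn g F0.
  by rewrite /F0; case: ifP => // dS; have [_ _ cF _ tF] := FS dS; apply: connU.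
have F2E x : x != z0 -> F2 x = if x \in S then F x else [set x] by rewrite /F2 => /negPf ->.
have F2sub x : x != z0 -> F2 x \subset x |: P.
  by move=> xz; rewrite F2E //; case: (boolP (x \in S)) => [/FS[]//|_]; rewrite subsetUl.
have xF2 x : x != z0 -> x \in F2 x.
  by move=> xz; rewrite F2E //; case: (boolP (x \in S)) => [/FS[]//|_]; rewrite set11.
have F2z0 : F2 z0 = F0 by rewrite /F2 eqxx.
have DP x : x \in Z' :|: f @: nbhd g (Z :|: P) -> x = z0 \/ x \notin P /\ x != d.
  rewrite inE => /orP[/Z'Z[->|xZ]|/imsetP[y /nP[yP _] ->]]; first by left.
    have xP : x \notin P by apply/negP; exact: dZP.
    right; split=> //; case: dP => [->|[_ dZ _ _]]; first exact: nz0.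
    by apply: contraNneq dZ => <-.
  by rewrite /f; case: eqP => [_|/eqP]; [left|right].
have dx z w : z != z0 -> w \notin P -> z != w -> [disjoint F2 z & [set w]].
  move=> zz wP zw; rewrite disjoint_sym disjoints1; apply/negP.
  by move/(subsetP (F2sub z zz)); rewrite !inE (negPf wP) orbF eq_sym (negPf zw).
have d0 x : x \notin P -> x != d -> [disjoint F0 & F2 x].
  move=> xP xd; rewrite F2E; last exact: nz0.
  case: (boolP (x \in S)) => xS; last first.
    rewrite disjoint_sym disjoints1; apply/negP=> /(subsetP F0sub).
    by rewrite in_setU1 (negPf xd) (negPf xP).
  have [_ _ _ dq _] := FS xS; rewrite /F0; case: ifP => // dS.
  by rewrite disjointU dq dF // eq_sym.
apply: (@target_transfer _ _ _ _ _ _ _ F2 f) => //.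
- exact: hub_sym.
- exact: hub_irr.
- move=> x /DP[->|[/nz0 xz _]].
    by rewrite F2z0; split=> //; apply: contraNneq q0 => E; rewrite -subset0 -E.
  split; first by apply/set0Pn; exists x; exact: xF2.
  by rewrite F2E //; case: (boolP (x \in S)) => [/FS[]//|_]; exact: conn1.
- move=> y yZ'; have [yz|yZ] := Z'Z y yZ'.
    rewrite yz F2z0; case: dP => [E|[dS dZ dN zN]].
      by rewrite /F0 E (negPf z0S) subsetU // qP orbT.
    by have := nbhd_notin zN; rewrite -yz yZ'.
  have yz : y != z0 by apply: nz0; apply/negP; exact: dZP.
  by apply: subset_trans (F2sub y yz) _; rewrite setSU // sub1set.
- move=> s sN; have [sP _] := nP s sN; rewrite /f; case: eqP => [E|_].
    rewrite F2z0 E; split.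
      case: dP => [E'|[dS _ _ _]]; first by rewrite E E' z0P in sP.
      by rewrite /F0 dS inE; have [-> _ _ _ _] := FS dS; rewrite orbT.
    by apply: subset_trans F0sub _; rewrite setUS // subsetUr.
  have sz := nz0 s sP; split; first exact: xF2.
  by apply: subset_trans (F2sub s sz) _; rewrite setUS // subsetUr.
- move=> x y /DP[->|[xP xd]] /DP[->|[yP yd]] xy.
  + by rewrite eqxx in xy.
  + by rewrite F2z0; exact: d0.
  + by rewrite F2z0 disjoint_sym; exact: d0.
  have xz := nz0 x xP; have yz := nz0 y yP.
  case: (boolP (x \in S)) => xS; last first.
    by rewrite (F2E x) // (negPf xS) disjoint_sym dx // eq_sym.
  case: (boolP (y \in S)) => yS; last first.
    by rewrite (F2E y) // (negPf yS) dx.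
  by rewrite !F2E // xS yS dF.
have hh x y : y \in Z' :|: f @: nbhd g (Z :|: P) -> half x y -> touch g (F2 x) (F2 y).
  move=> yD; rewrite /half => /orP[/andP[/eqP -> yS]|/and4P[/eqP -> yS ya yb]].
    rewrite F2z0 F2E ?yS; last by apply: contraTneq yS => ->; exact: z0S.
    by have [_ _ _ _ tq] := FS yS; apply: touch_sub tq.
  rewrite !F2E ?bS ?yS; first exact: tb.
    by apply: contraTneq yS => ->; exact: z0S.
  by apply: contraTneq bS => ->; exact: z0S.
move=> x y xZ' yD /or3P[/and3P[xP yP gxy]|xy|yx].
- by apply/touchP; exists x, y; rewrite !xF2 ?nz0.
- exact: hh.
by rewrite touch_sym //; apply: hh => //; rewrite inE xZ'.
Qed.

Hypothesis Pmax : forall Q, rigid Q -> P \subset Q -> Q = P.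
Hypothesis Pk : #|S| < #|nbhd g Y|.

Lemma hub_grow Z Z' d : Z \subset Y :\: P -> Z != set0 ->
  Z' = Z \/ Z' = z0 |: Z ->
  S \subset d |: (Z :|: nbhd hub Z') ->
  d = z0 \/ [/\ d \in S, d \notin Z, d \notin nbhd hub Z' & z0 \in nbhd hub Z'] ->
  #|nbhd hub Z'| < #|nbhd g Y| -> target hub Z' (nbhd hub Z') -> False.
Proof.
move=> sZ /set0Pn[x xZ] Z'E sub dE lt t.
have /andP[sZY dZ] : (Z \subset Y) && [disjoint Z & P] by rewrite -subsetD.
have [le tt] := hub_target dZ Z'E sub dE.
have E : Z :|: P = P.
  apply: Pmax; last exact: subsetUr.
  by split; [rewrite subUset sZY|apply: leq_ltn_trans lt|exact: tt].
have /disjointP/(_ x xZ) := dZ; apply; by rewrite -E inE xZ.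
Qed.

(* All edges of s leaving Z end in nbhd hub Z, so deleting s from Z loses at most
   four edges, while Z :\ s looks the same in g. *)
Lemma hub_single Z s : Z \subset Y :\: P -> Z :&: S = [set s] -> ~ violates hub Z.
Proof.
move=> sZ ZS [lt hv].
have /andP[sZY dZ] : (Z \subset Y) && [disjoint Z & P] by rewrite -subsetD.
have [sZ' sS] : s \in Z /\ s \in S by have := set11 s; rewrite -ZS inE => /andP[].
have zZ : z0 \notin Z by apply/negP=> zZ; have /disjointP/(_ _ zZ z0P) := dZ.
have zN : z0 \in nbhd hub Z.
  by apply/nbhdP; split=> //; exists s => //; rewrite hub_sym -nbrsE hub_deg.
set Z0 := Z :\ s.
have sZ0 : Z0 \subset Z by exact: subsetDl.
have Z0S : Z0 :&: S = set0.
  apply/setP=> x; rewrite in_set0 in_setI /Z0 in_setD1; apply/negP=> /andP[/andP[xs xZ] xS].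
  have : x \in Z :&: S by rewrite inE xZ.
  by rewrite ZS inE (negPf xs).
have dZ0 : [disjoint Z0 & P] by apply: disjointWl dZ.
have agr x y : x \in Z0 -> hub x y = g x y by exact: hub_agree.
have eZ := ecount_rem1 hub_sym hub_irr sZ'; rewrite -/Z0 (ecount_ext agr) in eZ.
have c1 : #|nbrs hub s :\: Z| <= #|nbhd hub Z|.
  apply/subset_leq_card/subsetP=> x; rewrite in_setD nbrsE => /andP[xZ hsx].
  by apply/nbhdP; split=> //; exists s.
have c2 : #|nbhd g Z0| <= #|nbhd hub Z|.
  have sub : nbhd g Z0 \subset s |: (nbhd hub Z :\ z0).
    rewrite -(nbhd_ext agr); apply/subsetP=> x /nbhdP[xZ0 [w wZ0 hwx]].
    rewrite in_setU1 in_setD1; case: eqP => //= /eqP xs.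
    apply/andP; split.
      apply/negP=> /eqP E; have := in_set0 w; rewrite -Z0S inE wZ0.
      by rewrite -hub_deg nbrsE hub_sym -E hwx.
    apply/nbhdP; split; last by exists w => //; exact: (subsetP sZ0).
    by move: xZ0; rewrite in_setD1 xs.
  apply: leq_trans (subset_leq_card sub) _.
  rewrite cardsU1 (cardsD1 z0 (nbhd hub Z)) zN leq_add2r; by case: (_ \notin _).
have l0 := lightY (subset_trans sZ0 sZY) (leq_ltn_trans c2 lt).
have cZ : #|Z| = #|Z0|.+1 by rewrite (cardsD1 s) sZ'.
have l4 : #|nbhd hub Z| <= 4 by rewrite -ltnS; exact: leq_trans lt k5.
move: hv; rewrite ltnNge eZ cZ mulnS addnC; case/negP; apply: leq_add => //.
exact: leq_trans c1 l4.
Qed.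

(** For [z0] outside [Z], the vertices of [S] beyond [Z] and its neighbourhood are counted. With
    none or one of them, [Z :|: P] contradicts the maximality of [P]. With two, either [Z] meets [S]
    in a single vertex or [S] splits into two pairs with no edge between them; the two further edges
    at [b] exist to prevent this. *)
Lemma hub_nv Z : Z \subset z0 |: (Y :\: P) -> Z != set0 -> violates hub Z ->
  target hub Z (nbhd hub Z) -> False.
Proof.
move=> sZ Z0 vZ tZ; have [lt hv] := vZ.
have sZ' : Z :\ z0 \subset Y :\: P.
  by apply/subsetP=> x; rewrite in_setD1 => /andP[xz /(subsetP sZ)];
      rewrite in_setU1 (negPf xz).
case: (boolP (z0 \in Z)) => zZ.
  have ZE : Z = z0 |: (Z :\ z0) by rewrite setD1K.
  (* Alone, [z0] carries exactly four edges, so it does not exceed four edges per vertex. *)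
  case: (eqVneq (Z :\ z0) set0) => [E|ne].
    move: hv; rewrite ZE E setU0 ecount1; [|exact: hub_sym|exact: hub_irr].
    by rewrite hub_deg S4 cards1.
  apply: (@hub_grow (Z :\ z0) Z z0) => //; [by right| |by left].
  apply/subsetP=> s sS; rewrite in_setU1 in_setU in_setD1.
  have sz : s != z0 by apply: contraTneq sS => ->; exact: z0S.
  rewrite sz (negPf sz) /=; case: (boolP (s \in Z)) => //= sZ2.
  by apply/nbhdP; split=> //; exists z0; rewrite // -nbrsE hub_deg.
have sZY : Z \subset Y :\: P.
  by apply/subsetP=> x xZ; apply: (subsetP sZ'); rewrite in_setD1 xZ andbT;
      apply: contraNneq zZ => <-.
have /andP[sZY' dZ] : (Z \subset Y) && [disjoint Z & P] by rewrite -subsetD.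
case: (set_0Vmem (Z :&: S)) => [ZS|[u]].
  have agr x y : x \in Z -> hub x y = g x y by exact: hub_agree.
  by have := lightY sZY'; rewrite -(nbhd_ext agr) -(ecount_ext agr) => /(_ lt);
      rewrite leqNgt hv.
rewrite inE => /andP[uZ uS].
have zN : z0 \in nbhd hub Z.
  by apply/nbhdP; split=> //; exists u; rewrite // hub_sym -nbrsE hub_deg.
case: (set_0Vmem (S :\: (Z :|: nbhd hub Z))) => [W0|[d]].
  apply: (@hub_grow Z Z z0) => //; [by left| |by left].
  apply: subset_trans (subsetUr _ _); rewrite -setD_eq0; exact/eqP.
rewrite in_setD in_setU => /andP[/norP[dZ' dN] dS].
case: (set_0Vmem (S :\: (d |: (Z :|: nbhd hub Z)))) => [W0|[w]].
  apply: (@hub_grow Z Z d) => //; [by left| |by right].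
  by rewrite -setD_eq0; exact/eqP.
rewrite in_setD in_setU1 in_setU => /andP[/norP[wd /norP[wZ wN]] wS].
case: (set_0Vmem ((Z :&: S) :\ u)) => [U0|[v]].
  apply: (@hub_single Z u) => //; apply/eqP; rewrite eqEsubset sub1set in_setI uZ uS andbT.
  by rewrite -setD_eq0 U0 eqxx.
rewrite in_setD1 in_setI => /and3P[vu vinZ vS].
have far x y : x \in Z -> y \notin Z -> y \notin nbhd hub Z -> ~~ hub x y.
  by move=> xZ yZ; apply: contra => hxy; apply/nbhdP; split=> //; exists x.
have bn x y : hub x y || hub y x = false -> y \in S -> x = b -> y = a \/ y = b.
  move=> H yS xb; case: (eqVneq y a) => [|ya]; [by left|].
  case: (eqVneq y b) => [|yb]; [by right|].
  by move: H; rewrite /hub /half xb eqxx yS ya yb /= !orbT.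
have fars x y : x \in Z -> y \notin Z -> y \notin nbhd hub Z -> hub x y || hub y x = false.
  by move=> xZ yZ yN; rewrite (hub_sym y) orbb; apply/negbTE; exact: far.
have neq x y : x \in Z -> y \notin Z -> x != y by move=> xZ; apply: contraNneq => <-.
have sub : u |: (v |: (d |: [set w])) \subset S by rewrite !subUset !sub1set uS vS dS wS.
have full : u |: (v |: (d |: [set w])) = S.
  apply/eqP; rewrite eqEcard sub S4 !cardsU1 cards1 !inE.
  rewrite (negPf (neq _ _ uZ dZ')) (negPf (neq _ _ uZ wZ)) eq_sym (negPf vu).
  by rewrite (negPf (neq _ _ vinZ dZ')) (negPf (neq _ _ vinZ wZ)) eq_sym (negPf wd).
have : b \in S by []. rewrite -full !inE.
have contra2 x y y' : x \in Z -> y \notin Z -> y \notin nbhd hub Z -> y \in S -> y' \notin Z ->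
   y' \notin nbhd hub Z -> y' \in S -> y != y' -> b = x -> False.
  move=> xZ yZ yN yS y'Z y'N y'S yy E.
  have [E1|E1] := bn _ _ (fars _ _ xZ yZ yN) yS (esym E); last by rewrite E1 E xZ in yZ.
  have [E2|E2] := bn _ _ (fars _ _ xZ y'Z y'N) y'S (esym E); last by rewrite E2 E xZ in y'Z.
  by rewrite E1 E2 eqxx in yy.
have contra3 y x x' : y \notin Z -> y \notin nbhd hub Z -> x \in Z -> x \in S ->
   x' \in Z -> x' \in S -> x != x' -> b = y -> False.
  move=> yZ yN xZ xS x'Z x'S xx E.
  have H1 := fars _ _ xZ yZ yN; have H2 := fars _ _ x'Z yZ yN.
  rewrite orbC in H1; rewrite orbC in H2.
  have [E1|E1] := bn _ _ H1 xS (esym E); last by rewrite -E -E1 xZ in yZ.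
  have [E2|E2] := bn _ _ H2 x'S (esym E); last by rewrite -E -E2 x'Z in yZ.
  by rewrite E1 E2 eqxx in xx.
have dw : d != w by rewrite eq_sym.
have uv : u != v by rewrite eq_sym.
case/or4P=> /eqP E.
- exact: (@contra2 u d w).
- exact: (@contra2 v d w).
- exact: (@contra3 d u v).
exact: (@contra3 w u v).
Qed.

(** The vertex [z0] brings one vertex and four edges, so the excess is that of the graph without it,
    while [1 < #|P|] makes the new graph smaller. *)
Lemma hub_contra : 1 < #|P| -> False.
Proof.
move=> P2; set Z1 := Y :\: P; set Y2 := z0 |: Z1.
have zZ1 : z0 \notin Z1 by rewrite inE z0P.
have cZ1 : #|Z1| + #|P| = #|Y| by rewrite cardsD (setIidPr PY); have := subset_leq_card PY; lia.
have cY2 : #|Y2| = #|Z1|.+1 by rewrite cardsU1 zZ1.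
have ltY2 : #|Y2| < #|Y| by lia.
have dZ1 : [disjoint Z1 & P] by rewrite disjoint_sym disjoints_subset; apply/subsetP=> x;
    rewrite !inE => ->.
have nv Z : Z \subset Y2 -> ~ violates hub Z.
  move=> sZ vZ.
  have [Z' [sZ' Z'0 vZ' tZ']] : exists Z, [/\ Z \subset Y2, Z != set0, violates hub Z &
      target hub Z (nbhd hub Z)].
    by apply: violator_target hub_sym hub_irr ltY2 _; exists Z.
  exact: hub_nv vZ' tZ'.
have YE : Z1 :|: P = Y by rewrite setUC -[RHS](setID Y P) (setIidPr PY).
have SY x : x \in S -> x \notin Y -> x \in nbhd g Y.
  move=> /nbhdP[_ [w wP gwx]] xY; apply/nbhdP; split=> //; exists w => //; exact: (subsetP PY).
have nbY2 : nbhd hub Y2 \subset nbhd g Y.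
  apply/subsetP=> y /nbhdP[]; rewrite in_setU1 => /norP[yz yZ1] [x xY2 hxy].
  have yP : y \notin P by apply: contra yz => yP; rewrite (hub_out hxy yP).
  have yY : y \notin Y by apply: contra yZ1 => yY; rewrite inE yP.
  case: (boolP (y \in S)) => [yS|yS]; first exact: SY.
  move: hxy; rewrite /hub /half (negPf yS) (negPf yz) /= !andbF /=.
  have -> : (y == b) = false by apply: contraNF yS => /eqP ->.
  rewrite orbF => /and3P[xP _ gxy]; apply/nbhdP; split=> //; exists x => //.
  move: xY2; rewrite in_setU1 in_setD xP => /orP[/eqP E|//].
  by rewrite E z0P in xP.
have eP := lightY PY Pk.
have eY : ecount g Y = ecount g P + ecount (del_verts g P) Z1 by rewrite -ecount_del // YE.
have eY2 : ecount hub Y2 = 4 + ecount (del_verts hub [set z0]) Z1.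
  have dz : [disjoint Z1 & [set z0]] by rewrite disjoint_sym disjoints1.
  rewrite /Y2 setUC (ecount_del hub_sym dz).
  by rewrite ecount1 ?hub_deg ?S4 //; [exact: hub_sym|exact: hub_irr].
have zY : z0 \notin nbhd g Y by apply/negP=> /nbhd_notin; rewrite (subsetP PY).
have qZ : qheavy hub Y2.
  have := @qheavy_super (del_verts hub [set z0]) P Z1 (del_verts_sym _ hub_sym) (subsetDl _ _).
  case=> //.
  - by rewrite eY leq_add2r -cZ1 addKn.
  - move=> x y _ dxy; rewrite /del_verts /hub dxy !inE /= andbT.
    have /and3P[xP yP _] := dxy.
    by apply/andP; split; [apply: contraNneq xP|apply: contraNneq yP] => ->.
  - by left; rewrite eY2 cY2 mulnS -addnA leq_add2l.
  move=> [h1 nf]; right; split; first by rewrite eY2 cY2 mulnS ltn_add2l.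
  move=> y; rewrite in_setU1 => /orP[/eqP ->|yZ].
    rewrite hub_deg; apply: leq_ltn_trans (subset_leq_card (subsetIl _ _)) _.
    by rewrite S4.
  apply: leq_ltn_trans (nf y yZ); apply/subset_leq_card/subsetP=> x.
  rewrite !in_setI !nbrsE => /andP[hyx /(subsetP nbY2) xN];
      rewrite xN andbT /del_verts hyx !inE andbT.
  by apply/andP; split; [apply: contraNneq zZ1|apply: contraNneq zY] => <-.
have [E tE] : nbhd hub Y2 = nbhd g Y /\ target hub Y2 (nbhd hub Y2).
  by apply: smaller_target hub_sym hub_irr _ nbY2 qZ nv; left.
apply: noT; rewrite -YE.
apply: (proj2 (@hub_target Z1 Y2 z0 dZ1 _ _ _)) => //; [by right| |by left].
rewrite E; apply/subsetP=> x xS; rewrite in_setU1 in_setU.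
case: (boolP (x \in Y)) => xY; last by rewrite (SY x) // !orbT.
by rewrite in_setD xY (nbhd_notin xS) orbT.
Qed.

End Hub.

(** * Heavy subsets, connectivity and the exact number of edges *)

Lemma no_rigid P : ~ rigid P.
Proof.
move=> rP; have [|Q rQ mQ] := @max_set _ rigid; first by exists P.
have [sQ lQ tQ] := rQ.
case: (leqP #|nbhd g Q| 3) => c3.
  have [F [F1 F2]] := target_clique gS c3 tQ.
  exact: (cliqued_contra sQ F1 F2).
have c4 : #|nbhd g Q| = 4 by have := leq_trans lQ k5; lia.
have [a [b [q [F [[aS bS ab] [q0 qQ cq] FS dF tb]]]]] := target_hub gS (ltn_trans (isT :
    1 < 3) c3) tQ.
have /set0Pn[z zQ] := target_nonempty tQ.
exact: (hub_contra sQ aS bS ab zQ c4 q0 qQ cq FS dF tb mQ lQ (target_card tQ)).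
Qed.

(** A set between [Z] and [Y] with the fewest neighbours is linked to [Z]. Taking [Y] whenever it
    attains the minimum leaves two cases: the paths start at all the roots, or at so few vertices
    that [no_rigid] applies. *)
Lemma min_link Z : Z \subset Y -> exists W M t,
  [/\ Z \subset W, W \subset Y, linked g Z W M t &
      W = Y \/ #|nbhd g W| < #|nbhd g Y|].
Proof.
move=> sZY.
have [|W /andP[ZW WY] mW] := @arg_minnP _ Y (fun W : {set T} =>
    (Z \subset W) && (W \subset Y)) (fun W => #|nbhd g W|).
  by rewrite sZY subxx.
case: (ltnP #|nbhd g W| #|nbhd g Y|) => [lt|ge].
  have [|M [t L]] := menger gS ZW.
    by move=> W' s1 s2; apply: mW; rewrite s1 (subset_trans s2).
  by exists W, M, t; split=> //; right.
have [|M [t L]] := menger gS sZY.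
  by move=> W' s1 s2; apply: leq_trans ge (mW _ _); rewrite s1.
by exists Y, M, t; split=> //; left.
Qed.

(** [Z] inherits lightness, so the induction hypothesis gives it a target, and a linkage carries
    this target outwards to [Y] or to a rigid set. *)
Lemma no_heavy_inner Z : Z \proper Y -> #|nbhd g Z| = #|nbhd g Y| -> ~ qheavy g Z.
Proof.
move=> ZY cZ qZ.
have sZY := proper_sub ZY.
have tZ : target g Z (nbhd g Z).
  apply: IH => //; [by left; exact: proper_card|by rewrite cZ|].
  by move=> P sP; rewrite cZ; apply: lightY; exact: subset_trans sZY.
have [W [M [t [ZW WY L WE]]]] := min_link sZY.
have tW := target_linked gS gI ZW L tZ.
case: WE => [E|lt]; first by apply: noT; rewrite -E.
by apply: (@no_rigid W).
Qed.

(** The case in which the roots have singleton branch sets. The covering hypothesis keeps a root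
    missed by [p] distinct from one missed by [q]. *)
Lemma target_direct p q : p != set0 -> q != set0 -> p \subset Y -> q \subset Y ->
  [disjoint p & q] -> conn g p -> conn g q ->
  touch g p q \/ (nbhd g Y \subset nbhd g p /\ nbhd g Y \subset nbhd g q) ->
  #|nbhd g Y :\: nbhd g p| <= 1 -> #|nbhd g Y :\: nbhd g q| <= 1 ->
  nbhd g Y \subset nbhd g p :|: nbhd g q -> target g Y (nbhd g Y).
Proof.
move=> p0 q0 pY qY dpq cp cq pq mp mq cov.
have /set0Pn[x0 x0p] := p0; have /set0Pn[y0 y0q] := q0.
exists p, q, (fun s => [set s]); split.
  split; [by split|by split| |].
    move=> s sN; have sY := nbhd_notin sN.
    split; rewrite ?set11 ?subsetUl //; first exact: conn1.
      by rewrite disjoint_sym disjoints1; apply: contra sY; exact: (subsetP pY).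
    by rewrite disjoint_sym disjoints1; apply: contra sY; exact: (subsetP qY).
  by move=> s s' _ _ ss'; rewrite disjoints1 inE.
have tch (r : {set T}) s : s \in nbhd g r -> touch g r [set s].
  by case/nbhdP=> _ [x xr gxs]; apply/touchP; exists x, s; rewrite set11.
have ex (r : {set T}) z0 : z0 \in Y -> #|nbhd g Y :\: nbhd g r| <= 1 ->
   exists2 a, a = z0 \/ a \in nbhd g Y :\: nbhd g r & forall s, s \in nbhd g Y -> s != a ->
       s \in nbhd g r.
  move=> z0Y; case: (set_0Vmem (nbhd g Y :\: nbhd g r)) => [E _|[a aN] c1].
    exists z0; first by left.
    by move=> s sN _; move/eqP: E; rewrite setD_eq0 => /subsetP; exact.
  exists a; first by right.
  move=> s sN; apply: contraR => sr; apply/eqP.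
  by apply: (card_le1_eqP c1) => //; rewrite in_setD sr.
have [a aE pa] := ex p x0 (subsetP pY _ x0p) mp.
have [b bE qb] := ex q y0 (subsetP qY _ y0q) mq.
have noY x : x \in Y -> x \in nbhd g Y -> False by move=> xY /nbhd_notin; rewrite xY.
exists a, b; split.
- apply/eqP=> E; move: aE bE; rewrite -E => -[->|]; last rewrite in_setD => /andP[ap aN].
    case=> [E1|]; first by have /disjointP/(_ x0 x0p) := dpq; apply; rewrite E1.
    by rewrite in_setD => /andP[_ /noY]; apply; exact: (subsetP pY).
  case=> [E1|]; first by apply: (noY a) => //; rewrite E1; exact: (subsetP qY).
  rewrite in_setD => /andP[aq _].
  by have := subsetP cov a aN; rewrite inE (negPf ap) (negPf aq).
- by move=> s sN sa; apply: tch; exact: pa.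
- by move=> s sN sb; apply: tch; exact: qb.
case: pq => [|[/subsetP sp /subsetP sq]]; [by left|right=> s sN].
by split; apply: tch; auto.
Qed.

Lemma Y_heavy : 4 * #|Y| < ecount g Y.
Proof. exact: qheavy_heavy. Qed.

Lemma rootsE u : u \in Y -> nbrs g u :&: nbhd g Y = nbrs g u :\: Y.
Proof.
move=> uY; apply/setP=> x; rewrite in_setI in_setD nbrsE andbC.
case: (boolP (g u x)) => gux; rewrite ?andbF // !andbT.
by apply/nbhdP/idP=> [[]//|xY]; split=> //; exists u.
Qed.

Lemma roots_sub u : u \in Y -> nbrs g u :\: Y \subset nbhd g Y.
Proof. by move=> uY; rewrite -rootsE // subsetIr. Qed.

Lemma heavy_nbhd Z : Z \subset Y -> 4 * #|Z| < ecount g Z -> #|nbhd g Y| <= #|nbhd g Z|.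
Proof.
by move=> sZ hZ; rewrite leqNgt; apply/negP=> /(lightY sZ); rewrite leqNgt hZ.
Qed.

Lemma heavy_inner Z : Z \proper Y -> 4 * #|Z| < ecount g Z -> #|nbhd g Z| = #|nbhd g Y| ->
  ecount g Z = 4 * #|Z| + 1 /\ exists2 z, z \in Z & 5 <= #|nbrs g z :&: nbhd g Z|.
Proof.
move=> pZ hZ cZ; have nq := no_heavy_inner pZ cZ.
split.
  have : ~ 4 * #|Z| + 2 <= ecount g Z by move=> H; apply: nq; left.
  move: hZ; move: (ecount _ _) => m; move: (4 * _) => n; clear; lia.
apply: NNPP => no; apply: nq; right; split=> // z zZ.
by rewrite ltnNge; apply/negP=> ge; apply: no; exists z.
Qed.

Lemma closed_nbhd C R : closed_in g (Y :\: R) C -> nbhd g C \subset nbhd g Y :|: R.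
Proof.
move=> [sC cl]; apply/subsetP=> y /nbhdP[yC [x xC gxy]]; rewrite in_setU.
case: (boolP (y \in R)) => yR; rewrite ?orbT // orbF.
have xY : x \in Y by have := subsetP sC x xC; rewrite inE => /andP[].
apply/nbhdP; split; last by exists x.
by apply: contra yC => yY; apply: (cl x) => //; rewrite in_setD yR.
Qed.

(** A heavy union of components other than [Y] has all the roots as neighbours, hence excess exactly
    one and a vertex seeing five roots. Two such vertices form the non-adjacent target. If only one
    part is heavy, the total excess is at most one although a vertex sees five roots, so [Y] is not
    quite heavy. *)
Lemma connY : conn g Y.
Proof.
move=> B sB B0 clB; apply: NNPP => BY.
have clYB : closed_in g Y B by split.
have clYD := closedD gS clYB.
have eY := ecount_closed gS clYB.
have part Z : closed_in g Y Z -> Z <> Y -> 4 * #|Z| < ecount g Z ->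
    ecount g Z = 4 * #|Z| + 1 /\ exists2 z, z \in Z &
        nbhd g Y \subset nbrs g z /\ 5 <= #|nbrs g z :&: nbhd g Y|.
  move=> cl ZY hZ.
  have sub : nbhd g Z \subset nbhd g Y.
    by have := @closed_nbhd Z set0; rewrite setD0 setU0; apply.
  have pZ : Z \proper Y by rewrite properEneq; have [-> _] := cl; rewrite andbT; apply/eqP.
  have E : nbhd g Z = nbhd g Y by apply/eqP; rewrite eqEcard sub heavy_nbhd //;
      exact: proper_sub.
  have [|eZ [z zZ z5]] := heavy_inner pZ hZ; first by rewrite E.
  split=> //; exists z => //; rewrite -E; split=> //.
  have : nbrs g z :&: nbhd g Z == nbhd g Z.
    by rewrite eqEcard subsetIr /= E; apply: leq_trans k5 _; rewrite -E.
  by move/eqP=> <-; exact: subsetIl.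
have cY : #|Y| = #|B| + #|Y :\: B|.
  by rewrite cardsD (setIidPr sB) subnKC // subset_leq_card.
have DY : Y :\: B <> Y.
  move=> E; have /set0Pn[b bB] := B0.
  by have := subsetP sB b bB; rewrite -E inE bB.
have dBD : [disjoint B & Y :\: B] by rewrite disjoints_subset; apply/subsetP=> x;
    rewrite !inE => ->.
have two z z' : z \in Y -> z' \in Y -> z != z' -> nbhd g Y \subset nbrs g z ->
    nbhd g Y \subset nbrs g z' -> False.
  move=> zY z'Y zz' fz fz'.
  have fu u : u \in Y -> nbhd g Y \subset nbrs g u -> nbhd g Y \subset nbhd g [set u].
    move=> uY fu; apply/subsetP=> x xN; apply/nbhdP; split.
      by rewrite inE; apply: contraNneq (nbhd_notin xN) => ->.
    by exists u; rewrite ?set11 // -nbrsE (subsetP fu).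
  apply: noT; apply: (@target_direct [set z] [set z']); rewrite ?sub1set //.
  - by apply/set0Pn; exists z; rewrite set11.
  - by apply/set0Pn; exists z'; rewrite set11.
  - by rewrite disjoints1 inE.
  - exact: conn1.
  - exact: conn1.
  - by right; split; apply: fu.
  - by move: (fu z zY fz); rewrite -setD_eq0 => /eqP ->; rewrite cards0.
  - by move: (fu z' z'Y fz'); rewrite -setD_eq0 => /eqP ->; rewrite cards0.
  by rewrite subsetU // fu.
have sDY : Y :\: B \subset Y by exact: subsetDl.
have excl z : z \in Y -> 5 <= #|nbrs g z :&: nbhd g Y| -> 4 * #|Y| + 2 <= ecount g Y.
  by move=> zY z5; case: heavyY => // -[_ /(_ z zY)]; rewrite ltnNge z5.
case: (ltnP (4 * #|B|) (ecount g B)) => hB.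
  have [eB [z zB [fz z5]]] := part B clYB BY hB.
  have zY := subsetP sB z zB.
  have hD : 4 * #|Y :\: B| < ecount g (Y :\: B).
    have := excl z zY z5; rewrite eY eB cY; clear; lia.
  have [_ [z' z'D [fz' _]]] := part _ clYD DY hD.
  apply: (two z z') => //; first exact: (subsetP sDY).
  by apply/eqP=> E; have /disjointP/(_ z zB) := dBD; apply; rewrite E.
have hD : 4 * #|Y :\: B| < ecount g (Y :\: B).
  have := Y_heavy; rewrite eY cY; move: hB; clear; lia.
have [eD [z zD [fz z5]]] := part _ clYD DY hD.
have := excl z (subsetP sDY _ zD) z5; rewrite eY eD cY; move: hB; clear; lia.
Qed.

Lemma Y_card : 1 < #|Y|.
Proof.
rewrite ltnNge leq_eqVlt ltnS leqn0; apply/negP=> /orP[/cards1P[y E]|]; last first.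
  by rewrite cards_eq0 => /eqP E; have := Y_heavy; rewrite E ecount_set0.
have yY : y \in Y by rewrite E set11.
have hy : ecount g Y = #|nbrs g y :&: nbhd g Y|.
  rewrite rootsE // E ecount1 //; congr #|pred_of_set _|; apply/setP=> x; rewrite !inE.
  by case: eqP => // ->; rewrite gI.
have := leq_trans (subset_leq_card (subsetIr (nbrs g y) _)) k5; rewrite -hy.
have h4 := Y_heavy; case: heavyY => [|[_ /(_ y yY)]]; rewrite -?hy; move: h4;
    rewrite E cards1; clear; lia.
Qed.

(** A heavy component [C] of [Y] minus [u] has at least five neighbours, of which only [u] is not a
    root, so it sees four roots. Its connected complement sees four roots through [u], and the two
    sides can serve as centres. *)
Lemma four_roots u : u \in Y -> #|nbhd g Y| = 5 -> 4 * #|Y :\ u| < ecount g (Y :\ u) ->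
  4 <= #|nbrs g u :\: Y| -> False.
Proof.
move=> uY k hu u4.
have [C [cC clC C0 hC]] := heavy_comp gS hu.
have [sC _] := clC.
have sCY : C \subset Y by apply: subset_trans sC _; exact: subsetDl.
have uC : u \notin C by apply/negP=> /(subsetP sC); rewrite !inE eqxx.
have sub := closed_nbhd clC.
have ge5 := heavy_nbhd sCY hC; rewrite k in ge5.
have cD : conn g (Y :\: C).
  apply: (@conn_compl _ g Y [set u]) clC => //; [exact: connY|exact: conn1| |].
    by apply/set0Pn; exists u; rewrite set11.
  by rewrite sub1set.
have uN : u \in nbhd g C.
  apply: NNPP => uN.
  have CY : C = Y.
    apply: connY => // x y xC yY gxy; apply: contraT => yC.
    have yN : y \in nbhd g C by apply/nbhdP; split=> //; exists x.
    have := subsetP sub y yN; rewrite in_setU => /orP[/nbhd_notin|/set1P yu];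
        first by rewrite yY.
    by case: uN; rewrite -yu.
  by rewrite CY uY in uC.
have C4 : #|nbhd g Y :\: nbhd g C| <= 1.
  have sub2 : nbhd g C :\ u \subset nbhd g Y :&: nbhd g C.
    apply/subsetP=> x; rewrite in_setD1 => /andP[xu xN]; rewrite in_setI xN andbT.
    by have := subsetP sub x xN; rewrite in_setU inE (negPf xu) orbF.
  have := subset_leq_card sub2; have := cardsID (nbhd g C) (nbhd g Y).
  move: ge5; rewrite k (cardsD1 u (nbhd g C)) uN; clear; lia.
have sub3 : nbrs g u :\: Y \subset nbhd g Y :&: nbhd g (Y :\: C).
  apply/subsetP=> x xu; rewrite in_setI (subsetP (roots_sub uY)) //=.
  move: xu; rewrite in_setD nbrsE => /andP[xY gux]; apply/nbhdP.
  by rewrite !inE (negPf xY) andbF; split=> //; exists u; rewrite // !inE uC.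
have D4 : #|nbhd g Y :\: nbhd g (Y :\: C)| <= 1.
  have := subset_leq_card sub3; have := cardsID (nbhd g (Y :\: C)) (nbhd g Y).
  move: u4; rewrite k; clear; lia.
apply: noT; apply: (@target_direct (Y :\: C) C) => //.
- by apply/set0Pn; exists u; rewrite inE uC.
- exact: subsetDl.
- by rewrite disjoints_subset; apply/subsetP=> x; rewrite !inE => /andP[].
- left; have /nbhdP[_ [x xC gxu]] := uN; apply/touchP; exists u, x; split=> //.
    by rewrite inE uC.
  by rewrite gS.
apply/subsetP=> x /nbhdP[xY [y yY gyx]]; rewrite in_setU.
case: (boolP (y \in C)) => yC; apply/orP; [right|left]; apply/nbhdP.
  by split; [apply: contra xY; exact: (subsetP sCY)|exists y].
by rewrite inE (negPf xY) andbF; split=> //; exists y; rewrite // inE yC.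
Qed.

(** A vertex seeing five roots forces excess at least two. Removing it costs five edges and one
    vertex, which leaves excess at least one. *)
Lemma no_full u : u \in Y -> #|nbrs g u :\: Y| < 5.
Proof.
move=> uY; rewrite ltnNge; apply/negP=> u5.
have le5 := leq_trans (subset_leq_card (roots_sub uY)) k5.
have k : #|nbhd g Y| = 5.
  apply/eqP; rewrite eqn_leq k5; exact: leq_trans u5 (subset_leq_card (roots_sub uY)).
apply: (four_roots uY k); last exact: ltnW.
have e1 := ecount_rem1 gS gI uY; have c1 := cardsD1 u Y; rewrite uY in c1.
case: heavyY => [h2|[_ /(_ u uY)]]; last by rewrite rootsE // ltnNge u5.
move: h2 le5; rewrite e1 c1; clear; lia.
Qed.

Definition del_edge a b : rel T := fun x y =>
  g x y && ~~ ((x == a) && (y == b) || (x == b) && (y == a)).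

(** With excess two or more, an edge inside [Y] can be deleted: the excess stays positive, and by
    [no_full] no vertex sees five roots. This is why the induction also counts edges. *)
Lemma ecount_exact : ecount g Y = 4 * #|Y| + 1.
Proof.
apply: NNPP => ne.
have h2 : 4 * #|Y| + 2 <= ecount g Y.
  have := Y_heavy; move: ne; move: (ecount _ _) => m; move: (4 * _) => n; clear; lia.
have [a [b [aY bY gab]]] : exists a b, [/\ a \in Y, b \in Y & g a b].
  have /card_gt0P[y yY] : 0 < #|Y| by apply: ltn_trans Y_card.
  apply: NNPP => no.
  have E : [set y] = Y.
    apply: connY; rewrite ?sub1set //; first by apply/set0Pn; exists y; rewrite set11.
    move=> x z /set1P -> zY gyz; case: no; by exists y, z.
  by have := Y_card; rewrite -E cards1.
have ab : a != b by apply: contraTneq gab => ->; rewrite gI.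
have hS : symmetric (del_edge a b).
  by move=> x y; rewrite /del_edge gS orbC; congr (_ && ~~ (_ || _)); rewrite andbC.
have hI : irreflexive (del_edge a b) by move=> x; rewrite /del_edge gI.
have hsub x y : del_edge a b x y -> g x y by case/andP.
have nab : ~~ del_edge a b a b by rewrite /del_edge !eqxx andbF.
have nba : ~~ del_edge a b b a by rewrite hS.
have nbsub Z : nbhd (del_edge a b) Z \subset nbhd g Z.
  by apply/subsetP=> y /nbhdP[yZ [x xZ /hsub gxy]]; apply/nbhdP; split=> //; exists x.
have le1 : ecount g Y <= (ecount (del_edge a b) Y).+1.
  have sub : touching g Y \subset [set a; b] |: touching (del_edge a b) Y.
    apply/subsetP=> e /touchingP[x [y [xY gxy ->]]]; rewrite in_setU1.
    case: (boolP (del_edge a b x y)) => [hxy|].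
      by apply/orP; right; apply/touchingP; exists x, y.
    rewrite /del_edge gxy /= negbK => /orP[]/andP[/eqP -> /eqP ->]; rewrite ?eqxx //.
    by rewrite setUC eqxx.
  apply: leq_trans (subset_leq_card sub) _; rewrite cardsU1.
  by case: (_ \notin _); rewrite ?leqnSn.
have lt1 : ecount (del_edge a b) Y < ecount g Y.
  by apply: (@ecount_lt _ (del_edge a b) g Y a b) => // x y _; exact: hsub.
have qh : qheavy (del_edge a b) Y.
  right; split; first by move: h2 le1; clear; lia.
  move=> y yY; apply: leq_ltn_trans (no_full yY); rewrite -rootsE //.
  by apply/subset_leq_card/setISS; [apply/subsetP=> x; rewrite !nbrsE;
      exact: hsub|exact: nbsub].
(* The deletion can shrink the neighbourhood of [P] only if [P] contains exactly one end, and then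
   only by the other end [y]. A violator of this kind has excess at least two in [g] and as many
   neighbours as [Y], against [no_heavy_inner]. *)
have one P x y : P \subset Y -> x \in P -> y \in Y -> y \notin P -> g x y ->
    ~~ del_edge a b x y ->
    (forall c d, c \in P -> d \notin P -> g c d -> ~~ del_edge a b c d -> d = y) ->
        ~ violates (del_edge a b) P.
  move=> sP xP yY yP gxy nxy uniq [lt hv].
  have lt2 : ecount (del_edge a b) P < ecount g P.
    by apply: (@ecount_lt _ (del_edge a b) g P x y) => // c d _; exact: hsub.
  have sub : nbhd g P \subset y |: nbhd (del_edge a b) P.
    apply/subsetP=> d /nbhdP[dP [c cP gcd]]; rewrite in_setU1.
    case: (boolP (del_edge a b c d)) => hcd; last by rewrite (uniq c d) ?eqxx.
    by apply/orP; right; apply/nbhdP; split=> //; exists c.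
  have le := heavy_nbhd sP (ltn_trans hv lt2).
  have c1 : #|nbhd g P| = #|nbhd g Y|.
    apply/eqP; rewrite eqn_leq le andbT; apply: leq_trans (subset_leq_card sub) _.
    rewrite cardsU1; apply: leq_trans lt; by case: (_ \notin _); rewrite ?leqnSn.
  apply: (@no_heavy_inner P) => //.
    by apply/properP; split=> //; exists y.
  by left; move: hv lt2; clear; lia.
have nv P : P \subset Y -> ~ violates (del_edge a b) P.
  move=> sP vP.
  have charn c d : c \in P -> d \notin P -> g c d -> ~~ del_edge a b c d ->
      (c = a /\ d = b) \/ (c = b /\ d = a).
    move=> _ _ gcd; rewrite /del_edge gcd /= negbK => /orP[]/andP[/eqP -> /eqP ->];
        by [left|right].
  case: (boolP (a \in P)) => aP; case: (boolP (b \in P)) => bP.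
  - have agr c d : c \in P -> d \notin P -> g c d -> del_edge a b c d.
      move=> cP dP gcd; apply: contraT => n; have [[_ E]|[_ E]] := charn c d cP dP gcd n.
        by rewrite E bP in dP.
      by rewrite E aP in dP.
    have E : nbhd g P \subset nbhd (del_edge a b) P.
      apply/subsetP=> d /nbhdP[dP [c cP gcd]]; apply/nbhdP; split=> //; exists c => //;
          exact: agr.
    have [lt hv] := vP.
    have le : ecount (del_edge a b) P <= ecount g P by apply: ecount_le => c d _; exact: hsub.
    have := heavy_nbhd sP (leq_trans hv le); rewrite leqNgt.
    by rewrite (leq_ltn_trans (subset_leq_card E) lt).
  - apply: (@one P a b) vP => // c d cP dP gcd n.
    have [[_ ->]//|[E _]] := charn c d cP dP gcd n; by rewrite E (negPf bP) in cP.
  - apply: (@one P b a) vP => //; first by rewrite gS.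
    move=> c d cP dP gcd n; have [[E _]|[_ ->]//] := charn c d cP dP gcd n.
    by rewrite E (negPf aP) in cP.
  have agr c d : c \in P -> g c d -> del_edge a b c d.
    move=> cP gcd; rewrite /del_edge gcd /=; apply/negP=> /orP[]/andP[/eqP E _].
      by rewrite E (negPf aP) in cP.
    by rewrite E (negPf bP) in cP.
  have E : nbhd g P \subset nbhd (del_edge a b) P.
    apply/subsetP=> d /nbhdP[dP [c cP gcd]]; apply/nbhdP; split=> //; exists c => //;
        exact: agr.
  have [lt hv] := vP.
  have le : ecount (del_edge a b) P <= ecount g P by apply: ecount_le => c d _; exact: hsub.
  have := heavy_nbhd sP (leq_trans hv le); rewrite leqNgt.
  by rewrite (leq_ltn_trans (subset_leq_card E) lt).
have [E t] := smaller_target hS hI (or_intror (conj erefl lt1)) (nbsub Y) qh nv.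
apply: noT; rewrite -E; exact: target_mono t.
Qed.

(** Removing a vertex with exactly four roots leaves the excess unchanged, so [four_roots]
    applies. *)
Lemma le3_roots u : u \in Y -> #|nbhd g Y| = 5 -> #|nbrs g u :\: Y| <= 3.
Proof.
move=> uY k; rewrite leqNgt; apply/negP=> u4; apply: (four_roots uY k) => //.
have := no_full uY; have := ecount_exact; rewrite (ecount_rem1 gS gI uY) (cardsD1 u Y) uY.
by clear; lia.
Qed.

(** * Contracting an edge *)

Section Contraction.
Variables (u v : T).
Hypotheses (uY : u \in Y) (guv : g u v).

(** [u] is merged into [v], which may be a root. The vertex [u] becomes isolated instead of
    disappearing, so that the vertex type stays the same. *)
Definition contract : rel T := fun x y =>
  [&& x != u, y != u & [|| g x y, [&& x == v, y != v & g u y] | [&& y == v, x != v & g u x]]].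

Lemma contract_sym : symmetric contract.
Proof.
move=> x y; rewrite /contract gS andbCA; congr [&& _, _ & (_ || _)]; exact: orbC.
Qed.

Lemma contract_irr : irreflexive contract.
Proof. by move=> x; rewrite /contract gI; case: (x == v); rewrite /= ?andbF. Qed.

Lemma uv_neq : u != v.
Proof. by apply: contraTneq guv => ->; rewrite gI. Qed.

Lemma contract_nbrs : nbrs contract v = (nbrs g u :|: nbrs g v) :\: [set u; v].
Proof.
apply/setP=> y; rewrite !inE /contract eqxx [v == u]eq_sym (negPf uv_neq) /=.
case: (eqVneq y u) => //= yu; case: (eqVneq y v) => [->|yv] /=; first by rewrite gI.
by rewrite orbF orbC.
Qed.

Lemma contract_del x y : del_verts contract [set v] x y = del_verts g [set u; v] x y.
Proof.
rewrite /del_verts /contract !inE; case: (x == v); case: (y == v); case: (x == u);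
    case: (y == u) => //=.
by rewrite orbF.
Qed.

Lemma contract_degree Z : u \notin Z -> v \notin Z ->
  #|nbrs contract v :\: Z| + 2 + #|(nbrs g u :&: nbrs g v) :\: Z| = #|nbrs g u :\: Z| + #|nbrs g v :\: Z|.
Proof.
move=> uZ vZ; have := cardsUI (nbrs g u :\: Z) (nbrs g v :\: Z).
rewrite -setDUl => <-; congr (_ + _); last first.
  by apply: eq_card => x; rewrite !inE; case: (x \in Z).
have -> : (nbrs g u :|: nbrs g v) :\: Z = (nbrs contract v :\: Z) :|: [set u; v].
  apply/setP=> x; rewrite contract_nbrs !inE.
  case: (eqVneq x u) => [->|xu]; first by rewrite uZ [g v u]gS guv /= !orbT.
  case: (eqVneq x v) => [->|xv]; first by rewrite vZ guv /= ?orbT.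
  by rewrite !orbF.
rewrite cardsU cards2 uv_neq; set I := _ :&: _.
suff -> : I = set0 by rewrite cards0 subn0.
apply/setP=> x; rewrite /I contract_nbrs !inE.
by case: (x == u) => //=; case: (x == v); rewrite ?andbF.
Qed.

Lemma ecount_contract_in Z : u \notin Z -> v \notin Z ->
  ecount g (u |: (v |: Z)) = ecount contract (v |: Z) + 1 + #|nbrs g u :&: nbrs g v|.
Proof.
move=> uZ vZ; have uv := uv_neq.
have dg : [disjoint Z & [set u; v]].
  by rewrite disjoint_sym disjoints_subset; apply/subsetP=> x; rewrite !inE => /orP[]/eqP ->.
have dv : [disjoint Z & [set v]] by rewrite disjoint_sym disjoints1.
have -> : u |: (v |: Z) = Z :|: [set u; v] by rewrite setUA setUC.
have -> : v |: Z = Z :|: [set v] by rewrite setUC.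
rewrite (ecount_del gS dg) (ecount_del contract_sym dv).
have -> : ecount (del_verts contract [set v]) Z = ecount (del_verts g [set u; v]) Z.
  by apply: ecount_ext => x y _; exact: contract_del.
rewrite ecount1; [|exact: contract_sym|exact: contract_irr].
rewrite ecount_add1 ?inE // ecount1 //.
have := @contract_degree set0; rewrite !inE !setD0 => /(_ isT isT).
have := cardsD1 v (nbrs g u); rewrite inE guv.
by clear; lia.
Qed.

Lemma ecount_contract_out Z : u \notin Z -> v \notin Z ->
  ecount g Z = ecount contract Z + #|nbrs g u :&: nbrs g v :&: Z|.
Proof.
move=> uZ vZ; have := ecount_contract_in uZ vZ.
have uvZ : u \notin v |: Z by rewrite in_setU1 negb_or uv_neq.
rewrite (ecount_add1 gS gI uvZ) (ecount_add1 gS gI vZ) (ecount_add1 contract_sym contract_irr vZ).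
have := contract_degree uZ vZ; have := cardsID Z (nbrs g u :&: nbrs g v).
have -> : #|nbrs g u :\: Z| = (#|nbrs g u :\: (v |: Z)|).+1.
  by rewrite (cardsD1 v) !inE guv vZ /= setDDl [Z :|: _]setUC.
by clear; lia.
Qed.

(* Pairs of roots count as edges. *)
Definition ntriangles := #|[set y in nbrs g u | (y != v) && (g v y || (v \notin Y) && (y \notin Y))]|.

(** Lost are the edge [uv] and one of two parallel edges for every common neighbour. If [v] is a
    root, the edges from [u] to other roots are lost as well, since they become edges between
    roots. *)
Lemma ecount_contract_Y : ecount g Y = ecount contract (Y :\ u) + 1 + ntriangles.
Proof.
have uv := uv_neq.
case: (boolP (v \in Y)) => vY.
  have E : Y :\ u = v |: (Y :\ u :\ v) by rewrite setD1K // !inE eq_sym uv.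
  have := @ecount_contract_in (Y :\ u :\ v); rewrite !inE !eqxx /= andbF -E (setD1K uY).
  move=> /(_ isT isT) ->; congr (_ + _); apply: eq_card => y; rewrite !inE vY orbF.
  by case: (g u y) => //=; case: (eqVneq y v) => [->|]; rewrite ?gI.
have uZ : u \notin Y :\ u by rewrite !inE eqxx.
have vZ : v \notin Y :\ u by rewrite !inE (negPf vY) andbF.
rewrite (ecount_rem1 gS gI uY) (ecount_contract_out uZ vZ) /ntriangles;
    set R := [set y in nbrs g u | _].
have e1 : #|nbrs g u :\: Y| = 1 + #|R :\: Y|.
  rewrite (cardsD1 v) !inE guv vY /=; congr (_ + _).
  apply: eq_card => y; rewrite !inE vY /=; case: (y \in Y); case: (y == v); case: (g u y) =>
      //=.
  by rewrite orbT.
have e2 : #|nbrs g u :&: nbrs g v :&: (Y :\ u)| = #|R :&: Y|.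
  apply: eq_card => y; rewrite !inE.
  case: (eqVneq y u) => [->|yu]; first by rewrite gI !andbF.
  case: (eqVneq y v) => [->|yv]; first by rewrite (negPf vY) !andbF.
  by case: (y \in Y); rewrite ?andbF ?andbT ?orbF.
rewrite e1 e2 -(cardsID Y R); clear; lia.
Qed.

Lemma contract_nbhd : nbhd contract (Y :\ u) \subset nbhd g Y.
Proof.
apply/subsetP=> y /nbhdP[yY' [x]]; rewrite in_setD1 => /andP[xu xY] /and3P[_ yu hxy].
have yY : y \notin Y by move: yY'; rewrite in_setD1 yu.
apply/nbhdP; split=> //; case/or3P: hxy => [gxy|/and3P[_ _ guy]|/and3P[/eqP -> _ _]].
- by exists x.
- by exists u.
by exists u.
Qed.

Lemma contract_target Z : u \notin Z -> v \in Z :|: nbhd contract Z ->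
  nbhd g (u |: Z) \subset nbhd contract Z -> target contract Z (nbhd contract Z) ->
  target g (u |: Z) (nbhd g (u |: Z)).
Proof.
move=> uZ vZ sub; have uv := uv_neq.
pose F x := if x == v then [set u; v] else [set x].
have xF x : x \in F x by rewrite /F; case: eqP => [->|_]; rewrite ?set22 ?set11.
have Fsub x : F x \subset u |: [set x].
  by rewrite /F; case: eqP => [->|_]; rewrite ?subxx // subsetUr.
have nu x : x \in Z :|: id @: nbhd g (u |: Z) -> x != u.
  rewrite inE imset_id => /orP[xZ|/nbhd_notin]; first by apply: contraNneq uZ => <-.
  by rewrite !inE => /norP[].
apply: (@target_transfer _ _ _ _ _ _ _ F id) => //.
- exact: contract_sym.
- exact: contract_irr.
- by move=> s sN; exact: (subsetP sub).
- move=> x _; split; first by apply/set0Pn; exists x.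
  by rewrite /F; case: eqP => _; [exact: conn2|exact: conn1].
- by move=> y yZ; apply: subset_trans (Fsub y) _; rewrite setUS // sub1set.
- move=> s sN; split=> //; apply: subset_trans (Fsub s) _.
  by rewrite setUC setUS // subsetUl.
- move=> x y /nu xu /nu yu xy; apply/disjointP=> z zx zy.
  have zE w : w != u -> z \in F w -> z = w \/ z = u /\ w = v.
    rewrite /F => wu; case: (eqVneq w v) => [->|_]; last by move/set1P; left.
    by case/set2P; [right|left].
  move/eqP: xy; apply; have [E|[E E1]] := zE x xu zx; have [E'|[E' E2]] := zE y yu zy.
  + by rewrite -E -E'.
  + by rewrite -E E' eqxx in xu.
  + by rewrite -E' E eqxx in yu.
  by rewrite E1 E2.
move=> x y xZ yD /and3P[xu yu /or3P[gxy|/and3P[/eqP -> yv guy]|/and3P[/eqP -> xv gux]]];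
  apply/touchP.
- by exists x, y.
- by exists u, y; rewrite xF /F eqxx set21.
by exists x, u; rewrite xF /F eqxx set21 gS.
Qed.

(** The delicate violator has [v] as a neighbour without containing it. Undoing the contraction adds
    [u] to its neighbours, so in [g] it has as many neighbours as [Y], excess exactly one, and a
    vertex [z] adjacent to all of them. The triangle [u v z] costs the contracted graph an edge, so
    the excess there is not positive. *)
Lemma contract_nv Z : Z \subset Y :\ u -> ~ violates contract Z.
Proof.
move=> sZ0 vZ0; have uv := uv_neq.
have ltY : #|Y :\ u| < #|Y| by rewrite (cardsD1 u Y) uY.
have [Z' [sZ Z0 [lt hv] tZ]] : exists Z, [/\ Z \subset Y :\ u, Z != set0,
    violates contract Z & target contract Z (nbhd contract Z)].
  by apply: violator_target contract_sym contract_irr ltY _; exists Z.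
have /andP[sZY uZ] : (Z' \subset Y) && (u \notin Z') by rewrite -subsetD1.
case: (boolP (v \in Z')) => vZ.
  have sub : nbhd g (u |: Z') \subset nbhd contract Z'.
    apply/subsetP=> y /nbhdP[]; rewrite in_setU1 => /norP[yu yZ] [x].
    rewrite in_setU1 => /orP[/eqP ->|xZ] gxy; apply/nbhdP; split=> //.
      exists v => //; rewrite /contract eq_sym uv yu eqxx gxy /= andbT.
      by have -> : y != v by [apply: contraNneq yZ => ->]; rewrite orbT.
    exists x => //; rewrite /contract yu gxy andbT.
    by apply: contraNneq uZ => <-.
  apply: (@no_rigid (u |: Z')); split.
  - by rewrite subUset sub1set uY.
  - exact: leq_ltn_trans (subset_leq_card sub) lt.
  by apply: contract_target => //; rewrite inE vZ.
have zu x : x \in Z' -> x != u by move=> xZ; apply: contraNneq uZ => <-.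
have zv x : x \in Z' -> x != v by move=> xZ; apply: contraNneq vZ => <-.
case: (boolP (v \in nbhd contract Z')) => vN; last first.
  have nv x : x \in Z' -> contract x v = false.
    by move=> xZ; apply: contraNF vN => hxv; apply/nbhdP; split=> //; exists x.
  have agr x y : x \in Z' -> contract x y = g x y.
    move=> xZ; have := nv x xZ;
        rewrite /contract (zu x xZ) [v == u]eq_sym uv eqxx (zv x xZ) (negPf (zv x xZ)) /=.
    rewrite ?andbT => /norP[gxv gux].
    case: (eqVneq y u) => [->|yu]; first by rewrite [g x u]gS (negPf gux).
    by rewrite (negPf gux) !andbF orbF.
  by have := lightY sZY; rewrite -(nbhd_ext agr) -(ecount_ext agr) => /(_ lt);
      rewrite leqNgt hv.
have eZ := ecount_contract_out uZ vZ.
have sub : nbhd g Z' \subset u |: nbhd contract Z'.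
  apply/subsetP=> y /nbhdP[yZ [x xZ gxy]]; rewrite in_setU1.
  case: eqP => //= /eqP yu; apply/nbhdP; split=> //; exists x => //.
  by rewrite /contract (zu x xZ) yu gxy.
have hg : 4 * #|Z'| < ecount g Z' by rewrite eZ; apply: leq_trans hv (leq_addr _ _).
have ge := heavy_nbhd sZY hg.
have cU : #|u |: nbhd contract Z'| <= #|nbhd g Y|.
  rewrite cardsU1; apply: leq_trans lt; by case: (_ \notin _); rewrite ?leqnSn.
have cE : #|nbhd g Z'| = #|nbhd g Y|.
  by apply/eqP; rewrite eqn_leq ge andbT; apply: leq_trans (subset_leq_card sub) cU.
have nE : nbhd g Z' = u |: nbhd contract Z' by apply/eqP; rewrite eqEcard sub cE.
have uN : u \in nbhd g Z' by rewrite nE setU11.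
have vN' : v \in nbhd g Z' by rewrite nE in_setU1 vN orbT.
have pZ : Z' \proper Y by apply/properP; split=> //; exists u.
have [eE [z zZ z5]] := heavy_inner pZ hg cE.
have full : nbhd g Z' \subset nbrs g z.
  have : nbrs g z :&: nbhd g Z' == nbhd g Z'.
    by rewrite eqEcard subsetIr cE /=; exact: leq_trans k5 z5.
  by move/eqP=> <-; exact: subsetIl.
have : 0 < #|nbrs g u :&: nbrs g v :&: Z'|.
  apply/card_gt0P; exists z; rewrite !in_setI zZ andbT !nbrsE.
  by apply/andP; split; rewrite gS -nbrsE; apply: (subsetP full).
by move: hv eE; rewrite eZ; clear; lia.
Qed.

(** With at most three triangles the contraction keeps a positive excess, so by minimality some
    vertex of it sees five roots. If [v] is a root, contraction gives another vertex at most the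
    root [v], and [le3_roots] excludes this. Otherwise only the merged vertex gains roots, so [u]
    and [v] together see all five. *)
Lemma ntriangles_ge4 : 4 <= ntriangles \/
  [/\ v \in Y, #|nbhd g Y| = 5 & nbhd g Y \subset nbrs g u :|: nbrs g v].
Proof.
case: (leqP 4 ntriangles) => t4; [by left|right].
have eY := ecount_contract_Y; rewrite ecount_exact (cardsD1 u Y) uY in eY.
have ltY : #|Y :\ u| < #|Y| by rewrite (cardsD1 u Y) uY.
have nq : ~ qheavy contract (Y :\ u).
  move=> qh; have [E t] := smaller_target contract_sym contract_irr (or_introl ltY) contract_nbhd qh contract_nv.
  apply: noT; rewrite -(setD1K uY); apply: contract_target => //.
  - by rewrite !inE eqxx.
  - rewrite E inE !in_setD1 eq_sym uv_neq /=.
    case: (boolP (v \in Y)) => //= vY; apply/nbhdP; split=> //; by exists u.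
  by rewrite (setD1K uY) E.
have [y yY y5] : exists2 y, y \in Y :\ u & 5 <= #|nbrs contract y :&: nbhd contract (Y :\ u)|.
  apply: NNPP => no; apply: nq; right; split; first by move: eY t4; clear; lia.
  by move=> y yY; rewrite ltnNge; apply/negP=> y5; apply: no; exists y.
have {}y5 : 5 <= #|nbrs contract y :&: nbhd g Y|.
  by apply: leq_trans y5 _; apply/subset_leq_card/setIS/contract_nbhd.
have k : #|nbhd g Y| = 5.
  apply/eqP; rewrite eqn_leq k5; apply: leq_trans y5 _; apply: subset_leq_card; exact: subsetIr.
have full : nbhd g Y \subset nbrs contract y.
  have : nbrs contract y :&: nbhd g Y == nbhd g Y by rewrite eqEcard subsetIr k.
  by move/eqP=> <-; exact: subsetIl.
have [yu yY'] : y != u /\ y \in Y by move: yY; rewrite !inE => /andP[].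
case: (boolP (v \in Y)) => vY.
  split=> //; case: (eqVneq y v) => [E|yv].
    by apply: subset_trans full _; rewrite E contract_nbrs subsetDl.
  have := no_full yY'; rewrite ltnNge -k => /negP[]; rewrite -rootsE //.
  apply/subset_leq_card/subsetP=> x xN; rewrite in_setI xN andbT.
  have := subsetP full x xN; rewrite !nbrsE /contract (negPf yv) /=.
  have -> : (x == v) = false by apply: contraTF xN => /eqP ->; apply/negP=> /nbhd_notin;
      rewrite vY.
  by rewrite /= orbF => /and3P[].
have := le3_roots yY' k; rewrite leqNgt => /negP[].
have sub : nbhd g Y :\ v \subset nbrs g y :\: Y.
  apply/subsetP=> x; rewrite in_setD1 => /andP[xv xN].
  rewrite in_setD (nbhd_notin xN) /=; have := subsetP full x xN.
  have yv : y != v by apply: contraTneq yY' => ->.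
  by rewrite !nbrsE /contract (negPf yv) (negPf xv) /= orbF => /and3P[].
apply: leq_trans (subset_leq_card sub).
have : #|nbhd g Y| <= 1 + #|nbhd g Y :\ v| by rewrite (cardsD1 v (nbhd g Y)) leq_add2r;
    case: (_ \in _).
by rewrite k.
Qed.

End Contraction.

(** * Adjacent pairs that together see all five roots *)

Section FullPair.
Hypothesis k : #|nbhd g Y| = 5.

Definition full_pair u v := [/\ u \in Y, v \in Y, g u v &
    nbhd g Y \subset nbrs g u :|: nbrs g v].

(** A union of components of [Y] minus [u] and [v]; [piece] selects a single component. *)
Definition sealed u v C := [/\ C \subset Y, u \notin C, v \notin C &
  forall x y, x \in C -> y \in Y -> g x y -> [|| y \in C, y == u | y == v]].

Definition piece u v C := [/\ sealed u v C, conn g C & C != set0].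

(* The components C of Y minus u and v with ecount g C > 4 #|C|: they have three
   roots and can be joined to u or to v as needed. *)
Definition bridge u v C :=
  [/\ piece u v C, u \in nbhd g C, v \in nbhd g C & #|nbhd g C :&: nbhd g Y| = 3].

Lemma full_pairC u v : full_pair u v -> full_pair v u.
Proof. by case=> uY vY guv sub; split; rewrite // 1?gS // setUC. Qed.

Lemma sealedC u v C : sealed u v C -> sealed v u C.
Proof.
case=> sC uC vC cl; split=> // x y xC yY gxy.
by have := cl x y xC yY gxy; case: (y \in C); case: (y == u); case: (y == v).
Qed.

Lemma pieceC u v C : piece u v C -> piece v u C.
Proof. by case=> /sealedC ? ? ?; split. Qed.

Lemma sealed_closed u v C : sealed u v C -> closed_in g (Y :\: [set u; v]) C.
Proof.
case=> sC uC vC cl; split.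
  apply/subsetP=> x xC; rewrite !inE (subsetP sC) // andbT.
  by apply/norP; split; apply: contraTneq xC => ->.
move=> x y xC; rewrite !inE => /andP[/norP[yu yv] yY] gxy.
by have := cl x y xC yY gxy; rewrite (negPf yu) (negPf yv) !orbF.
Qed.

Lemma sealed_nbhd u v C : sealed u v C -> nbhd g C \subset nbhd g Y :|: [set u; v].
Proof. by move/sealed_closed/closed_nbhd. Qed.

Lemma piece_meet u v C C' : piece u v C -> piece u v C' -> C != C' -> [disjoint C & C'].
Proof.
move=> [[sC uC vC cl] cC C0] [[sC' uC' vC' cl'] cC' C0'] CC'.
apply/disjointP=> x xC xC'.
have E : C :&: C' = C.
  apply: cC; [exact: subsetIl|by apply/set0Pn; exists x; rewrite inE xC|].
  move=> a b; rewrite !inE => /andP[aC aC'] bC gab; rewrite bC /=.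
  have := cl' a b aC' (subsetP sC _ bC) gab.
  case/or3P=> // /eqP E; move: bC; rewrite E; first by rewrite (negPf uC).
  by rewrite (negPf vC).
have E' : C :&: C' = C'.
  apply: cC'; [exact: subsetIr|by apply/set0Pn; exists x; rewrite inE xC|].
  move=> a b; rewrite !inE => /andP[aC aC'] bC gab; rewrite bC andbT.
  have := cl a b aC (subsetP sC' _ bC) gab.
  case/or3P=> // /eqP E1; move: bC; rewrite E1; first by rewrite (negPf uC').
  by rewrite (negPf vC').
by move/eqP: CC'; apply; rewrite -E -{2}E'.
Qed.

Lemma roots_nbhd u (p : {set T}) : u \in p -> p \subset Y -> nbrs g u :\: Y \subset nbhd g p.
Proof.
move=> up pY; apply/subsetP=> x; rewrite in_setD nbrsE => /andP[xY gux].
apply/nbhdP; split; last by exists u.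
by apply: contra xY; exact: (subsetP pY).
Qed.

(** With four roots, the piece and its complement would be two centres: the complement is connected
    and sees all the roots through [u] and [v]. *)
Lemma piece_roots u v C : full_pair u v -> piece u v C -> #|nbhd g C :&: nbhd g Y| <= 3.
Proof.
move=> [uY vY guv full] [sC cC C0].
have clC := sealed_closed sC; have [sCY uC vC cl] := sC.
rewrite leqNgt; apply/negP=> C4.
have cD : conn g (Y :\: C).
  apply: (@conn_compl _ g Y [set u; v]) clC => //; [exact: connY|exact: conn2| |].
    by apply/set0Pn; exists u; rewrite set21.
  by rewrite subUset !sub1set uY.
have sub : nbhd g Y \subset nbhd g (Y :\: C).
  apply/subsetP=> x xN; have xY := nbhd_notin xN; apply/nbhdP.
  rewrite inE (negPf xY) andbF; split=> //.
  have := subsetP full x xN; rewrite in_setU !nbrsE => /orP[gux|gvx].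
    by exists u; rewrite // inE uC.
  by exists v; rewrite // inE vC.
apply: noT; apply: (@target_direct (Y :\: C) C) => //.
- by apply/set0Pn; exists u; rewrite inE uC.
- exact: subsetDl.
- by rewrite disjoints_subset; apply/subsetP=> x; rewrite !inE => /andP[].
- left; apply: contraT => nt.
  have CY : C = Y.
    apply: connY => // x y xC yY gxy; apply: contraT => yC.
    case/negP: nt; apply/touchP; exists y, x; split=> //; [by rewrite inE yC|by rewrite gS].
  by rewrite CY uY in uC.
- by move: sub; rewrite -setD_eq0 => /eqP ->; rewrite cards0.
- have := cardsID (nbhd g C) (nbhd g Y); rewrite setIC; move: C4; rewrite k; clear; lia.
by rewrite subsetU // sub.
Qed.

(** Lightness forces five neighbours, of which at most three are roots, so [u] and [v] are the other
    two. Having exactly five neighbours, the piece has excess exactly one. *)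
Lemma heavy_bridge u v C : full_pair u v -> piece u v C -> 4 * #|C| < ecount g C ->
  bridge u v C /\ ecount g C = 4 * #|C| + 1.
Proof.
move=> fp pC hC; have [uY vY guv full] := fp; have [sC cC C0] := pC.
have [sCY uC vC cl] := sC; have uv : u != v by apply: contraTneq guv => ->; rewrite gI.
have le3 := piece_roots fp pC.
have ge5 := heavy_nbhd sCY hC; rewrite k in ge5.
have sub : nbhd g C :\: nbhd g Y \subset [set u; v].
  apply/subsetP=> x; rewrite in_setD => /andP[xN xC].
  by have := subsetP (sealed_nbhd sC) x xC; rewrite in_setU (negPf xN).
have c2 := subset_leq_card sub; rewrite cards2 uv in c2.
have cID := cardsID (nbhd g Y) (nbhd g C).
have E : nbhd g C :\: nbhd g Y = [set u; v].
  by apply/eqP; rewrite eqEcard sub cards2 uv; move: ge5 le3 cID; clear; lia.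
have inN x : x \in [set u; v] -> x \in nbhd g C by rewrite -E inE => /andP[].
split; first by split; rewrite ?inN ?set21 ?set22 //; move: ge5 le3 cID c2; clear; lia.
have pY : C \proper Y by apply/properP; split=> //; exists u.
have [|-> //] := heavy_inner pY hC.
by rewrite k; move: ge5 le3 cID c2; clear; lia.
Qed.

(** Each heavy component uses up exactly one unit of excess, so a sealed set of excess [m] yields
    [m] different bridges. *)
Lemma peel u v Z : full_pair u v -> sealed u v Z -> 4 * #|Z| < ecount g Z ->
  exists C, [/\ bridge u v C, C \subset Z, sealed u v (Z :\: C) &
    ecount g (Z :\: C) + 4 * #|Z| + 1 = ecount g Z + 4 * #|Z :\: C|].
Proof.
move=> fp [sZ uZ vZ cl] hZ.
have [C [cC clC C0 hC]] := heavy_comp gS hZ; have [sC clC'] := clC.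
have pC : piece u v C.
  split=> //; split.
  - exact: subset_trans sZ.
  - by apply: contra uZ; exact: (subsetP sC).
  - by apply: contra vZ; exact: (subsetP sC).
  move=> x y xC yY gxy; have := cl x y (subsetP sC _ xC) yY gxy.
  by case/or3P=> [yZ|->|->]; rewrite ?orbT // (clC' x y xC yZ gxy).
have [bC eC] := heavy_bridge fp pC hC.
have [[[_ uC vC clC2] _ _] _ _ _] := bC.
exists C; split=> //.
  split.
  - by apply: subset_trans sZ; exact: subsetDl.
  - by rewrite inE (negPf uZ) andbF.
  - by rewrite inE (negPf vZ) andbF.
  move=> x y; rewrite !inE => /andP[xC xZ] yY gxy.
  case/or3P: (cl x y xZ yY gxy) => [yZ|->|->]; rewrite ?orbT //.
  rewrite yZ andbT; case: (boolP (y \in C)) => //= yC.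
  by case/negP: xC; apply: (clC' y) => //; rewrite gS.
have := ecount_closed gS clC; have := cardsD Z C; rewrite (setIidPr sC).
have := subset_leq_card sC; rewrite eC; clear; lia.
Qed.

(** A heavy component [Q] of [Y] minus [v] contains [u], since otherwise it would be a bridge and
    touch [u]. It has [v] and all five roots as neighbours: with only five neighbours, some vertex
    would see four roots. So [Q] sees [x], and the wanted piece is the component of [Q] minus [u]
    from which [x] is seen. *)
Lemma reach u v x : full_pair u v -> x \in nbhd g Y -> ~~ g u x ->
  exists C, [/\ piece u v C, u \in nbhd g C & x \in nbhd g C].
Proof.
move=> fp xN gux; have [uY vY guv full] := fp.
have uv : u != v by apply: contraTneq guv => ->; rewrite gI.
have hv : 4 * #|Y :\ v| + 2 <= ecount g (Y :\ v).
  have := le3_roots vY k; have := ecount_exact; rewrite (ecount_rem1 gS gI vY) (cardsD1 v Y) vY.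
  by clear; lia.
have [|Q [cQ clQ Q0 hQ]] := @heavy_comp _ g (Y :\ v) gS; first by move: hv; clear; lia.
have [sQ clQ'] := clQ.
have /andP[sQY vQ] : (Q \subset Y) && (v \notin Q) by rewrite -subsetD1.
have uQ : u \in Q.
  apply: contraT => uQ.
  have nuQ : u \notin nbhd g Q.
    apply: contra uQ => /nbhdP[_ [w wQ gwu]]; apply: (clQ' w) => //.
    by rewrite !inE uv.
  have pQ : piece u v Q.
    split=> //; split=> // a b aQ bY gab.
    case: (eqVneq b v) => [|bv]; rewrite ?orbT // orbF.
    by rewrite (clQ' a b aQ) // !inE bv.
  by have [[_ uN _ _] _] := heavy_bridge fp pQ hQ; rewrite uN in nuQ.
have sub : nbhd g Q \subset v |: nbhd g Y.
  by rewrite setUC; exact: closed_nbhd clQ.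
have ge5 := heavy_nbhd sQY hQ; rewrite k in ge5.
have vNY : v \notin nbhd g Y by apply/negP=> /nbhd_notin; rewrite vY.
have c6 : #|v |: nbhd g Y| = 6 by rewrite cardsU1 vNY k.
have ne5 : #|nbhd g Q| != 5.
  apply/eqP=> E5.
  have [||eQ [z zQ z5]] := @heavy_inner Q _ hQ; [by apply/properP; split=> //;
      exists v|by rewrite E5 k|].
  have zY := subsetP sQY z zQ.
  have fz : nbhd g Q \subset nbrs g z.
    have : nbrs g z :&: nbhd g Q == nbhd g Q by rewrite eqEcard subsetIr E5.
    by move/eqP=> <-; exact: subsetIl.
  have sub2 : nbhd g Q :\ v \subset nbrs g z :\: Y.
    apply/subsetP=> y; rewrite in_setD1 in_setD => /andP[yv yQ].
    rewrite (subsetP fz) // andbT; have := subsetP sub y yQ.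
    by rewrite in_setU1 (negPf yv) => /nbhd_notin.
  have := subset_leq_card sub2; have := le3_roots zY k.
  have : #|nbhd g Q| <= 1 + #|nbhd g Q :\ v| by rewrite (cardsD1 v (nbhd g Q)) leq_add2r;
      case: (_ \in _).
  by rewrite E5; clear; lia.
have EQ : nbhd g Q = v |: nbhd g Y.
  apply/eqP; rewrite eqEcard sub c6; move: ge5 ne5; clear; lia.
have /nbhdP[_ [w wQ gwx]] : x \in nbhd g Q by rewrite EQ in_setU1 xN orbT.
have wu : w != u by apply: contraTneq gwx => ->.
have wQu : w \in Q :\ u by rewrite !inE wu.
have [C [wC cC [sC clC]]] := comp_ex gS wQu.
have /andP[sCQ uC] : (C \subset Q) && (u \notin C) by rewrite -subsetD1.
have pC : piece u v C.
  split=> //; last by apply/set0Pn; exists w.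
  split=> //; first exact: subset_trans sQY.
    by apply: contra vQ; exact: (subsetP sCQ).
  move=> a b aC bY gab; case: (eqVneq b v) => [|bv]; rewrite ?orbT // orbF.
  case: (eqVneq b u) => [|bu]; rewrite ?orbT // orbF; apply: (clC a) => //.
  rewrite !inE bu; apply: (clQ' a) => //; first exact: (subsetP sCQ).
  by rewrite !inE bv.
exists C; split=> //.
  apply: contraT => uN; have CQ : C = Q.
    apply: cQ => //; first by apply/set0Pn; exists w.
    move=> a b aC bQ gab; apply: (clC a) => //; rewrite !inE bQ andbT.
    apply/eqP=> E; case/negP: uN; apply/nbhdP; split=> //; by exists a => //; rewrite -E.
  by rewrite CQ uQ in uC.
apply/nbhdP; split; last by exists w.
by apply: contra (nbhd_notin xN) => /(subsetP sCQ)/(subsetP sQY).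
Qed.

(** [E] and [E'] are the roots gained by extending [u] to [p] and [v] to [q]. Each side then sees
    four roots, and [u] and [v] already cover all five. *)
Lemma arms u v (p q E E' : {set T}) : full_pair u v -> conn g p -> conn g q ->
  u \in p -> v \in q -> p \subset Y -> q \subset Y -> [disjoint p & q] ->
  E \subset nbhd g Y :\: nbrs g u -> E \subset nbhd g p ->
  E' \subset nbhd g Y :\: nbrs g v -> E' \subset nbhd g q ->
  4 <= #|E| + #|nbrs g u :\: Y| -> 4 <= #|E'| + #|nbrs g v :\: Y| -> False.
Proof.
move=> [uY vY guv full] cp cq up vq pY qY dpq EN Ep EN' Eq' c c'.
have few w (r D : {set T}) : w \in Y -> w \in r -> r \subset Y ->
    D \subset nbhd g Y :\: nbrs g w -> D \subset nbhd g r -> 4 <= #|D| + #|nbrs g w :\: Y| ->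
    #|nbhd g Y :\: nbhd g r| <= 1.
  move=> wY wr rY DN Dr c4.
  have sub : D :|: (nbrs g w :\: Y) \subset nbhd g Y :&: nbhd g r.
    rewrite subUset !subsetI Dr (roots_sub wY) (roots_nbhd wr rY) !andbT.
    exact: subset_trans DN (subsetDl _ _).
  have dis : [disjoint D & nbrs g w :\: Y].
    apply/disjointP=> x /(subsetP DN); rewrite !in_setD => /andP[xw _] /andP[_].
    by rewrite (negPf xw).
  have := subset_leq_card sub; rewrite cardsU disjoint_setI0 // cards0 subn0.
  have := cardsID (nbhd g r) (nbhd g Y); move: c4; rewrite k; clear; lia.
apply: noT; apply: (@target_direct p q) => //.
- by apply/set0Pn; exists u.
- by apply/set0Pn; exists v.
- by left; apply/touchP; exists u, v.
- exact: (few u p E).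
- exact: (few v q E').
apply/subsetP=> x xN; have xY := nbhd_notin xN; have := subsetP full x xN.
rewrite !in_setU => /orP[xu|xv]; apply/orP; [left|right].
  by apply: (subsetP (roots_nbhd up pY)); rewrite in_setD xY.
by apply: (subsetP (roots_nbhd vq qY)); rewrite in_setD xY.
Qed.

Lemma piece_arm u v C : u \in Y -> piece u v C -> u \in nbhd g C ->
  conn g (u |: C) /\ u |: C \subset Y.
Proof.
move=> uY [[sC _ _ _] cC _] uN; split; first exact: connU1.
by rewrite subUset sub1set uY.
Qed.

Lemma nbhd_arm u v C x : u \in Y -> piece u v C -> x \in nbhd g Y -> x \in nbhd g C ->
  x \in nbhd g (u |: C).
Proof.
move=> uY [[sC _ _ _] _ _] xN /nbhdP[xC [w wC gwx]]; apply/nbhdP; split.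
  rewrite in_setU1 (negPf xC) orbF; apply: contraTneq uY => <-; exact: nbhd_notin xN.
by exists w; rewrite // in_setU1 wC orbT.
Qed.

Lemma disjoint_arms u v C C' : full_pair u v -> piece u v C -> piece u v C' ->
  [disjoint C & C'] -> [disjoint u |: C & v |: C'].
Proof.
move=> [_ _ guv _] [[_ uC vC _] _ _] [[_ uC' vC' _] _ _] /disjointP dis.
apply/disjointP=> x; rewrite !in_setU1 => /orP[/eqP ->|xC] /orP[/eqP E|xC'].
- by rewrite E gI in guv.
- by rewrite xC' in uC'.
- by rewrite -E xC in vC.
exact: dis xC xC'.
Qed.

Lemma two_pieces u v C C' x y : full_pair u v -> piece u v C -> piece u v C' ->
  C != C' -> u \in nbhd g C -> v \in nbhd g C' -> x \in nbhd g Y -> y \in nbhd g Y ->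
  x \in nbhd g C -> y \in nbhd g C' -> ~~ g u x -> ~~ g v y ->
  3 <= #|nbrs g u :\: Y| -> 3 <= #|nbrs g v :\: Y| -> False.
Proof.
move=> fp pC pC' CC' uC vC' xN yN xC yC' gux gvy c c'.
have [uY vY guv full] := fp; have dis := piece_meet pC pC' CC'.
have [c1 s1] := piece_arm uY pC uC; have [c2 s2] := piece_arm vY (pieceC pC') vC'.
apply: (@arms u v (u |: C) (v |: C') [set x] [set y]) => //.
- exact: setU11.
- exact: setU11.
- exact: disjoint_arms.
- by rewrite sub1set in_setD nbrsE gux.
- by rewrite sub1set; apply: nbhd_arm pC _ _.
- by rewrite sub1set in_setD nbrsE gvy.
- by rewrite sub1set; apply: nbhd_arm (pieceC pC') _ _.
- by rewrite cards1.
by rewrite cards1.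
Qed.

(** Removing [u] and [v] from a set of excess one costs their edges to roots and the edge [uv], but
    saves two vertices at four edges each. The rest has excess eight minus the number of those root
    edges. *)
Lemma full_pair_rest u v : full_pair u v ->
  5 <= #|nbrs g u :\: Y| + #|nbrs g v :\: Y| /\
  ecount g (Y :\: [set u; v]) + #|nbrs g u :\: Y| + #|nbrs g v :\: Y| = 4 * #|Y :\: [set u;
      v]| + 8.
Proof.
move=> [uY vY guv full]; have uv : u != v by apply: contraTneq guv => ->; rewrite gI.
split.
  have sub : nbhd g Y \subset (nbrs g u :\: Y) :|: (nbrs g v :\: Y).
    apply/subsetP=> x xN; rewrite -setDUl in_setD (nbhd_notin xN); exact: (subsetP full).
  rewrite -k; apply: leq_trans (subset_leq_card sub) _; exact: leq_card_setU.
have vYu : v \in Y :\ u by rewrite !inE eq_sym uv.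
have -> : Y :\: [set u; v] = Y :\ u :\ v by rewrite setDDl.
have := ecount_exact; rewrite (ecount_rem1 gS gI uY) (ecount_rem1 gS gI vYu).
have -> : #|nbrs g v :\: (Y :\ u)| = 1 + #|nbrs g v :\: Y|.
  rewrite (cardsD1 u) !inE eqxx gS guv /=; congr (_ + _); apply: eq_card => x; rewrite !inE.
  by case: (eqVneq x u) => [->|]; rewrite ?uY.
by rewrite (cardsD1 u Y) uY (cardsD1 v (Y :\ u)) vYu; clear; lia.
Qed.

Lemma sealed_rest u v : sealed u v (Y :\: [set u; v]).
Proof.
split; rewrite ?subsetDl // ?inE ?eqxx ?orbT //.
move=> x y _ yY _; rewrite !inE yY andbT.
by case: (y == u); case: (y == v).
Qed.

Lemma three_pieces u v C D D' x y y' : full_pair u v -> piece u v C -> piece u v D ->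
  piece u v D' -> C != D -> C != D' -> u \in nbhd g C -> v \in nbhd g D -> v \in nbhd g D' ->
  x \in nbhd g Y -> x \in nbhd g C -> ~~ g u x -> y != y' ->
  y \in nbhd g Y -> y' \in nbhd g Y -> ~~ g v y -> ~~ g v y' ->
  y \in nbhd g D :|: nbhd g D' -> y' \in nbhd g D :|: nbhd g D' ->
  3 <= #|nbrs g u :\: Y| -> 2 <= #|nbrs g v :\: Y| -> False.
Proof.
move=> fp pC pD pD' CD CD' uC vD vD' xN xC gux yy yN yN' gvy gvy' yD yD' c c'.
have [uY vY guv full] := fp.
have [c1 s1] := piece_arm uY pC uC.
have [c2 s2] := piece_arm vY (pieceC pD) vD.
have [c3 s3] := piece_arm vY (pieceC pD') vD'.
have sq : (v |: D) :|: (v |: D') \subset Y by rewrite subUset s2.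
have nbq z : z \in nbhd g Y -> z \in nbhd g D :|: nbhd g D' ->
    z \in nbhd g ((v |: D) :|: (v |: D')).
  move=> zN; have zY := nbhd_notin zN; rewrite in_setU => /orP[zD|zD].
    have /nbhdP[_ [w wD gwz]] := nbhd_arm vY (pieceC pD) zN zD.
    apply/nbhdP; split; last by exists w; rewrite // in_setU wD.
    by apply: contra zY; exact: (subsetP sq).
  have /nbhdP[_ [w wD gwz]] := nbhd_arm vY (pieceC pD') zN zD.
  apply/nbhdP; split; last by exists w; rewrite // in_setU wD orbT.
  by apply: contra zY; exact: (subsetP sq).
apply: (@arms u v (u |: C) ((v |: D) :|: (v |: D')) [set x] [set y; y']) => //.
- by apply: conn_meet => //; apply/set0Pn; exists v; rewrite !inE eqxx.
- exact: setU11.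
- by rewrite in_setU setU11.
- rewrite disjoint_sym disjointU; apply/andP; split; rewrite disjoint_sym;
    by apply: disjoint_arms => //; apply: piece_meet pC _ _.
- by rewrite sub1set in_setD nbrsE gux.
- by rewrite sub1set; apply: nbhd_arm pC _ _.
- by rewrite subUset !sub1set !in_setD !nbrsE gvy gvy' yN.
- by rewrite subUset !sub1set !nbq.
- by rewrite cards1.
by rewrite cards2 yy.
Qed.

(** Here [u] sees exactly three roots and needs one more. If [v] sees three, it needs one more and
    the excess provides two bridges; if [v] sees two, it needs two more and there are three bridges.
    What has to be arranged is that [u] and [v] use different pieces. *)
Lemma no_full_pair3 u v : full_pair u v -> 3 <= #|nbrs g u :\: Y| -> False.
Proof.
move=> fp A3; have [uY vY guv full] := fp.
have le3u := le3_roots uY k; have le3v := le3_roots vY k.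
have [AB eZ] := full_pair_rest fp; set Z := Y :\: [set u; v] in eZ.
have sZ : sealed u v Z by exact: sealed_rest.
have missing w (D : {set T}) : D \subset nbhd g Y -> #|nbrs g w :\: Y| < #|D| -> exists2 x,
    x \in D & ~~ g w x.
  move=> sD lt; have : ~~ (D \subset nbrs g w :\: Y).
    by apply/negP=> /subset_leq_card; rewrite leqNgt lt.
  case/subsetPn=> x xD; rewrite in_setD nbrsE (nbhd_notin (subsetP sD x xD)) => gwx.
  by exists x.
have bsub D : nbhd g D :&: nbhd g Y \subset nbhd g Y by exact: subsetIr.
have [x xN gux] : exists2 x, x \in nbhd g Y & ~~ g u x.
  by apply: missing => //; rewrite k; apply: leq_ltn_trans le3u _.
have [C [pC uC xC]] := reach fp xN gux.
have next D1 D2 : bridge u v D1 -> bridge u v D2 -> D1 != D2 ->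
   exists2 D, bridge u v D & D != C.
  move=> b1 b2 D12; case: (eqVneq D1 C) => [E|]; last by exists D1.
  by exists D2 => //; rewrite -E eq_sym.
have [|D1 [b1 D1Z sZ1 e1]] := @peel u v Z fp sZ; first by move: AB eZ le3u le3v; clear; lia.
have [|D2 [b2 D2Z sZ2 e2]] := peel fp sZ1; first by move: AB eZ le3u le3v e1; clear; lia.
have diff D D' W : bridge u v D -> D \subset W :\: D' -> D' != D.
  move=> [[_ _ /set0Pn[d dD]] _ _ _] sD; apply/eqP=> E.
  by have := subsetP sD d dD; rewrite inE E dD.
have D12 := diff _ _ _ b2 D2Z.
case: (leqP 3 #|nbrs g v :\: Y|) => B3.
  have [y yN gvy] : exists2 y, y \in nbhd g Y & ~~ g v y.
    by apply: missing => //; rewrite k; apply: leq_ltn_trans le3v _.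
  have [C' [pC' vC' yC']] := reach (full_pairC fp) yN gvy.
  (* If [C] is the only piece at hand, another bridge [D] replaces it on one side. This fails only
     if [u] and [v] both see all three roots of [D], and then they see at most three roots in
     total. *)
  case: (eqVneq C C') => [E|CC']; last first.
    exact: (two_pieces fp pC (pieceC pC') CC' uC vC' xN yN xC yC' gux gvy).
  have [D [pD uD vD D3] DC] := next _ _ b1 b2 D12.
  case: (classic (exists2 x', x' \in nbhd g D :&: nbhd g Y & ~~ g u x')) => [[x']|noU].
    rewrite in_setI => /andP[x'D x'N] gux'.
    rewrite E in DC; exact: (two_pieces fp pD (pieceC pC') DC uD vC' x'N yN x'D yC' gux' gvy).
  case: (classic (exists2 y', y' \in nbhd g D :&: nbhd g Y & ~~ g v y')) => [[y']|noV].
    rewrite in_setI => /andP[y'D y'N] gvy'.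
    rewrite eq_sym in DC.
    exact: (two_pieces fp pC pD DC uC vD xN y'N xC y'D gux gvy').
  have sub : nbhd g D :&: nbhd g Y \subset (nbrs g u :\: Y) :&: (nbrs g v :\: Y).
    apply/subsetP=> z zD; have /andP[_ /nbhd_notin zY] :
        (z \in nbhd g D) && (z \in nbhd g Y) by rewrite -in_setI.
    rewrite in_setI !in_setD !nbrsE zY /=; apply/andP; split; apply: contraT => ngz.
      by case: noU; exists z.
    by case: noV; exists z.
  have := subset_leq_card sub; rewrite D3.
  have : #|nbhd g Y| <= #|(nbrs g u :\: Y) :|: (nbrs g v :\: Y)|.
    apply/subset_leq_card/subsetP=> z zN.
    by rewrite -setDUl in_setD (nbhd_notin zN); exact: (subsetP full).
  have := cardsUI (nbrs g u :\: Y) (nbrs g v :\: Y); rewrite k.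
  by move: le3u le3v; clear; lia.
have [|D3 [b3 D3Z sZ3 e3]] := peel fp sZ2; first by move: AB eZ le3u B3 e1 e2; clear; lia.
have D23 := diff _ _ _ b3 D3Z.
have D13 : D1 != D3.
  by apply: (diff _ _ Z b3); apply: subset_trans D3Z _; apply: subset_trans (subsetDl _ _) _.
have [E1 [E2 [c1 c2 E12 E1C E2C]]] : exists E1 E2, [/\ bridge u v E1, bridge u v E2,
    E1 != E2, C != E1 & C != E2].
  case: (eqVneq C D1) => [E|n1]; first by exists D2, D3; split=> //; rewrite E.
  case: (eqVneq C D2) => [E|n2]; first by exists D1, D3; split=> //; rewrite E.
  by exists D1, D2.
have [p1 u1 v1 t1] := c1; have [p2 u2 v2 t2] := c2.
have B2 : 2 <= #|nbrs g v :\: Y| by move: AB le3u; clear; lia.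
case: (classic (exists y y', [/\ y != y', y \in nbhd g Y, y' \in nbhd g Y &
    [/\ ~~ g v y, ~~ g v y', y \in nbhd g E1 :|: nbhd g E2 & y' \in nbhd g E1 :|: nbhd g E2]])).
  move=> [y [y' [yy yN y'N [gvy gvy' yE y'E]]]].
  exact: (three_pieces fp pC p1 p2 E1C E2C uC v1 v2 xN xC gux yy yN y'N gvy gvy' yE y'E).
(* Now [E1] and [E2] together see only one root [s] missed by [v]. [E1] sees a root missed by [u]:
   otherwise two roots of [E1] are common to [u] and [v], which then see at most three in total. So
   [E1] goes to [u], while [v] gets [E2] and a piece reaching a second missed root. *)
move=> no.
have [s sE2 gvs] : exists2 s, s \in nbhd g E2 :&: nbhd g Y & ~~ g v s.
  by apply: missing => //; rewrite t2.
have /andP[sE2' sN] : (s \in nbhd g E2) && (s \in nbhd g Y) by rewrite -in_setI.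
have uniq y : y \in nbhd g Y -> ~~ g v y -> y \in nbhd g E1 :|: nbhd g E2 -> y = s.
  move=> yN gvy yE; apply/eqP/negPn/negP=> ys; apply: no; exists y, s; split=> //.
  by split=> //; rewrite in_setU sE2' orbT.
have [x' x'E1 gux'] : exists2 x', x' \in nbhd g E1 :&: nbhd g Y & ~~ g u x'.
  apply: NNPP => noU.
  have sub : (nbhd g E1 :&: nbhd g Y) :\ s \subset (nbrs g u :\: Y) :&: (nbrs g v :\: Y).
    apply/subsetP=> z; rewrite in_setD1 => /andP[zs zE].
    have /andP[zE1 zN] : (z \in nbhd g E1) && (z \in nbhd g Y) by rewrite -in_setI.
    rewrite in_setI !in_setD !nbrsE (nbhd_notin zN) /=; apply/andP; split; apply: contraT =>
        ngz.
      by case: noU; exists z.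
    by case/eqP: zs; apply: uniq; rewrite // in_setU zE1.
  have := subset_leq_card sub.
  have : #|nbhd g E1 :&: nbhd g Y| <= 1 + #|(nbhd g E1 :&: nbhd g Y) :\ s|.
    by rewrite (cardsD1 s (nbhd g E1 :&: nbhd g Y)) leq_add2r; case: (_ \in _).
  have : #|nbhd g Y| <= #|(nbrs g u :\: Y) :|: (nbrs g v :\: Y)|.
    apply/subset_leq_card/subsetP=> z zN.
    by rewrite -setDUl in_setD (nbhd_notin zN); exact: (subsetP full).
  have := cardsUI (nbrs g u :\: Y) (nbrs g v :\: Y); rewrite k t1.
  by move: le3u B3; clear; lia.
have /andP[x'E x'N] : (x' \in nbhd g E1) && (x' \in nbhd g Y) by rewrite -in_setI.
have [y yNs gvy] : exists2 y, y \in nbhd g Y :\ s & ~~ g v y.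
  apply: missing; first exact: subsetDl.
  by move: B3; have := cardsD1 s (nbhd g Y); rewrite sN k; clear; lia.
have [ys yN] : y != s /\ y \in nbhd g Y by move: yNs; rewrite in_setD1 => /andP[].
have [C' [pC' vC' yC']] := reach (full_pairC fp) yN gvy.
have E1C' : E1 != C'.
  by apply/eqP=> E; case/eqP: ys; apply: uniq; rewrite // in_setU E yC'.
have sy : s != y by rewrite eq_sym.
apply: (three_pieces fp p1 p2 (pieceC pC') E12 E1C' u1 v2 vC' x'N x'E gux' sy sN yN gvs gvy) => //.
  by rewrite in_setU sE2'.
by rewrite in_setU yC' orbT.
Qed.

Lemma no_full_pair u v : ~ full_pair u v.
Proof.
move=> fp; have [AB _] := full_pair_rest fp.
case: (leqP 3 #|nbrs g u :\: Y|) => A3; first exact: no_full_pair3 fp A3.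
by apply: (no_full_pair3 (full_pairC fp)); move: AB A3; clear; lia.
Qed.

End FullPair.

(** * Triangles and a vertex of small degree *)

Lemma four_triangles u v : u \in Y -> g u v -> 4 <= ntriangles u v.
Proof.
move=> uY guv; case: (ntriangles_ge4 uY guv) => // -[vY k full].
by case: (@no_full_pair k u v); split.
Qed.

Lemma conn_clique A : (forall x y, x \in A -> y \in A -> x != y -> g x y) -> conn g A.
Proof.
move=> cl B sB B0 clB; have /set0Pn[x xB] := B0.
apply/eqP; rewrite eqEsubset sB; apply/subsetP=> y yA.
case: (eqVneq x y) => [<-//|xy]; apply: (clB x) => //; apply: cl => //.
exact: (subsetP sB).
Qed.

Lemma card_bigcup_le (I : finType) (D : {set I}) (G : I -> {set T}) :
  #|\bigcup_(i in D) G i| <= \sum_(i in D) #|G i|.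
Proof.
elim/big_rec2: _ => [|i n A _ le]; first by rewrite cards0.
by apply: leq_trans (leq_card_setU _ _) _; rewrite leq_add2l.
Qed.

(** The degrees of the vertices of [Y] and the number of edges from [Y] to roots add up to [8n + 2].
    At least three such edges exist, so less than [8n] remains for the degrees. *)
Lemma small_degree : 3 <= #|nbhd g Y| -> exists2 v, v \in Y & #|nbrs g v| <= 7.
Proof.
move=> k3; apply: NNPP => no.
have big : \sum_(y in Y) 8 <= \sum_(y in Y) #|nbrs g y|.
  apply: leq_sum => y yY; rewrite ltnNge; apply/negP=> le.
  by apply: no; exists y.
have sub : nbhd g Y \subset \bigcup_(y in Y) (nbrs g y :\: Y).
  apply/subsetP=> x /nbhdP[xY [y yY gyx]]; apply/bigcupP; exists y => //.
  by rewrite in_setD xY nbrsE.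
have le := leq_trans (subset_leq_card sub) (card_bigcup_le _ _).
have := degree_sum Y gS gI; rewrite big_split /= ecount_exact.
rewrite sum_nat_const in big; move: big le k3; clear; lia.
Qed.

(** * Linking the roots to the neighbourhood of a vertex of small degree *)

Section LowDegree.
Variables (v : T) (W : {set T}) (M : T -> {set T}) (t : T -> T).
Hypotheses (vY : v \in Y) (vW : [set v] \subset W) (WY : W \subset Y).
Hypothesis L : linked g [set v] W M t.
Hypothesis WE : W = Y \/ #|nbhd g W| < #|nbhd g Y|.
Hypothesis small : #|nbhd g Y| <= 2 \/ #|nbrs g v| <= 7.

Let H := nbrs g v.
Let T0 := t @: nbhd g W.
Let near y := [set z in H | (z != y) && (g y z || (y \notin Y) && (z \notin Y))].

Lemma nbhd_v : nbhd g [set v] = H.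
Proof.
apply/setP=> x; rewrite nbrsE; apply/nbhdP/idP => [[_ [y /set1P->]]//|gvx].
split; last by exists v; rewrite ?set11.
by rewrite inE; apply: contraTneq gvx => ->; rewrite gI.
Qed.

Lemma near4 y : y \in H -> 4 <= #|near y|.
Proof. by rewrite nbrsE => gvy; exact: four_triangles. Qed.

Lemma near_out y : y \in H -> #|H :\: near y| <= #|H| - 4.
Proof.
move=> yH; have := near4 yH; have := cardsD H (near y).
have -> : H :&: near y = near y by apply/setIidPr; apply/subsetP=> z; rewrite inE => /andP[].
by clear; lia.
Qed.

Lemma near_self y : y \notin near y.
Proof. by rewrite inE eqxx andbF. Qed.

Lemma H5 : 5 <= #|H|.
Proof.
have [y yH] : exists y, y \in H.
  apply: NNPP => no; have := Y_card.
  suff <- : [set v] = Y by rewrite cards1.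
  apply: connY; rewrite ?sub1set //; first by apply/set0Pn; exists v; rewrite set11.
  by move=> x z /set1P -> _ gvz; case: no; exists z; rewrite nbrsE.
have sub : y |: near y \subset H.
  by rewrite subUset sub1set yH; apply/subsetP=> z; rewrite inE => /andP[].
have := subset_leq_card sub; rewrite cardsU1 near_self; have := near4 yH.
by clear; lia.
Qed.

Lemma M_P s : s \in nbhd g W -> [/\ s \in M s, conn g (M s), M s \subset s |: (W :\ v) &
  M s :&: H = [set t s]].
Proof. by case: L => LM _ /LM; rewrite nbhd_v. Qed.

Lemma t_P s : s \in nbhd g W -> t s \in M s /\ t s \in H.
Proof. by case/M_P=> _ _ _ E; have := set11 (t s); rewrite -E in_setI => /andP[]. Qed.

Lemma M_dis s s' : s \in nbhd g W -> s' \in nbhd g W -> s != s' -> [disjoint M s & M s'].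
Proof. by case: L => _; apply. Qed.

Lemma t_inj : {in nbhd g W &, injective t}.
Proof.
move=> s s' sW s'W E; apply/eqP/negPn/negP=> ss'.
have /disjointP/(_ (t s)) := M_dis sW s'W ss'; apply; first by have [] := t_P sW.
by rewrite E; have [] := t_P s'W.
Qed.

Lemma T0_card : #|T0| = #|nbhd g W|.
Proof. exact: card_in_imset t_inj. Qed.

Lemma T0_H : T0 \subset H.
Proof. by apply/subsetP=> x /imsetP[s sW ->]; have [] := t_P sW. Qed.

Lemma free_M w s : w \in H :\: T0 -> s \in nbhd g W -> w \notin M s.
Proof.
rewrite in_setD => /andP[wT wH] sW; apply: contra wT => wM.
have [_ _ _ E] := M_P sW.
have : w \in M s :&: H by rewrite in_setI wM.
by rewrite E => /set1P ->; apply: imset_f.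
Qed.

(** A vertex of [H] in [nbhd g W] lies in its own linking set and is therefore its end. Hence
    vertices of [H] that are not ends are non-roots and can be used freely for the second centre. *)
Lemma free_W w : w \in H :\: T0 -> w \in W.
Proof.
move=> wf; have wH : w \in H by move: wf; rewrite in_setD => /andP[].
have := subsetP (nbhd_sub_setU g vW) w; rewrite nbhd_v in_setU => /(_ wH)/orP[//|wN].
by have := free_M wf wN; have [-> _ _ _] := M_P wN.
Qed.

Lemma free_Y w : w \in H :\: T0 -> w \in Y.
Proof. by move/free_W; exact: (subsetP WY). Qed.

Lemma near_adj y w : y \in H -> w \in H -> w \in Y -> (w \in near y) = (g y w).
Proof.
move=> yH wH wY; rewrite inE wH wY andbF orbF /=.
by case: (eqVneq w y) => [->|]; rewrite ?gI.
Qed.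

Lemma no_target_W : ~ target g W (nbhd g W).
Proof.
move=> tW; case: WE => [E|lt]; first by apply: noT; rewrite -E.
by apply: (@no_rigid W).
Qed.

Lemma v_M s : s \in nbhd g W -> v \notin M s.
Proof.
move=> sW; have [_ _ sM _] := M_P sW; apply/negP=> /(subsetP sM).
rewrite !inE eqxx /= orbF => /eqP E.
by have := nbhd_notin sW; rewrite -E -sub1set vW.
Qed.

Lemma exists_neq x : exists a : T, a != x.
Proof.
have : 1 < #|Y| := Y_card; rewrite (cardsD1 x) => c.
have : 0 < #|Y :\ x| by move: c; case: (x \in Y); clear; lia.
by case/card_gt0P=> a; rewrite in_setD1 => /andP[ax _]; exists a.
Qed.

Lemma single_out A : #|A| <= 1 -> exists b : T, A \subset [set b].
Proof.
case: (set_0Vmem A) => [->|[b bA]] c1; first by exists v; rewrite sub0set.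
by exists b; apply/subsetP=> x xA; rewrite inE; apply/eqP/(card_le1_eqP c1).
Qed.

(* The hub v sees every t s, so a connected q avoiding the paths and missing at
   most one t s completes a target. *)
Lemma hub_fails (q : {set T}) : q != set0 -> conn g q -> q \subset H :\: T0 ->
  #|[set s in nbhd g W | ~~ touch g q [set t s]]| <= 1 -> False.
Proof.
move=> q0 cq qH c1; have [b sb] := single_out c1; have [a ab] := exists_neq b.
have vH : v \notin H by rewrite nbrsE gI.
have pM s : s \in nbhd g W -> touch g [set v] (M s).
  by case/t_P=> tM tH; apply/touchP; exists v, (t s); rewrite set11 -nbrsE.
apply: no_target_W; exists [set v], q, M; split.
  split=> //.
  - split=> //; first by apply/set0Pn; exists v; rewrite set11.
      by apply/subsetP=> w /(subsetP qH)/free_W.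
    rewrite disjoints1; apply: contra vH => /(subsetP qH); by rewrite in_setD => /andP[].
  - by split=> //; exact: conn1.
  - move=> s sW; have [sM cM sub _] := M_P sW; split=> //.
    + by apply: subset_trans sub _; rewrite setUS // subsetDl.
    + by rewrite disjoints1 v_M.
    by apply/disjointP=> w /(subsetP qH) wf; apply/negP; exact: free_M.
  by move=> s s'; exact: M_dis.
exists a, b; split=> //.
- by move=> s sW _; exact: pM.
- move=> s sW; apply: contraR => nt; have [tM _] := t_P sW.
  have : s \in [set s in nbhd g W | ~~ touch g q [set t s]].
    rewrite inE sW; apply: contra nt; apply: touch_sub => //; by rewrite sub1set.
  by move/(subsetP sb)/set1P ->.
left; have /set0Pn[w wq] := q0; apply/touchP; exists v, w; split; rewrite ?set11 //.
by rewrite -nbrsE; have := subsetP qH w wq; rewrite in_setD => /andP[].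
Qed.

Lemma few_roots : #|nbhd g W| <= 4 -> False.
Proof.
move=> c4; have h5 := H5; rewrite -T0_card in c4.
have single w : w \in H :\: T0 -> #|T0 :\: nbrs g w| <= 1 -> False.
  move=> wf c1; apply: (@hub_fails [set w]).
  - by apply/set0Pn; exists w; rewrite set11.
  - exact: conn1.
  - by rewrite sub1set.
  apply: leq_trans c1; set A := [set s in nbhd g W | _].
  have sA : {in A &, injective t}.
    by move=> s s'; rewrite in_set => /andP[sW _]; rewrite in_set => /andP[s'W _]; exact: t_inj.
  rewrite -(card_in_imset sA); apply/subset_leq_card/subsetP=> x /imsetP[s].
  rewrite in_set => /andP[sW nt] ->; rewrite in_setD imset_f // andbT.
  by apply: contra nt; rewrite nbrsE => gwt; apply/touchP; exists w, (t s); rewrite !set11.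
have cT : #|H :\: T0| = #|H| - #|T0| by rewrite cardsD (setIidPr T0_H).
have [w0 w0f] : exists w, w \in H :\: T0.
  by apply/card_gt0P; rewrite cT; move: c4 h5; clear; lia.
(* With at most two ends, an end [a] still has a near vertex that is not an end, and this vertex
   misses at most the other end. *)
case: small => [k2|d7].
  have le2 : #|T0| <= 2.
    by rewrite T0_card; case: WE => [->//|lt]; apply: leq_trans k2; exact: ltnW.
  case: (set_0Vmem T0) => [E|[a aT]]; first by apply: (single w0) => //; rewrite E set0D cards0.
  have aH := subsetP T0_H a aT.
  have [w] : exists w, w \in near a :\: T0.
    apply/card_gt0P; have := cardsID T0 (near a); have := near4 aH.
    have := subset_leq_card (subsetIr (near a) T0); move: le2; clear; lia.
  rewrite in_setD => /andP[wT wa].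
  have wH : w \in H by move: wa; rewrite inE => /andP[].
  have wf : w \in H :\: T0 by rewrite in_setD wT.
  apply: (single w wf); rewrite near_adj // in wa; last exact: free_Y.
  have sub : T0 :\: nbrs g w \subset T0 :\ a.
    apply/subsetP=> x; rewrite in_setD in_setD1 nbrsE => /andP[gwx ->]; rewrite andbT.
    by apply: contraNneq gwx => ->; rewrite gS.
  apply: leq_trans (subset_leq_card sub) _; move: le2; rewrite (cardsD1 a T0) aT.
  by clear; lia.
have {}d7 : #|H| <= 7 by exact: d7.
(* A free vertex [w] that alone does not suffice misses at least two ends. With [w] itself these
   fill the at most three places of [H] outside [near w], so [#|H| = 7] and [w] is adjacent to all
   other free vertices. *)
have H7 w : w \in H :\: T0 -> H :\: near w = w |: (T0 :\: nbrs g w) /\ #|H| = 7.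
  move=> wf; have [wT wH] : w \notin T0 /\ w \in H by move: wf; rewrite in_setD => /andP[].
  have ge2 : 2 <= #|T0 :\: nbrs g w|.
    by rewrite ltnNge; apply/negP=> c1; exact: single wf c1.
  have wY := free_Y wf.
  have sub : w |: (T0 :\: nbrs g w) \subset H :\: near w.
    rewrite subUset sub1set in_setD near_self wH /=; apply/subsetP=> x.
    rewrite in_setD nbrsE => /andP[gwx xT]; have xH := subsetP T0_H x xT.
    by rewrite in_setD xH andbT inE xH (negPf gwx) wY /= andbF.
  have le := near_out wH; have cU := subset_leq_card sub.
  have c3 : #|w |: (T0 :\: nbrs g w)| = (#|T0 :\: nbrs g w|).+1.
    by rewrite cardsU1 in_setD (negPf wT) andbF.
  split; last by move: le cU d7 ge2; rewrite c3; clear; lia.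
  apply/esym/eqP; rewrite eqEcard sub c3; move: le d7 ge2; clear; lia.
have [_ h7] := H7 w0 w0f.
(* The at least three free vertices form a clique and serve together as the second centre. An end
   missed by all of them would have at least four vertices of [H], itself included, outside its near
   set, where three are possible. *)
apply: (@hub_fails (H :\: T0)) => //.
- by apply/set0Pn; exists w0.
- apply: conn_clique => x y xf yf xy; have [E _] := H7 x xf.
  have [yT yH] : y \notin T0 /\ y \in H by move: yf; rewrite in_setD => /andP[].
  have xH : x \in H by move: xf; rewrite in_setD => /andP[].
  rewrite -near_adj ?free_Y //; apply: contraT => yn.
  have : y \in H :\: near x by rewrite in_setD yn.
  by rewrite E in_setU1 eq_sym (negPf xy) in_setD (negPf yT) andbF.
set A := [set s in nbhd g W | _]; suff -> : A = set0 by rewrite cards0.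
apply/setP=> s; rewrite in_set0 /A in_set; apply/negP=> /andP[sW nt].
have [tM tH] := t_P sW.
have sub : t s |: (H :\: T0) \subset H :\: near (t s).
  rewrite subUset sub1set in_setD near_self tH /=; apply/subsetP=> w wf.
  have wH : w \in H by move: wf; rewrite in_setD => /andP[].
  rewrite in_setD wH near_adj ?free_Y // andbT; apply: contra nt => gtw.
  by apply/touchP; exists w, (t s); rewrite set11 gS.
have := subset_leq_card sub; rewrite cardsU1 in_setD imset_f // cT h7.
have := near_out tH; rewrite h7; move: c4; clear; lia.
Qed.

(** As [v] does not see all five roots, some root [x] differs from its end [t x]. The part [C] of
    its linking set around [t x] is given to the second centre, which reaches [x] through it; [v]
    may then miss [x], and the second centre may miss one of the other four ends. *)
Lemma five_roots : #|nbhd g W| = 5 -> False.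
Proof.
move=> c5; have h5 := H5.
have WY' : W = Y by case: WE => // lt; have := leq_trans lt k5; rewrite c5.
have k : #|nbhd g Y| = 5 by rewrite -WY'.
have d7 : #|H| <= 7 by case: small => //; rewrite k.
have [x xW tx] : exists2 x, x \in nbhd g W & t x != x.
  apply: NNPP => no; have := no_full vY; rewrite ltnNge -k => /negP[].
  apply/subset_leq_card/subsetP=> x xN; rewrite in_setD (nbhd_notin xN) /=.
  have xW : x \in nbhd g W by rewrite WY'.
  have [_ xH] := t_P xW; rewrite -[x](_ : t x = x) //.
  by apply/eqP/negPn/negP=> ne; apply: no; exists x.
have [xM cM sM iM] := M_P xW; have [txM txH] := t_P xW.
have txY : t x \in Y.
  have := subsetP sM _ txM; rewrite in_setU1 (negPf tx) in_setD1 => /andP[_];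
      exact: (subsetP WY).
have txD : t x \in M x :\ x by rewrite in_setD1 tx.
have [C [tC cC [sC clC]]] := comp_ex gS txD.
have /andP[sCM xC] : (C \subset M x) && (x \notin C) by rewrite -subsetD1.
have xNC : x \in nbhd g C.
  apply: contraT => xN; have E : C = M x.
    apply: cM => //; first by apply/set0Pn; exists (t x).
    move=> a b aC bM gab; apply: (clC a) => //; rewrite in_setD1 bM andbT.
    apply: contraNneq xN => E; apply/nbhdP; split=> //; by exists a; rewrite -?E.
  by rewrite E xM in xC.
have CW : C \subset W.
  apply/subsetP=> y yC; have := subsetP sM y (subsetP sCM y yC).
  rewrite in_setU1 in_setD1; case: eqP => [E|_ /andP[//]]; by rewrite -E yC in xC.
have vC : v \notin C by apply: contra (v_M xW); exact: (subsetP sCM).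
have finish (q : {set T}) : C \subset q -> q \subset C :|: (H :\: T0) -> conn g q ->
    #|[set s in nbhd g W :\ x | ~~ touch g q [set t s]]| <= 1 -> False.
  move=> Cq qC cq c1.
  have tq : t x \in q by exact: (subsetP Cq).
  have qW : q \subset W.
    apply: subset_trans qC _; rewrite subUset CW; apply/subsetP=> w; exact: free_W.
  have xq : x \notin q by apply: contra (nbhd_notin xW); exact: (subsetP qW).
  have qM s : s \in nbhd g W -> s != x -> [disjoint q & M s].
    move=> sW sx; apply/disjointP=> y /(subsetP qC); rewrite in_setU => /orP[yC|yf].
      have xs : x != s by rewrite eq_sym.
      have /disjointP H1 := M_dis xW sW xs; exact: H1 (subsetP sCM y yC).
    by apply/negP; exact: free_M.
  have [b bx sb] : exists2 b, b != x &
      [set s in nbhd g W :\ x | ~~ touch g q [set t s]] \subset [set b].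
    case: (set_0Vmem [set s in nbhd g W :\ x | ~~ touch g q [set t s]]) => [->|[b bA]].
      by have [b bx] := exists_neq x; exists b; rewrite ?sub0set.
    exists b; first by move: bA; rewrite in_set in_setD1 => /andP[/andP[]].
    by apply/subsetP=> y yA; rewrite in_set1; apply/eqP/(card_le1_eqP c1).
  apply: no_target_W; exists [set v], q, (fun s => if s == x then [set x] else M s); split.
    split.
    - split=> //; [by apply/set0Pn; exists v; rewrite set11|by apply/set0Pn; exists (t x)|].
      rewrite disjoints1; apply/negP=> /(subsetP qC); rewrite in_setU (negPf vC) /=.
      by rewrite in_setD nbrsE gI andbF.
    - by split=> //; exact: conn1.
    - move=> s sW; case: (eqVneq s x) => [->|sx].
        split; rewrite ?set11 ?subsetUl //; first exact: conn1.
          by rewrite disjoints1 inE; apply: contraNneq (nbhd_notin xW) => <-; rewrite -sub1set.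
        by rewrite disjoint_sym disjoints1.
      have [sMs cMs sub _] := M_P sW; split=> //; last exact: qM.
        by apply: subset_trans sub _; rewrite setUS // subsetDl.
      by rewrite disjoints1 v_M.
    have dx r : r \in nbhd g W -> r != x -> [disjoint [set x] & M r].
      move=> rW rx; rewrite disjoints1; have xr : x != r by rewrite eq_sym.
      by have /disjointP/(_ x xM) := M_dis xW rW xr; move/negP.
    move=> s s' sW s'W; case: (eqVneq s x) => [E|sx]; case: (eqVneq s' x) => [E'|s'x] ss'.
    - by rewrite E E' eqxx in ss'.
    - exact: dx.
    - by rewrite disjoint_sym; exact: dx.
    exact: M_dis.
  exists x, b; split; first by rewrite eq_sym.
  - move=> s sW sx; rewrite (negPf sx); have [tM tH] := t_P sW.
    by apply/touchP; exists v, (t s); rewrite set11 -nbrsE.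
  - move=> s sW sb'; case: (eqVneq s x) => [_|sx].
      have /nbhdP[_ [y yC gyx]] := xNC; apply/touchP; exists y, x.
      by rewrite set11 (subsetP Cq).
    have [tM _] := t_P sW; apply: contraR sb' => nt.
    have : s \in [set s in nbhd g W :\ x | ~~ touch g q [set t s]].
      rewrite in_set in_setD1 sx sW; apply: contra nt; apply: touch_sub => //.
      by rewrite sub1set.
    by move/(subsetP sb)/set1P ->.
  by left; apply/touchP; exists v, (t x); rewrite set11 -nbrsE.
have miss (q R : {set T}) : (forall s, s \in nbhd g W -> s != x -> t s \notin R ->
    touch g q [set t s]) ->
    #|[set s in nbhd g W :\ x | ~~ touch g q [set t s]]| <= #|R|.
  move=> HR; set A := [set s in _ | _].
  have sA : {in A &, injective t}.
    move=> s s'; rewrite in_set in_setD1 => /andP[/andP[_ sW] _].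
    by rewrite in_set in_setD1 => /andP[/andP[_ s'W] _]; exact: t_inj.
  rewrite -(card_in_imset sA); apply/subset_leq_card/subsetP=> y /imsetP[s].
  rewrite in_set in_setD1 => /andP[/andP[sx sW] nt] ->.
  by apply: contraR nt; exact: HR.
(* These are the other ends not seen by [t x], at most two in number. If there are two, [t x] sees
   both free vertices, and one that sees an end in [R] can be added to the centre. *)
set R := (T0 :\ t x) :\: nbrs g (t x).
have tT s : s \in nbhd g W -> s != x -> t s \in T0 :\ t x.
  move=> sW sx; rewrite in_setD1 imset_f // andbT.
  by apply: contra sx => /eqP/t_inj->.
have CR s : s \in nbhd g W -> s != x -> t s \notin R -> touch g C [set t s].
  move=> sW sx; rewrite in_setD tT // andbT negbK nbrsE => gt.
  by apply/touchP; exists (t x), (t s); rewrite set11.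
case: (leqP #|R| 1) => R1.
  apply: (finish C) => //; first exact: subsetUl.
  exact: leq_trans (miss _ _ CR) R1.
have cT : #|H :\: T0| = #|H| - 5 by rewrite cardsD (setIidPr T0_H) T0_card c5.
have sub : t x |: R \subset H :\: near (t x).
  rewrite subUset sub1set in_setD near_self txH /=; apply/subsetP=> y.
  rewrite !in_setD in_set1 nbrsE => /andP[gty /andP[_ yT]]; have yH := subsetP T0_H y yT.
  by rewrite yH andbT inE yH (negPf gty) txY /= andbF.
have c3 : #|t x |: R| = (#|R|).+1 by rewrite cardsU1 !in_setD in_set1 eqxx /= andbF.
have le := near_out txH; have cU := subset_leq_card sub.
have R2 : #|R| = 2 by move: le cU d7 R1; rewrite c3; clear; lia.
have h7 : #|H| = 7 by move: le cU d7 R1; rewrite c3; clear; lia.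
have E : H :\: near (t x) = t x |: R.
  by apply/esym/eqP; rewrite eqEcard sub c3 R2; move: le; rewrite h7; clear; lia.
have freeadj w : w \in H :\: T0 -> g (t x) w.
  move=> wf; have [wT wH] : w \notin T0 /\ w \in H by move: wf; rewrite in_setD => /andP[].
  rewrite -near_adj ?free_Y //; apply: contraT => wn.
  have : w \in H :\: near (t x) by rewrite in_setD wn.
  rewrite E in_setU1 !in_setD in_set1 (negPf wT) !andbF orbF => /eqP Ew.
  by rewrite Ew imset_f in wT.
have [r rR] : exists r, r \in R by apply/card_gt0P; rewrite R2.
have [rg rtx rT] : [/\ ~~ g (t x) r, r != t x & r \in T0].
  by move: rR; rewrite !in_setD in_set1 nbrsE => /andP[-> /andP[-> ->]].
have rH := subsetP T0_H r rT.
case: (classic (exists2 w, w \in H :\: T0 & g r w)) => [[w wf grw]|no].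
  apply: (finish (C :|: [set w])).
  - exact: subsetUl.
  - by rewrite setUS // sub1set.
  - apply: connU => //; first exact: conn1.
    by apply/touchP; exists (t x), w; rewrite set11 freeadj.
  apply: leq_trans (miss _ (R :\ r) _) _; last by move: R2; rewrite (cardsD1 r R) rR add1n =>
      -[->].
  move=> s sW sx; rewrite in_setD1 negb_and negbK => /orP[/eqP ts|tR].
    by apply/touchP; exists w, (t s); rewrite !set11 in_setU set11 orbT ts gS.
  by apply: touch_sub (CR s sW sx tR) => //; exact: subsetUl.
(* Otherwise [r] itself, [t x] and the two free vertices are four vertices outside [near r], where
   at most three are possible. *)
have sub2 : r |: (t x |: (H :\: T0)) \subset H :\: near r.
  rewrite !subUset !sub1set !in_setD near_self rH txH near_adj // gS rg /=.
  apply/subsetP=> w wf; have wH : w \in H by move: wf; rewrite in_setD => /andP[].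
  rewrite in_setD wH near_adj ?free_Y // andbT; apply/negP=> grw.
  by apply: no; exists w.
have := subset_leq_card sub2; rewrite !cardsU1 !in_setU1 !in_setD rT imset_f //.
rewrite (negPf rtx) cT h7 /=; have := near_out rH; rewrite h7; clear; lia.
Qed.

End LowDegree.

Lemma no_counterexample : False.
Proof.
have [v vY small] : exists2 v, v \in Y & #|nbhd g Y| <= 2 \/ #|nbrs g v| <= 7.
  case: (leqP 3 #|nbhd g Y|) => [/small_degree[v vY d7]|k2]; first by exists v; auto.
  have /card_gt0P[v vY] : 0 < #|Y| by apply: ltn_trans Y_card.
  by exists v; auto.
have sv : [set v] \subset Y by rewrite sub1set.
have [W [M [t [vW WY L WE]]]] := min_link sv.
have le5 : #|nbhd g W| <= 5.
  by case: WE => [->//|lt]; apply: leq_trans k5; exact: ltnW.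
case: (ltnP #|nbhd g W| 5) => c; first exact: (few_roots vY vW WY L WE small).
by apply: (five_roots vY vW WY L WE small); apply/eqP; rewrite eqn_leq le5.
Qed.

End MinimalCounterexample.

Lemma heavy_target (T : finType) (g : rel T) (Y : {set T}) : symmetric g -> irreflexive g ->
  #|nbhd g Y| <= 5 -> light g Y -> qheavy g Y -> target g Y (nbhd g Y).
Proof.
(* [K] exceeds every edge count, so the sum below orders vertex and edge numbers
   lexicographically. *)
pose K := #|{set T}|.+1.
have [m] := ubnP (#|Y| * K + ecount g Y); elim: m g Y => // m IH g Y lt gS gI k5 lY qY.
apply: NNPP => noT; apply: (no_counterexample gS gI k5 lY qY noT).
move=> h Z hS hI dec; apply: IH => //.
have eK : ecount h Z < K by rewrite ltnS max_card.
rewrite -ltnS; apply: leq_trans lt; rewrite ltnS.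
case: dec => [lZ|[-> le]]; last by rewrite ltn_add2l.
apply: leq_trans (leq_addr _ _); apply: leq_trans (leq_mul lZ (leqnn K)).
by rewrite mulSn addnC ltn_add2r.
Qed.

(** * Back to rooted graphs *)

Section Bridge.
Variable G : rooted_graph.
Local Notation g := (@adj G).
Local Notation X := (root_set G).
Local Notation Y := (~: root_set G).

Lemma rho_ecount : rho G = ecount g Y.
Proof.
apply: eq_card => e; rewrite !inE; apply/andP/touchingP.
  move=> [/imset2P[x y _]]; rewrite inE => /andP[_ gxy] ->.
  rewrite subUset !sub1set negb_and => /orP[xX|yX]; first by exists x, y; rewrite inE.
  by exists y, x; rewrite inE yX adj_sym setUC.
move=> [x [y [xY gxy ->]]]; rewrite inE in xY; split.
  by apply/imset2P; exists x y; rewrite ?inE.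
by rewrite subUset !sub1set (negPf xY).
Qed.

Lemma nbhd_Y : nbhd g Y \subset X.
Proof. by apply/subsetP=> x /nbhdP[]; rewrite inE negbK. Qed.

(** The separation used here has [P] as the non-roots of its right-hand side and [nbhd g P] as its
    roots. *)
Lemma light_ecount (P : {set G}) : light4 G -> P \subset Y -> #|nbhd g P| < #|X| ->
    ecount g P <= 4 * #|P|.
Proof.
move=> lG sP lt; set A := ~: P; set B := P :|: nbhd g P.
have AB : A :&: B = nbhd g P.
  apply/setP=> x; rewrite !inE; case: (x \in P); rewrite ?andbF //=.
have rs : root_separation A B.
  split; last by rewrite /A -setCS setCK.
  split.
    by apply/setP=> x; rewrite !inE; case: (x \in P).
  move=> x y; rewrite in_setD => /andP[xB]; rewrite in_setC => xP.
  rewrite in_setD => /andP[]; rewrite in_setC negbK => yP _.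
  apply: contra xB => gxy; rewrite in_setU; apply/orP; right.
  by apply/nbhdP; split=> //; exists y; rewrite // adj_sym.
have := lG A B rs; rewrite AB => /(_ lt).
set R := right_hand_side A B.
have cn : nonroots R <= #|P|.
  rewrite /nonroots -(card_imset _ val_inj); apply/subset_leq_card/subsetP=> x /imsetP[y].
  rewrite in_setC in_set AB => yn ->.
  by have : val y \in B := valP y; rewrite in_setU (negPf yn) orbF.
have ce : ecount g P <= rho R.
  pose f (e : {set G}) : {set R} := [set x | val x \in e].
  have sB e : e \in touching g P -> e \subset B.
    move=> /touchingP[x [y [xP gxy ->]]]; rewrite subUset !sub1set !in_setU xP /=.
    case: (boolP (y \in P)) => //= yP; by apply/nbhdP; split=> //; exists x.
  have fK e : e \in touching g P -> [set val x | x in f e] = e.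
    move=> /sB/subsetP eB; apply/setP=> x; apply/imsetP/idP => [[y]|xe].
      by rewrite inE => ye ->.
    by exists (Sub x (eB x xe)); rewrite ?inE SubK.
  have f_inj : {in touching g P &, injective f}.
    by move=> e e' eT e'T E; rewrite -(fK e eT) -(fK e' e'T) E.
  rewrite /ecount -(card_in_imset f_inj); apply/subset_leq_card/subsetP=> d /imsetP[e eT ->].
  have eB := subsetP (sB e eT).
  move: eT => /touchingP[x [y [xP gxy eE]]].
  have xe : x \in e by rewrite eE set21.
  have ye : y \in e by rewrite eE set22.
  pose x' : R := Sub x (eB x xe); pose y' : R := Sub y (eB y ye).
  have fE : f e = [set x'; y'].
    apply/setP=> z; rewrite !inE eE !inE.
    by rewrite -(inj_eq val_inj) -(inj_eq val_inj z y') !SubK.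
  rewrite inE; apply/andP; split.
    by apply/imset2P; exists x' y'; rewrite ?inE //= /induced_adj !SubK.
  apply/subsetPn; exists x'; first by rewrite fE set21.
  by rewrite !inE SubK xP.
rewrite /rho4; lia.
Qed.

Lemma conn_induces (S : {set G}) : conn g S -> induces_connected S.
Proof.
move=> cS x y xS yS.
set R := [rel u v : G | [&& u \in S, v \in S & adj u v]].
have E : [set z in S | connect R x z] = S.
  apply: cS.
  - by apply/subsetP=> z; rewrite inE => /andP[].
  - by apply/set0Pn; exists x; rewrite inE xS connect0.
  move=> a b; rewrite !inE => /andP[aS xa] bS gab; rewrite bS.
  by apply: connect_trans xa (connect1 _); rewrite /R /= aS bS.
by move: yS; rewrite -E inE => /andP[].
Qed.

Section Vampire.
Variables a b : G.
Let V := (bool + {x : G | x \in X})%type.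

(** The vampire with the fewest edges for given exceptional roots, so only the adjacencies
    guaranteed by [fanged] have to be realised: [inl true] stands for [p], missing [a], and
    [inl false] for [q], missing [b]. *)
Definition fang (x y : V) := match x, y with
  | inl i, inl j => i != j
  | inl i, inr s | inr s, inl i => val s != if i then a else b
  | inr _, inr _ => false
  end.

Lemma fang_sym : symmetric fang.
Proof. by case=> [i|s] [j|r] //=; rewrite eq_sym. Qed.

Lemma fang_irr : irreflexive fang.
Proof. by case=> [i|s] //=; rewrite eqxx. Qed.

Definition fanged_graph : rooted_graph :=
  @RootedGraph V fang [set inr s | s in {: {x : G | x \in X}}] fang_sym fang_irr.

Lemma fanged_graph_rootP (x : fanged_graph) : reflect (exists s,
    x = inr s) (x \in root_set fanged_graph).
Proof. by apply: (iffP imsetP) => [[s _ ->]|[s ->]]; exists s. Qed.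

Lemma card_fanged_graph_roots : #|root_set fanged_graph| = #|X|.
Proof.
rewrite card_imset; last by move=> s r [].
by rewrite card_sig; apply: eq_card => x.
Qed.

Lemma fanged_graph_vampire : rooted 5 G -> a \in X -> b \in X -> a != b -> vampire fanged_graph.
Proof.
move=> r5 aX bX ab; split.
- by rewrite card_sum card_bool card_sig -r5.
- by rewrite /rooted card_fanged_graph_roots.
- by move=> x y /fanged_graph_rootP[s ->] /fanged_graph_rootP[r ->].
exists (inl true : fanged_graph), (inl false : fanged_graph); split=> //.
  apply/setP=> x; rewrite !inE; case: x => [[]|s] /=.
  - by apply/negP=> /fanged_graph_rootP[].
  - by apply/negP=> /fanged_graph_rootP[].
  by apply/negbTE; rewrite negbK; apply/fanged_graph_rootP; exists s.
exists (inr (Sub b bX) : fanged_graph), (inr (Sub a aX) : fanged_graph); split.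
- by apply/fanged_graph_rootP; exists (Sub b bX).
- by apply/fanged_graph_rootP; exists (Sub a aX).
- by apply: contra ab => /eqP[->].
- move=> x /fanged_graph_rootP[s ->] ne /=; apply: contra ne => /eqP E.
  by apply/eqP; congr inr; apply: val_inj.
move=> x /fanged_graph_rootP[s ->] ne /=; apply: contra ne => /eqP E.
by apply/eqP; congr inr; apply: val_inj.
Qed.

End Vampire.

Lemma touch_model (A B : {set G}) : touch g A B -> exists x y : G, [/\ x \in A, y \in B &
    adj x y].
Proof. by move/touchP. Qed.

Lemma target_minor : rooted 5 G -> target g Y X ->
  (exists W : rooted_graph, vampire W /\ rooted_minor W G) \/ rooted_minor K2down5 G.
Proof.
move=> r5 [p [q [M [[[p0 q0 _ _ dpq] [cp cq] HM dM] fan]]]].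
have X1 : 1 < #|X| by rewrite (r5 : #|X| = 5).
have [a [b [aX bX ab [pa qb pq]]]] := fanged_in X1 fan.
have M0 s : s \in X -> M s != set0.
  by move=> /HM[sM _ _ _ _]; apply/set0Pn; exists s.
case: pq => [pq|all]; [left|right].
  exists (fanged_graph a b); split; first exact: fanged_graph_vampire.
  split; first exact: card_fanged_graph_roots.
  pose mu (x : fanged_graph a b) : {set G} := match x with inl i =>
      if i then p else q | inr s => M (val s) end.
  exists (fun x : fanged_graph a b => match x with inl _ => a | inr s => val s end), mu.
  split.
  - move=> x y /fanged_graph_rootP[s ->] /fanged_graph_rootP[r ->] E; congr inr; exact: val_inj.
  - apply/setP=> x; apply/imsetP/idP => [[y /fanged_graph_rootP[s ->] ->]|xX];
      first exact: valP.
    by exists (inr (Sub x xX)); rewrite ?SubK //; apply/fanged_graph_rootP; exists (Sub x xX).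
  - split.
    + by case=> [[]|s] //=; apply: M0; exact: valP.
    + case=> [[]|s] /=; apply: conn_induces => //.
      by have [] := HM _ (valP s).
    + case=> [[]|s] [[]|r] //= ne.
      * by have [] := HM _ (valP r).
      * by rewrite disjoint_sym.
      * by have [] := HM _ (valP r).
      * by rewrite disjoint_sym; have [] := HM _ (valP s).
      * by rewrite disjoint_sym; have [] := HM _ (valP s).
      apply: dM; try exact: valP.
      by apply: contra ne => /eqP E; apply/eqP; congr inr; exact: val_inj.
    case=> [[]|s] [[]|r] //= ne; apply: touch_model => //.
    + by apply: pa => //; exact: valP.
    + by rewrite touch_sym //; exact: adj_sym.
    + by apply: qb => //; exact: valP.
    + by rewrite touch_sym; [apply: pa => //; exact: valP|exact: adj_sym].
    by rewrite touch_sym; [apply: qb => //; exact: valP|exact: adj_sym].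
  by move=> x /fanged_graph_rootP[s ->] /=; have [] := HM _ (valP s).
have c5 : 5 = #|X| by [].
pose e (i : 'I_5) : G := enum_val (cast_ord c5 i).
have eX i : e i \in X by exact: enum_valP.
have e_inj : injective e by move=> i j /enum_val_inj/cast_ord_inj.
have KrootP (x : K2down5) : reflect (exists i, x = inr i) (x \in root_set K2down5).
  by apply: (iffP imsetP) => [[s _ ->]|[s ->]]; exists s.
split.
  by rewrite card_imset ?card_ord //; move=> i j [].
pose mu (x : K2down5) : {set G} := match x with inl i =>
    if i == ord0 then p else q | inr s => M (e s) end.
exists (fun x : K2down5 => match x with inl _ => a | inr s => e s end), mu.
split.
- by move=> x y /KrootP[s ->] /KrootP[r ->] /e_inj ->.
- apply/setP=> x; apply/imsetP/idP => [[y /KrootP[s ->] ->]|xX]; first exact: eX.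
  exists (inr (cast_ord (esym c5) (enum_rank_in xX x))).
    by apply/KrootP; eexists.
  by rewrite /e cast_ordKV enum_rankK_in.
- split.
  + by case=> [i|s] /=; [case: ifP|exact: M0].
  + case=> [i|s] /=; apply: conn_induces; first by case: ifP.
    by have [] := HM _ (eX s).
  + have ord2 (i j : 'I_2) : i != j -> (i == ord0) != (j == ord0).
      by case: i j => [[|[|i]] Hi] [[|[|j]] Hj].
    case=> [i|s] [j|r] //= ne.
    * have := ord2 i j; rewrite (_ : i != j) => [/(_ isT)|]; last by apply: contra ne =>
        /eqP ->.
      by case: (i == ord0); case: (j == ord0) => // _; rewrite disjoint_sym.
    * by have [_ _ _ d1 d2] := HM _ (eX r); case: ifP.
    * by have [_ _ _ d1 d2] := HM _ (eX s); rewrite disjoint_sym; case: ifP.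
    by apply: dM => //; apply: contra ne => /eqP/e_inj ->.
  case=> [i|s] [j|r] //= _; apply: touch_model.
  + by have [tp tq] := all _ (eX r); case: ifP.
  have [tp tq] := all _ (eX s); rewrite touch_sym; last exact: adj_sym.
  by case: ifP.
by move=> x /KrootP[s ->] /=; have [] := HM _ (eX s).
Qed.

End Bridge.

Theorem theorem2p9 (G : rooted_graph) (hroots : rooted 5 G) (hlight : light4 G)
    (hheavy : quite_heavy G) :
  (exists W : rooted_graph, vampire W /\ rooted_minor W G) \/
  rooted_minor K2down5 G.
Proof.
have gS : symmetric (@adj G) by exact: adj_sym.
have gI : irreflexive (@adj G) by exact: adj_irr.
set Y := ~: root_set G.
have hY : 4 * #|Y| < ecount (@adj G) Y.
  move: hheavy; rewrite /quite_heavy /rho4 rho_ecount /nonroots -/Y.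
  by case=> [|[]]; lia.
(* A root without neighbours in [Y] would leave [Y] with fewer than five neighbours, and a heavy [Y]
   would then violate lightness. *)
have nbE : nbhd (@adj G) Y = root_set G.
  apply/eqP; rewrite eqEcard nbhd_Y leqNgt; apply/negP=> lt.
  by have := light_ecount hlight (subxx _) lt; rewrite leqNgt hY.
apply: target_minor => //; have := @heavy_target _ _ Y gS gI; rewrite nbE; apply.
- by rewrite (hroots : #|root_set G| = 5).
- by move=> P sP; rewrite nbE; exact: light_ecount.
rewrite /qheavy; move: hheavy; rewrite /quite_heavy /rho4 rho_ecount /nonroots -/Y =>
    -[h2|[h1 nf]].
  left; lia.
right; split=> // y yY; rewrite nbE ltnNge; apply/negP=> c5; apply: nf.
exists y; first by move: yY; rewrite inE.
have E : nbrs (@adj G) y :&: root_set G == root_set G.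
  by rewrite eqEcard subsetIr (hroots : #|root_set G| = 5).
move=> x; rewrite -(eqP E) in_setI nbrsE => /andP[] //.
Qed.
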